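(* Let $\pi,\psi\in\Pi$ be such that $\overline{\chi(\pi)}\neq\overline{\chi(\psi)}$. Then $$\operatorname{Ext}^1_{\mathcal J_{int}^+}(X_\pi^{\mathbf g},X_\psi^{\mathbf s})=0\qquad\text{for all }\mathbf g,\mathbf s\in\mathbb Z_0^k.$$ In particular, if $V$ is linked to $X_\pi^{\mathbf g}$ (for some $\mathbf g\in\mathbb Z^k_0$) and $\overline{\chi(\pi)}\neq\overline{\chi(\psi)}$, then $\operatorname{Ext}^1_{\mathcal J_{int}^+}(V,X_\psi^{\mathbf s})=0$ for all $\mathbf s\in\mathbb Z_0^k$.
   Context: Notation for $\mathfrak g_{fin}$. $\mathfrak g_{fin}$ is a finite-dimensional simple complex Lie algebra of rank $n$ with Cartan subalgebra $\mathfrak h_{fin}$, root system $R_{fin}$, simple roots $\alpha_1,\dots,\alpha_n$, root lattice $Q_{fin}$, weight lattice $P_{fin}$, highest root $\theta$; $\Gamma=P_{fin}/Q_{fin}$. The form $(\cdot|\cdot)$ is normalized so that long roots have square length $2$. Toroidal algebra. For $k\in\mathbb N$, $\mathcal T_k(\mathfrak g)=\mathfrak g_{fin}\otimes\mathbb C[t_1^{\pm1},\dots,t_k^{\pm1}]\oplus\mathcal Z_k\oplus D_k$, where $\mathcal Z_k$ is spanned by symbols $t^{\mathbf m}K_i$ ($\mathbf m\in\mathbb Z^k$, $1\le i\le k$) subject to $\sum_i r_i t^{\mathbf r}K_i=0$ for all $\mathbf r\in\mathbb Z^k$, and $D_k$ is spanned by $d_1,\dots,d_k$. Brackets: $[x\otimes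 t^{\mathbf m},y\otimes t^{\mathbf s}]=[x,y]\otimes t^{\mathbf m+\mathbf s}+(x|y)\sum_i m_i t^{\mathbf m+\mathbf s}K_i$, $\mathcal Z_k$ commutes with $\mathfrak g_{fin}\otimes\mathbb C[t_1^{\pm1},\dots,t_k^{\pm1}]$ and itself, $[d_i,x\otimes t^{\mathbf m}]=m_i x\otimes t^{\mathbf m}$, $[d_i,t^{\mathbf m}K_j]=m_it^{\mathbf m}K_j$, $[d_i,d_j]=0$. Write $K_i=t^{\mathbf 0}K_i$ and $\mathfrak h_{tor}=\mathfrak h_{fin}\oplus\bigoplus_i\mathbb CK_i\oplus D_k$. A module is integrable if it is $\mathfrak h_{tor}$-diagonalizable and all $x_\alpha\otimes t^{\mathbf m}$ ($x_\alpha$ a root vector of $\mathfrak g_{fin}$, $\mathbf m\in\mathbb Z^k$) act locally nilpotently. $\mathbb Z_0^k=\{\mathbf m\in\mathbb Z^k:m_1=0\}$. Category. Throughout, modules are assumed to have integer eigenvalues for all $d_i$ (so only $\pi$ for which this holds are considered). For $m>0$, $\mathcal J_{int}^m$ is the category of integrable $\mathcal T_k(\mathfrak g)$-modules of finite length with finite-dimensional $\mathfrak h_{tor}$-weight spaces on which $K_1$ acts by $m$ and $K_2,\dots,K_k$ act by $0$; $\mathcal J_{int}^+=\bigoplus_{m>0}\mathcal J_{int}^m$ (an abelian category; $\operatorname{Ext}^1$ is the group of extensions in it). Two indecomposable objects $U,V$ are linked, $U\sim V$, if there are indecomposable objects $U=U_1,\dots,U_r=V$ of $\mathcal J_{int}^+$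 with $\operatorname{Hom}(U_i,U_{i+1})\ne0$ or $\operatorname{Hom}(U_{i+1},U_i)\neq0$ for $1\le i\le r-1$. Affine algebra. $\mathfrak g_{aff}=\mathcal T_1(\mathfrak g)=\mathfrak g_{fin}\otimes\mathbb C[t_1^{\pm1}]\oplus\mathbb CK_1\oplus\mathbb Cd_1$, $\mathfrak h_{aff}=\mathfrak h_{fin}\oplus\mathbb CK_1\oplus\mathbb Cd_1$; fundamental weights $\Lambda_1,\dots,\Lambda_{n+1}$ ($\Lambda_{n+1}$ attached to the affine node $\alpha_{n+1}=\delta_1-\theta$, $\alpha_{n+1}^\vee=K_1-\theta^\vee$), with $\Lambda_i(\alpha_j^\vee)=\delta_{ij}$, $\Lambda_i(d_1)=0$; $\delta_1$ vanishes on $\mathfrak h_{fin}\oplus\mathbb CK_1$ and $\delta_1(d_1)=1$. $P_{aff}^+=\sum_{i=1}^{n+1}\mathbb Z_+\Lambda_i+\mathbb C\delta_1$. $X(\lambda)$ is the irreducible integrable highest weight $\mathfrak g_{aff}$-module of highest weight $\lambda\in P_{aff}^+$. Simple modules. $\Pi$ is the set of finitely supported functions $\pi:\max\mathbb C[t_2^{\pm1},\dots,t_k^{\pm1}]\to P_{aff}^+$, $\operatorname{supp}(\pi)=\{M:\pi(M)\ne0\}$. For $\pi$ with support $\{M_1,\dots,M_l\}$ put $X_\pi=X(\pi(M_1))\otimes\cdots\otimes X(\pi(M_l))$, on which $Y\otimes f$ ($Y\in\mathfrak g_{fin}\otimes\mathbb C[t_1^{\pm1}]\oplus\mathbb CK_1$,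 $f\in\mathbb C[t_2^{\pm1},\dots,t_k^{\pm1}]$) acts by $\sum_i \mathrm{ev}_{M_i}(f)\,1\otimes\cdots\otimes Y\otimes\cdots\otimes1$ ($Y$ in position $i$), $\mathrm{ev}_{M}$ being evaluation at the point of $M$, and $d_1$ acts as usual on the tensor product. $L(X_\pi)=X_\pi\otimes\mathbb C[t_2^{\pm1},\dots,t_k^{\pm1}]$ is the $\mathcal T_k(\mathfrak g)$-module with $(Y\otimes f)(w\otimes f')=((Y\otimes f)w)\otimes ff'$, $d_1(w\otimes f')=d_1w\otimes f'$, $d_i(w\otimes f')=w\otimes t_i\partial_{t_i}f'$ ($i\ge2$), and $t^{\mathbf r}K_i$ ($i\ge2$, any $\mathbf r$) and $t^{\mathbf r}K_1$ ($r_1\neq0$) acting by $0$. With $v_\pi$ the tensor product of highest weight vectors, $X_\pi^{\mathbf g}=\mathcal U(\mathcal T_k(\mathfrak g))(v_\pi\otimes t^{\mathbf g})$ for $\mathbf g\in\mathbb Z_0^k$. These are irreducible and every irreducible object of $\mathcal J_{int}^+$ is isomorphic to some $X_\pi^{\mathbf g}$. In the statement $\pi,\psi$ are such that $X_\pi^{\mathbf g},X_\psi^{\mathbf s}$ lie in $\mathcal J_{int}^+$. Spectral characters. $\Xi$ is the group of finitely supported functions $\xi:\max\mathbb C[t_2^{\pm1},\dots,t_k^{\pm1}]\to\mathbb Z\times\Gamma$. $(\mathbb C^* )^{k-1}$ acts on maximal ideals via the automorphisms $t_i\mapsto b_it_i$ ($\mathbf b.M$ is the image of $M$) and on $\Xi$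 by $(\mathbf b.\xi)(M)=\xi(\mathbf b.M)$; $\bar\xi$ denotes the orbit of $\xi$. For $\pi\in\Pi$, $\chi(\pi)\in\Xi$ is given by $\chi(\pi)(M)=(\pi(M)(K_1),\ \pi(M)|_{\mathfrak h_{fin}}\bmod Q_{fin})$ (which is $(0,0)$ off $\operatorname{supp}(\pi)$). *)

(* Defs.v *)
From HB Require Import structures.
From mathcomp Require Import all_boot all_order all_algebra generic_quotient ring_quotient finmap.
From mathcomp Require Import all_classical reals complex.

Set Implicit Arguments.
Unset Strict Implicit.
Unset Printing Implicit Defensive.

Import Order.TTheory GRing.Theory Num.Theory.
Local Open Scope classical_set_scope.
Local Open Scope ring_scope.
Local Open Scope quotient_scope.

(** * Linear algebra *)

Section LinearFunctions.
Variables (C : fieldType) (W W' : lmodType C) (g : W -> W').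
Hypothesis glin : linear g.

Lemma lin0 : g 0 = 0.
Proof. by have := glin (-1) 0 0; rewrite scaler0 addr0 scaleN1r addNr. Qed.

Lemma linZ a u : g (a *: u) = a *: g u.
Proof. by rewrite -[a *: u]addr0 glin lin0 addr0. Qed.

Lemma linD u v : g (u + v) = g u + g v.
Proof. by rewrite -[u]scale1r glin !scale1r. Qed.

Lemma linB u v : g (u - v) = g u - g v.
Proof. by rewrite addrC -scaleN1r glin scaleN1r addrC. Qed.

Lemma lin_sum (J : Type) (s : seq J) (F : J -> W) :
  g (\sum_(i <- s) F i) = \sum_(i <- s) g (F i).
Proof.
elim: s => [|i s IH]; first by rewrite !big_nil lin0.
by rewrite !big_cons linD IH.
Qed.

End LinearFunctions.

(** ** Finitely supported functions *)

Section Fsupp.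
Variables (C : fieldType) (I : choiceType) (V : lmodType C).

Definition fsupp_pred : {pred I -> V} :=
  fun f => `[< finite_set [set i | f i != 0] >].

Lemma fsupp_subsemimod : subsemimod_closed fsupp_pred.
Proof.
split; first split.
- apply/asboolP; suff -> : [set i | (0 : I -> V) i != 0] = set0 by [].
  by rewrite -subset0 => i /=; rewrite eqxx.
- move=> f g /asboolP ff /asboolP fg; apply/asboolP.
  apply: (@sub_finite_set _ _ ([set i | f i != 0] `|` [set i | g i != 0])).
    move=> i /= fgi; have [fi|fi] := eqVneq (f i) 0; last by left.
    by right; apply: contra_neq fgi => gi; rewrite [LHS]/GRing.add /= fi gi addr0.
  by rewrite finite_setU.
- move=> a f /asboolP ff; apply/asboolP.
  apply: sub_finite_set ff => i /=; apply: contra_neq => fi.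
  by rewrite [LHS]/GRing.scale /= fi scaler0.
Qed.

HB.instance Definition _ :=
  GRing.isSubmodClosed.Build C (I -> V) fsupp_pred fsupp_subsemimod.

Record fsupp := Fsupp { fsfun_of :> I -> V; _ : fsfun_of \in fsupp_pred }.

HB.instance Definition _ := [isSub for fsfun_of].
HB.instance Definition _ := [Choice of fsupp by <:].
HB.instance Definition _ := [SubChoice_isSubLmodule of fsupp by <:].

Definition fsset (f : fsupp) : {fset I} := fset_set [set i | f i != 0].

Lemma in_fsset f i : (i \in fsset f) = (f i != 0).
Proof.
rewrite in_fset_set; last by case: f => f /= /asboolP.
by apply/idP/idP; rewrite inE.
Qed.

Lemma fsuppP (f g : fsupp) : (forall i, f i = g i) -> f = g.
Proof. by move=> fg; apply/val_inj/funext => i; exact: fg. Qed.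

Lemma fsuppD (f g : fsupp) i : (f + g) i = f i + g i. Proof. by []. Qed.
Lemma fsuppZ a (f : fsupp) i : (a *: f) i = a *: f i. Proof. by []. Qed.
Lemma fsupp0 i : (0 : fsupp) i = 0. Proof. by []. Qed.

Lemma fsupp_sum (J : Type) (r : seq J) (P : pred J) (F : J -> fsupp) i :
  (\sum_(j <- r | P j) F j) i = \sum_(j <- r | P j) F j i.
Proof. by elim/big_rec2: _ => // j y1 y2 _ <-. Qed.

Lemma fsdelta_subproof (i : I) (v : V) :
  (fun j => if j == i then v else 0) \in fsupp_pred.
Proof.
apply/asboolP/(@sub_finite_set _ _ [set i]) => [j /=|]; last exact: finite_set1.
by have [//|_] := eqVneq j i; rewrite eqxx.
Qed.

(* [fsdelta i v] takes the value [v] at [i] and is zero elsewhere *)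
Definition fsdelta (i : I) (v : V) : fsupp := Fsupp (fsdelta_subproof i v).

Lemma fsdeltaE i v j : fsdelta i v j = if j == i then v else 0.
Proof. by []. Qed.

Lemma fsdelta_linear i : linear (fsdelta i).
Proof.
move=> a u v; apply: fsuppP => j; rewrite fsuppD fsuppZ !fsdeltaE.
by case: ifP; rewrite // scaler0 addr0.
Qed.

Lemma fsupp_decomp (f : fsupp) : f = \sum_(i <- fsset f) fsdelta i (f i).
Proof.
apply: fsuppP => j; rewrite fsupp_sum; have [jf|jf] := boolP (j \in fsset f).
  rewrite (big_fsetD1 j) //= eqxx big1_fset ?addr0 // => i.
  by rewrite !inE => /andP[/negPf ij _] _; rewrite eq_sym ij.
rewrite big1_fset; first by move: jf; rewrite in_fsset negbK => /eqP.
by move=> i ifs _; rewrite fsdeltaE; case: eqP => // ji; rewrite ji ifs in jf.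
Qed.

Section Lift.
Variables (W : lmodType C) (F : I -> V -> W).

(* the linear extension to [fsupp] of the linear maps [F i : V -> W] *)
Definition fslift (f : fsupp) : W := \sum_(i <- fsset f) F i (f i).

Hypothesis Flin : forall i, linear (F i).

Let F0 i : F i 0 = 0. Proof. exact: lin0 (Flin i). Qed.

Lemma fslift_sup (A : {fset I}) (f : fsupp) : {subset fsset f <= A} ->
  fslift f = \sum_(i <- A) F i (f i).
Proof.
move=> fA; rewrite /fslift; apply: big_fset_incl; first exact/fsubsetP.
by move=> i _; rewrite in_fsset negbK => /eqP ->; exact: F0.
Qed.

Lemma fslift_linear : linear fslift.
Proof.
move=> a f g; pose A := (fsset f `|` fsset g `|` fsset (a *: f + g)%R)%fset.
rewrite !(@fslift_sup A); try by move=> i iA; rewrite !inE iA ?orbT.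
by rewrite scaler_sumr -big_split /=; apply: eq_bigr => i _; rewrite -Flin.
Qed.

Lemma fslift_delta i v : fslift (fsdelta i v) = F i v.
Proof.
rewrite (@fslift_sup [fset i]%fset); first by rewrite big_seq_fset1 fsdeltaE eqxx.
by move=> j; rewrite in_fsset fsdeltaE !inE; case: (j == i) => //; rewrite eqxx.
Qed.

End Lift.

Lemma fsupp_ext (W : lmodType C) (g h : fsupp -> W) : linear g -> linear h ->
  (forall i v, g (fsdelta i v) = h (fsdelta i v)) ->
  forall f, g f = h f.
Proof.
move=> glin hlin gh f; rewrite (fsupp_decomp f) (lin_sum glin) (lin_sum hlin).
by apply: eq_bigr => i _; exact: gh.
Qed.

End Fsupp.

(** ** Subspaces *)

Section Subspaces.
Variables (C : fieldType) (V : lmodType C).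

Definition is_subspace (W : set V) : Prop :=
  W 0 /\ forall (a : C) u v, W u -> W v -> W (a *: u + v).

Definition span_pred (S : set V) : {pred V} :=
  fun v => `[< forall W : set V, is_subspace W -> S `<=` W -> W v >].

Lemma span_subsemimod S : subsemimod_closed (span_pred S).
Proof.
split; first split.
- by apply/asboolP => W [].
- move=> u v /asboolP Su /asboolP Sv; apply/asboolP => W Wsub SW.
  by rewrite -[u]scale1r; apply: Wsub.2; [exact: Su|exact: Sv].
- move=> a u /asboolP Su; apply/asboolP => W Wsub SW.
  by rewrite -[_ *: _]addr0; apply: Wsub.2; [exact: Su|exact: Wsub.1].
Qed.

HB.instance Definition _ S :=
  GRing.isSubmodClosed.Build C V (span_pred S) (span_subsemimod S).

Lemma span_sub (S : set V) v : S v -> v \in span_pred S.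
Proof. by move=> Sv; apply/asboolP => W _; apply. Qed.

Lemma span_min (S W : set V) : is_subspace W -> S `<=` W ->
  forall v, v \in span_pred S -> W v.
Proof. by move=> Wsub SW v /asboolP; apply. Qed.

End Subspaces.

(** ** Quotient of a vector space by the span of a subset *)

Section LmodQuotient.
Variables (C : fieldType) (V : lmodType C) (G : set V).

Definition lquot := Quotient.quot (span_pred G).
HB.instance Definition _ := Choice.on lquot.
HB.instance Definition _ := GRing.Zmodule.on lquot.
HB.instance Definition _ := EqQuotient.on lquot.

Lemma lquot_eqP (x y : V) : (\pi_lquot x = \pi_lquot y) <-> (x - y \in span_pred G).
Proof. by rewrite Quotient.idealrBE; split=> [xy|/eqP]; first exact/eqP. Qed.

Lemma pi_lquotD (x y : V) : \pi_lquot (x + y) = \pi_lquot x + \pi_lquot y.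
Proof. exact: (raddfD (\pi_(Quotient.quot (span_pred G)))). Qed.

Definition lquot_scale (a : C) (x : lquot) : lquot := \pi_lquot (a *: repr x).

Lemma lquot_scaleE a v : lquot_scale a (\pi_lquot v) = \pi_lquot (a *: v).
Proof.
by apply/lquot_eqP; rewrite -scalerBr rpredZ //; apply/lquot_eqP; rewrite reprK.
Qed.

Fact lquot_scaleA a b v : lquot_scale a (lquot_scale b v) = lquot_scale (a * b) v.
Proof. by elim/quotW: v => v; rewrite (lquot_scaleE b) !lquot_scaleE scalerA. Qed.
Fact lquot_scale1 : left_id 1 lquot_scale.
Proof. by move=> v; elim/quotW: v => v; rewrite lquot_scaleE scale1r. Qed.
Fact lquot_scaleDr : right_distributive lquot_scale +%R.
Proof.
move=> a u v; elim/quotW: u => u; elim/quotW: v => v.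
by rewrite -pi_lquotD !lquot_scaleE scalerDr pi_lquotD.
Qed.
Fact lquot_scaleDl v : {morph lquot_scale^~ v : a b / a + b}.
Proof. by move=> a b; elim/quotW: v => v; rewrite !lquot_scaleE scalerDl pi_lquotD. Qed.

HB.instance Definition _ := GRing.Zmodule_isLmodule.Build C lquot
  lquot_scaleA lquot_scale1 lquot_scaleDr lquot_scaleDl.

Definition lproj (v : V) : lquot := \pi_lquot v.

Lemma lproj_linear : linear lproj.
Proof. by move=> a u v; rewrite /lproj pi_lquotD -lquot_scaleE. Qed.

Lemma lproj_eqP (x y : V) : (lproj x = lproj y) <-> (x - y \in span_pred G).
Proof. exact: lquot_eqP. Qed.

End LmodQuotient.

(** ** Tensor products of finite families *)

Section Tensor.
Variables (C : fieldType) (I : choiceType) (V : I -> lmodType C).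

Definition multilinear (W : lmodType C) (f : (forall i, V i) -> W) : Prop :=
  forall (v : forall i, V i) (i : I), linear (fun x : V i => f (eqtype.dfwith v x)).

Definition tens_free := fsupp {classic (forall i, V i)} C^o.
HB.instance Definition _ := GRing.Lmodule.on tens_free.

Definition tens_gen (v : forall i, V i) : tens_free :=
  @fsdelta C {classic (forall i, V i)} C^o v 1.

Definition tens_rel : set tens_free := [set r | exists v i a (x y : V i),
  r = tens_gen (eqtype.dfwith v (a *: x + y))
      - (a *: tens_gen (eqtype.dfwith v x) + tens_gen (eqtype.dfwith v y))].

Definition tensor := lquot tens_rel.
HB.instance Definition _ := GRing.Lmodule.on tensor.

Definition tpure (v : forall i, V i) : tensor :=
  lproj tens_rel (tens_gen v).

Lemma tpure_multilinear : multilinear tpure.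
Proof.
move=> v i a x y; rewrite /tpure -lproj_linear; apply/lproj_eqP.
by apply: span_sub; exists v, i, a, x, y.
Qed.

Section TensLift.
Variables (W : lmodType C) (f : (forall i, V i) -> W).

Definition tens_free_lift : tens_free -> W :=
  @fslift C {classic (forall i, V i)} C^o W (fun v c => c *: f v).

(* the linear map induced by the multilinear map [f] *)
Definition tens_lift (t : tensor) : W := tens_free_lift (repr t).

Lemma tens_free_lift_linear : linear tens_free_lift.
Proof.
by apply: fslift_linear => v a x y; rewrite scalerDl scalerA.
Qed.

Lemma tens_free_lift_gen v : tens_free_lift (tens_gen v) = f v.
Proof.
rewrite [LHS]fslift_delta ?scale1r // => u a x y.
by rewrite scalerDl scalerA.
Qed.

Hypothesis fml : multilinear f.

Lemma tens_lift_proj r : tens_lift (lproj _ r) = tens_free_lift r.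
Proof.
have L := tens_free_lift_linear.
have : repr (lproj tens_rel r) - r \in span_pred tens_rel.
  by apply/lproj_eqP; rewrite /lproj reprK.
move/(@span_min _ _ _ [set r | tens_free_lift r = 0]) => H.
apply/eqP; rewrite -subr_eq0 -(linB L); apply/eqP/H.
  split=> /= [|a u v u0 v0]; last by rewrite L u0 v0 scaler0 addr0.
  exact: lin0 L.
move=> _ [v [i [a [x [y ->]]]]] /=.
rewrite (linB L) L !tens_free_lift_gen.
by rewrite (fml v (i := i)) subrr.
Qed.

Lemma tens_lift_linear : linear tens_lift.
Proof.
move=> a u v; rewrite -[u]reprK -[v]reprK -!/(lproj _ _) -lproj_linear.
by rewrite !tens_lift_proj tens_free_lift_linear.
Qed.

Lemma tens_lift_pure v : tens_lift (tpure v) = f v.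
Proof. by rewrite tens_lift_proj tens_free_lift_gen. Qed.

End TensLift.

Lemma tensor_ext (W : lmodType C) (g h : tensor -> W) : linear g -> linear h ->
  (forall v, g (tpure v) = h (tpure v)) ->
  forall t, g t = h t.
Proof.
move=> glin hlin gh t; rewrite -[t]reprK -/(lproj _ _).
apply: (@fsupp_ext _ _ _ _ (g \o lproj _) (h \o lproj _)).
- by move=> a x y /=; rewrite lproj_linear glin.
- by move=> a x y /=; rewrite lproj_linear hlin.
- move=> v c /=; have -> : fsdelta v c = c *: tens_gen v.
    apply: fsuppP => u.
    rewrite fsuppZ !fsdeltaE; case: ifP => _; last by rewrite scaler0.
    by rewrite /GRing.scale /= mulr1.
  by rewrite (linZ (@lproj_linear _ _ _)) (linZ glin) (linZ hlin) gh.
Qed.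

(* [1 \otimes .. \otimes a \otimes .. \otimes 1] with [a] in position [i] *)
Definition slot (i : I) (a : V i -> V i) : tensor -> tensor :=
  tens_lift (fun v => tpure (eqtype.dfwith v (a (v i)))).

Lemma dfwith_same (v : forall i, V i) i (x y : V i) :
  eqtype.dfwith (eqtype.dfwith v x) y = eqtype.dfwith v y.
Proof.
apply: functional_extensionality_dep => j; case: eqtype.dfwithP => [|{}j ij].
  by rewrite eqtype.dfwith_in.
by rewrite !eqtype.dfwith_out.
Qed.

Lemma dfwith_swap (v : forall i, V i) i j (x : V i) (y : V j) : i != j ->
  eqtype.dfwith (eqtype.dfwith v x) y = eqtype.dfwith (eqtype.dfwith v y) x.
Proof.
move=> ij; apply: functional_extensionality_dep => l.
have [<-|jl] := eqVneq j l.
  by rewrite eqtype.dfwith_in eqtype.dfwith_out // eqtype.dfwith_in.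
rewrite eqtype.dfwith_out //; have [<-|il] := eqVneq i l.
  by rewrite !eqtype.dfwith_in.
by rewrite !eqtype.dfwith_out.
Qed.

Lemma slot_multilinear i (a : V i -> V i) : linear a ->
  multilinear (fun v => tpure (eqtype.dfwith v (a (v i)))).
Proof.
move=> alin v j c x y; have [ij|ij] := eqVneq i j.
  by case: j / ij x y => x y; rewrite !eqtype.dfwith_in !dfwith_same alin tpure_multilinear.
by rewrite !eqtype.dfwith_out 1?eq_sym // ![eqtype.dfwith (eqtype.dfwith _ _) (a _)]dfwith_swap
   1?eq_sym // tpure_multilinear.
Qed.

Lemma slot_pure i (a : V i -> V i) v : linear a ->
  slot a (tpure v) = tpure (eqtype.dfwith v (a (v i))).
Proof. by move=> alin; rewrite /slot tens_lift_pure //; exact: slot_multilinear. Qed.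

Lemma slot_linear i (a : V i -> V i) : linear a -> linear (slot a).
Proof. by move=> alin; apply/tens_lift_linear/slot_multilinear. Qed.

Lemma slot_comp i (a b : V i -> V i) t : linear a -> linear b ->
  slot a (slot b t) = slot (a \o b) t.
Proof.
move=> alin blin.
have ablin : linear (a \o b) by move=> c x y /=; rewrite blin alin.
have [[La Lb] Lab] := (slot_linear alin, slot_linear blin, slot_linear ablin).
move: t; apply: (@tensor_ext _ (slot a \o slot b) (slot (a \o b))) => //.
  by move=> c x y /=; rewrite Lb La.
by move=> v /=; rewrite !slot_pure // eqtype.dfwith_in dfwith_same.
Qed.

Lemma slotC i j (a : V i -> V i) (b : V j -> V j) t : i != j ->
  linear a -> linear b -> slot a (slot b t) = slot b (slot a t).
Proof.
move=> ij alin blin; have [La Lb] := (slot_linear alin, slot_linear blin).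
move: t; apply: (@tensor_ext _ (slot a \o slot b) (slot b \o slot a)).
- by move=> c x y /=; rewrite Lb La.
- by move=> c x y /=; rewrite La Lb.
- move=> v /=; rewrite !slot_pure // !eqtype.dfwith_out //; last by rewrite eq_sym.
  by rewrite dfwith_swap // eq_sym.
Qed.

Lemma slot_lincomb i (a b : V i -> V i) (c : C) t : linear a -> linear b ->
  slot (fun x => c *: a x + b x) t = c *: slot a t + slot b t.
Proof.
move=> alin blin; have [La Lb] := (slot_linear alin, slot_linear blin).
have ablin : linear (fun x => c *: a x + b x).
  move=> d x y; rewrite alin blin !scalerDr !scalerA mulrC.
  by rewrite -!addrA; congr (_ + _); rewrite addrCA.
move: t; apply: (@tensor_ext _ _ (fun t => c *: slot a t + slot b t)).
- exact: slot_linear.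
- move=> d x y; rewrite La Lb !scalerDr !scalerA mulrC.
  by rewrite -!addrA; congr (_ + _); rewrite addrCA.
- move=> v; rewrite !slot_pure //; exact: tpure_multilinear.
Qed.

End Tensor.

Section SlotSum.
Variables (C : fieldType) (I : finType) (V : I -> lmodType C).
Implicit Types (c d : I -> C) (a b : forall i, V i -> V i).

Definition slotsum c a (t : tensor V) : tensor V :=
  \sum_(i : I) c i *: slot (a i) t.

Definition all_linear a := forall i, linear (a i).

Lemma slotsum_linear c a : all_linear a -> linear (slotsum c a).
Proof.
move=> alin e x y; rewrite /slotsum scaler_sumr -big_split /=.
apply: eq_bigr => i _; rewrite (slot_linear (@alin i)) scalerDr !scalerA.
by rewrite mulrC.
Qed.

Lemma slotsum_lincomb e c a b t : all_linear a -> all_linear b ->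
  slotsum c (fun i x => e *: a i x + b i x) t
  = e *: slotsum c a t + slotsum c b t.
Proof.
move=> alin blin; rewrite /slotsum scaler_sumr -big_split /=.
apply: eq_bigr => i _; rewrite (slot_lincomb _ _ (@alin i) (@blin i)).
by rewrite scalerDr !scalerA mulrC.
Qed.

Lemma eq_slotsum c a b t : (forall i x, a i x = b i x) ->
  slotsum c a t = slotsum c b t.
Proof.
move=> ab; apply: eq_bigr => i _; congr (_ *: slot _ t).
by apply/funext => x; exact: ab.
Qed.

Lemma slotsum_comm c d a b t : all_linear a -> all_linear b ->
  slotsum c a (slotsum d b t) - slotsum d b (slotsum c a t)
  = slotsum (fun i => c i * d i) (fun i x => a i (b i x) - b i (a i x)) t.
Proof.
move=> alin blin.
have E c' d' a' b' : all_linear a' -> all_linear b' ->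
    slotsum c' a' (slotsum d' b' t)
    = \sum_i \sum_j (c' i * d' j) *: slot (a' i) (slot (b' j) t).
  move=> a'lin b'lin; apply: eq_bigr => i _; rewrite /slotsum.
  rewrite (lin_sum (slot_linear (@a'lin i))) scaler_sumr.
  by apply: eq_bigr => j _; rewrite (linZ (slot_linear (@a'lin i))) scalerA.
rewrite !E // [X in _ - X]exchange_big -sumrB; apply: eq_bigr => i _ /=.
rewrite -sumrB (bigD1 i) //= big1 ?addr0; last first.
  by move=> j ji; rewrite mulrC (slotC t ji (@blin j) (@alin i)) subrr.
rewrite (mulrC (d i)) -scalerBr; congr (_ *: _).
rewrite !slot_comp //; rewrite addrC -scaleN1r.
rewrite -slot_lincomb; first last.
- by move=> e x y /=; rewrite blin alin.
- by move=> e x y /=; rewrite alin blin.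
by congr slot; apply/funext => x /=; rewrite scaleN1r addrC.
Qed.

End SlotSum.

(** * Laurent polynomials and their maximal ideals *)

(* exponents, elements of $\mathbb Z^k$ *)
Definition zk (k : nat) := {ffun 'I_k -> int}.
HB.instance Definition _ k := GRing.Zmodule.on (zk k).

Section Laurent.
Variables (C : fieldType) (k : nat).

Definition laurent := fsupp (zk k) C^o.
HB.instance Definition _ := GRing.Lmodule.on laurent.

(* the monomial [c t^r] *)
Definition lmono (r : zk k) (c : C) : laurent := @fsdelta C (zk k) C^o r c.

Definition lshift (r : zk k) : laurent -> laurent :=
  fslift (fun s (c : C^o) => lmono (r + s) c).

Definition lmul (f g : laurent) : laurent :=
  fslift (fun r (c : C^o) => c *: lshift r g) f.

Lemma lmono_linear r : linear (lmono r : C^o -> laurent).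
Proof. exact: fsdelta_linear. Qed.

Lemma lshift_linear r : linear (lshift r).
Proof. by apply: fslift_linear => s; exact: lmono_linear. Qed.

Lemma lmul_linearl g : linear (lmul^~ g).
Proof. by apply: fslift_linear => r a x y; rewrite scalerDl scalerA. Qed.

Lemma lmul_mono r c g : lmul (lmono r c) g = c *: lshift r g.
Proof. by rewrite [LHS]fslift_delta // => s a x y; rewrite scalerDl scalerA. Qed.

Lemma lshift_mono r s c : lshift r (lmono s c) = lmono (r + s) c.
Proof. by rewrite [LHS]fslift_delta // => u; exact: lmono_linear. Qed.

Lemma lmul_monom r s c d : lmul (lmono r c) (lmono s d) = lmono (r + s) (c * d).
Proof.
by rewrite lmul_mono lshift_mono -(linZ (@lmono_linear _)).
Qed.

Lemma lmul_linearr f : linear (lmul f).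
Proof.
move=> a g h; move: f; apply: fsupp_ext => [||r c].
- exact: lmul_linearl.
- move=> b x y; rewrite !lmul_linearl !scalerDr !scalerA mulrC.
  by rewrite -!addrA; congr (_ + _); rewrite addrCA.
- rewrite -/(lmono r c) !lmul_mono lshift_linear scalerDr !scalerA.
  by rewrite mulrC.
Qed.

Fact lmulA : associative lmul.
Proof.
move=> f g h; move: f; apply: fsupp_ext => [||r c].
- exact: lmul_linearl.
- by move=> b x y; rewrite !lmul_linearl.
move: g; apply: fsupp_ext => [||s d].
- by move=> b x y; rewrite lmul_linearl lmul_linearr.
- by move=> b x y; rewrite lmul_linearr lmul_linearl.
move: h; apply: fsupp_ext => [||u e].
- by move=> b x y; rewrite !lmul_linearr.
- by move=> b x y; rewrite !lmul_linearr.
by rewrite -!/(lmono _ _) !lmul_monom addrA mulrA.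
Qed.

Fact lmulC : commutative lmul.
Proof.
move=> f g; move: f; apply: fsupp_ext => [||r c].
- exact: lmul_linearl.
- exact: lmul_linearr.
move: g; apply: fsupp_ext => [||s d].
- exact: lmul_linearr.
- exact: lmul_linearl.
by rewrite -!/(lmono _ _) !lmul_monom addrC mulrC.
Qed.

Fact lmul1 : left_id (lmono 0 1) lmul.
Proof.
apply: fsupp_ext => [||s d]; first exact: lmul_linearr; first by [].
by rewrite -/(lmono s d) lmul_monom add0r mul1r.
Qed.

Fact lmulDl : left_distributive lmul +%R.
Proof. by move=> f g h; rewrite (linD (@lmul_linearl _)). Qed.

Fact lone_neq0 : lmono 0 1 != 0 :> laurent.
Proof.
apply/eqP => /(congr1 (fun f : laurent => f 0)); rewrite fsdeltaE eqxx fsupp0.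
by apply/eqP; rewrite oner_eq0.
Qed.

HB.instance Definition _ := GRing.Zmodule_isComNzRing.Build laurent
  lmulA lmulC lmul1 lmulDl lone_neq0.

Lemma lmulE (f g : laurent) : f * g = lmul f g. Proof. by []. Qed.

(* [mono a r] is the product of the [a_i ^ r_i] *)
Definition mono (a : 'I_k -> C) (r : zk k) : C := \prod_(i < k) a i ^ r i.

Lemma monoD a r s : (forall i, a i != 0) -> mono a (r + s) = mono a r * mono a s.
Proof.
by move=> a0; rewrite -big_split; apply: eq_bigr => i _ /=; rewrite ffunE expfzDr.
Qed.

Lemma mono0 a : mono a 0 = 1.
Proof. by rewrite /mono big1 // => i _; rewrite ffunE expr0z. Qed.

(* evaluation at a point of the torus *)
Definition leval (a : 'I_k -> C) (f : laurent) : C :=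
  \sum_(r <- fsset f) f r * mono a r.

Lemma leval_mono a r c : leval a (lmono r c) = c * mono a r.
Proof.
have L s : linear ((fun c => c * mono a s) : C^o -> C^o).
  by move=> e x y; rewrite [LHS]mulrDl; congr (_ + _); rewrite -[LHS]mulrA.
exact: (@fslift_delta C (zk k) C^o C^o _ L).
Qed.

(** ** The maximal spectrum *)

Definition is_ideal (M : set laurent) : Prop :=
  [/\ M 0, forall f g, M f -> M g -> M (f + g) & forall f g, M g -> M (f * g)].

Definition is_maximal_ideal (M : set laurent) : Prop :=
  [/\ is_ideal M, ~ M 1 &
    forall J, is_ideal J -> ~ J 1 -> M `<=` J -> J `<=` M].

Record maxspec := MaxSpec { mideal :> set laurent; _ : is_maximal_ideal mideal }.
HB.instance Definition _ := gen_eqMixin maxspec.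
HB.instance Definition _ := gen_choiceMixin maxspec.

(* The point of the torus at which all elements of [M] vanish (it exists and
   is unique when [C] is algebraically closed). *)
Definition mpoint (M : maxspec) : 'I_k -> C :=
  xget (fun=> 1) [set a : 'I_k -> C |
    (forall i, a i != 0) /\ forall f, mideal M f -> leval a f = 0].

Lemma mpoint_neq0 M i : mpoint M i != 0.
Proof. by rewrite /mpoint; case: xgetP => [a _ [a0 _]|_]; rewrite ?oner_eq0. Qed.

Definition mev (M : maxspec) (f : laurent) : C := leval (mpoint M) f.

Lemma mev_monoD M r s :
  mev M (lmono (r + s) 1) = mev M (lmono r 1) * mev M (lmono s 1).
Proof. by rewrite /mev !leval_mono !mul1r monoD //; exact: mpoint_neq0. Qed.

Lemma mev_mono0 M : mev M (lmono 0 1) = 1.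
Proof. by rewrite /mev leval_mono mono0 mulr1. Qed.

(** ** The action of the torus *)

Definition torus := {b : {ffun 'I_k -> C} | [forall i, b i != 0]}.

Lemma torus_neq0 (b : torus) i : val b i != 0.
Proof. exact: forallP (valP b) i. Qed.

Lemma torus_inv_subproof (b : torus) : [forall i, [ffun j => (val b j)^-1] i != 0].
Proof. by apply/forallP => i; rewrite ffunE invr_eq0 torus_neq0. Qed.

Definition torus_inv (b : torus) : torus :=
  exist (fun b : {ffun 'I_k -> C} => [forall i, b i != 0]) _ (torus_inv_subproof b).

(* the automorphism with [t_i |-> b_i t_i] *)
Definition tscale (b : torus) : laurent -> laurent :=
  fslift (fun r (c : C^o) => lmono r (mono (val b) r * c)).

Lemma tscale_aux (b : torus) r :
  linear ((fun c => lmono r (mono (val b) r * c)) : C^o -> laurent).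
Proof.
move=> e x y; rewrite -lmono_linear; congr lmono.
by rewrite mulrDr; congr (_ + _); exact: mulrCA.
Qed.

Lemma tscale_linear b : linear (tscale b).
Proof. by apply: fslift_linear => r; exact: tscale_aux. Qed.

Lemma tscale_mono b r c : tscale b (lmono r c) = lmono r (mono (val b) r * c).
Proof. by rewrite [LHS]fslift_delta // => s; exact: tscale_aux. Qed.

Lemma tscaleM b f g : tscale b (f * g) = tscale b f * tscale b g.
Proof.
have L := tscale_linear b.
rewrite !lmulE.
move: f; apply: fsupp_ext => [||r c].
- by move=> e x y; rewrite lmul_linearl L.
- by move=> e x y; rewrite L lmul_linearl.
move: g; apply: fsupp_ext => [||s d].
- by move=> e x y; rewrite lmul_linearr L.
- by move=> e x y; rewrite L lmul_linearr.
rewrite -!/(lmono _ _) lmul_monom !tscale_mono lmul_monom.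
congr lmono; rewrite monoD; last exact: torus_neq0.
exact: mulrACA.
Qed.

Lemma tscaleK b : cancel (tscale b) (tscale (torus_inv b)).
Proof.
apply: fsupp_ext => [||r c] //.
  by move=> e x y; rewrite !tscale_linear.
rewrite -/(lmono r c) !tscale_mono mulrA -big_split big1 ?mul1r // => i _ /=.
by rewrite ffunE -expfzMl mulVf ?exp1rz // torus_neq0.
Qed.

Lemma tscaleVK b : cancel (tscale (torus_inv b)) (tscale b).
Proof.
apply: fsupp_ext => [||r c] //.
  by move=> e x y; rewrite !tscale_linear.
rewrite -/(lmono r c) !tscale_mono mulrA -big_split big1 ?mul1r // => i _ /=.
by rewrite ffunE -expfzMl mulfV ?exp1rz // torus_neq0.
Qed.

Lemma tscale1 b : tscale b 1 = 1.
Proof. by rewrite [LHS]tscale_mono mono0 mul1r. Qed.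

Lemma tscale_ideal b (M : set laurent) : is_ideal M -> is_ideal (tscale b @` M).
Proof.
case=> M0 MD MM; split.
- by exists 0; rewrite ?(lin0 (tscale_linear b)).
- move=> _ _ [f Mf <-] [g Mg <-]; exists (f + g); first exact: MD.
  by rewrite (linD (tscale_linear b)).
- move=> f _ [g Mg <-]; exists (tscale (torus_inv b) f * g); first exact: MM.
  by rewrite tscaleM tscaleVK.
Qed.

Lemma tscale_maximal b (M : maxspec) : is_maximal_ideal (tscale b @` mideal M).
Proof.
case: M => /= M [Mid M1 Mmax]; split.
- exact: tscale_ideal.
- by case=> f Mf f1; apply: M1; rewrite -(tscale1 (torus_inv b)) -f1 tscaleK.
- move=> J Jid J1 MJ g Jg; exists (tscale (torus_inv b) g); last exact: tscaleVK.
  apply: (Mmax (tscale (torus_inv b) @` J)); first exact: tscale_ideal.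
  + case=> f Jf f1; apply: J1.
    by rewrite -(tscale1 b) -f1 tscaleVK.
  + move=> f Mf; exists (tscale b f); last exact: tscaleK.
    by apply: MJ; exists f.
  + by exists g.
Qed.

Definition torus_act (b : torus) (M : maxspec) : maxspec :=
  MaxSpec (tscale_maximal b M).

End Laurent.

(** * Finite-dimensional simple Lie algebras *)

Record lieAlgebra (C : fieldType) := LieAlgebra {
  lie_space :> vectType C;
  lbr : lie_space -> lie_space -> lie_space;
  lbr_linearl : forall y, linear (lbr^~ y);
  lbr_linearr : forall x, linear (lbr x);
  lbrxx : forall x, lbr x x = 0;
  lbr_jacobi : forall x y z,
    lbr x (lbr y z) + lbr y (lbr z x) + lbr z (lbr x y) = 0
}.

Section LieNotions.
Variables (C : fieldType) (g : lieAlgebra C).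

Definition is_lie_ideal (U : {vspace g}) : Prop :=
  forall x u : g, u \in U -> lbr x u \in U.

Definition is_simple_lie : Prop :=
  (exists x y : g, lbr x y != 0) /\
  forall U : {vspace g}, is_lie_ideal U -> U = 0%VS \/ U = fullv.

(* a nilpotent subalgebra equal to its own normalizer *)
Definition is_cartan (h : {vspace g}) : Prop :=
  [/\ forall x y : g, x \in h -> y \in h -> lbr x y \in h,
      exists N : nat, forall (s : seq g) (y : g), size s = N ->
        {subset s <= h} -> y \in h -> foldr (@lbr _ g) y s = 0 &
      forall x : g, (forall y : g, y \in h -> lbr x y \in h) -> x \in h].

Variable h : {vspace g}.

Definition hdual := 'Hom(subvs_of h, C^o).

Definition root_vector (al : hdual) : set g :=
  [set x | forall t : subvs_of h, lbr (vsval t) x = al t *: x].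

Definition is_root (al : hdual) : Prop :=
  al != 0 /\ exists x, x != 0 /\ root_vector al x.

Definition is_coroot (al : hdual) (t : subvs_of h) : Prop :=
  al t = 2 /\ exists x y,
    [/\ root_vector al x, root_vector (- al) y & vsval t = lbr x y].

(* the coroot of the root [al] (it exists and is unique when [g] is simple over
   an algebraically closed field of characteristic 0 and [h] is Cartan) *)
Definition coroot (al : hdual) : subvs_of h := xget 0 [set t | is_coroot al t].

Section Base.
Variables (n : nat) (al : 'I_n -> hdual).

Definition is_simple_roots : Prop :=
  [/\ forall i, is_root (al i),
      free [seq al i | i <- enum 'I_n] &
      forall be, is_root be -> exists c : 'I_n -> nat,
        be = \sum_i al i *+ c i \/ be = - \sum_i al i *+ c i].

Definition is_positive_root (be : hdual) : Prop :=
  is_root be /\ exists c : 'I_n -> nat, be = \sum_i al i *+ c i.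

Definition is_highest_root (th : hdual) : Prop :=
  is_root th /\ forall be, is_root be ->
    exists c : 'I_n -> nat, th - be = \sum_i al i *+ c i.

End Base.

Definition is_invariant_form (B : g -> g -> C) : Prop :=
  [/\ forall y, linear (B^~ y : g -> C^o), forall x y, B x y = B y x &
      forall x y z, B (lbr x y) z = B x (lbr y z)].

(* [u] in [h] corresponds to [al] under the identification of [h] with its
   dual given by the form, so that the square length of [al] is [B u u] *)
Definition represents (B : g -> g -> C) (al : hdual) (u : subvs_of h) : Prop :=
  forall t, B (vsval u) (vsval t) = al t.

End LieNotions.

(* the long roots have square length 2, i.e. the maximum of the square lengths
   of the roots is 2 *)
Definition is_normalized_form (C : numFieldType) (g : lieAlgebra C)
    (h : {vspace g}) (B : g -> g -> C) : Prop :=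
  (forall (al : hdual h) u, is_root al -> represents B al u ->
     B (vsval u) (vsval u) <= 2) /\
  (exists (al : hdual h) u, [/\ is_root al, represents B al u &
     B (vsval u) (vsval u) = 2]).

Record simpleLie (R : realType) := SimpleLie {
  gfin :> lieAlgebra R[i];
  gfin_simple : is_simple_lie gfin;
  hfin : {vspace gfin};
  hfin_cartan : is_cartan hfin;
  simple_root : 'I_(\dim hfin) -> hdual hfin;
  simple_rootP : is_simple_roots simple_root;
  theta : hdual hfin;
  thetaP : is_highest_root simple_root theta;
  form : gfin -> gfin -> R[i];
  form_invariant : is_invariant_form form;
  form_normalized : is_normalized_form hfin form
}.

Section Lattices.
Variables (R : realType) (G : simpleLie R).
Local Notation C := R[i].
Local Notation h := (hfin G).
Local Notation n := (\dim (hfin G)).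
Local Notation alpha := (@simple_root R G).

(** ** The lattices and the group P/Q *)

Definition Pfin_pred : {pred hdual h} :=
  fun la => `[< forall i, exists z : int, la (coroot (alpha i)) = z%:~R >].

Lemma Pfin_zmod_closed : zmod_closed Pfin_pred.
Proof.
split; first by apply/asboolP => i; exists 0; rewrite lfunE.
move=> x y /asboolP Px /asboolP Py; apply/asboolP => i.
have [[a xa] [b yb]] := (Px i, Py i); exists (a - b).
by rewrite add_lfunE opp_lfunE xa yb intrB.
Qed.

HB.instance Definition _ := GRing.isZmodClosed.Build (hdual h) Pfin_pred Pfin_zmod_closed.

Record Pfin := PfinElt { Pfin_val :> hdual h; _ : Pfin_val \in Pfin_pred }.
HB.instance Definition _ := [isSub for Pfin_val].
HB.instance Definition _ := [Choice of Pfin by <:].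
HB.instance Definition _ := [SubChoice_isSubZmodule of Pfin by <:].

(* the root lattice, as a subgroup of the weight lattice *)
Definition Qfin_pred : {pred Pfin} :=
  fun la => `[< exists c : 'I_n -> int, Pfin_val la = \sum_i alpha i *~ c i >].

Lemma Qfin_zmod_closed : zmod_closed Qfin_pred.
Proof.
split; first by apply/asboolP; exists (fun=> 0); rewrite big1.
move=> x y /asboolP[a xa] /asboolP[b yb]; apply/asboolP.
exists (fun i => a i - b i); rewrite -[LHS]/(Pfin_val x - Pfin_val y) xa yb -sumrB.
by apply: eq_bigr => i _; rewrite mulrzBr.
Qed.

HB.instance Definition _ := GRing.isZmodClosed.Build Pfin Qfin_pred Qfin_zmod_closed.

Definition Gamma := Quotient.quot Qfin_pred.
HB.instance Definition _ := GRing.Zmodule.on Gamma.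

(** ** Affine weights *)

(* [(t, a, b)] stands for [t + a K_1 + b d_1] *)
Definition haff := (subvs_of h * C^o * C^o)%type.
HB.instance Definition _ := Vector.on haff.
Definition haff_dual := 'Hom(haff, C^o).

Definition haff_h (t : subvs_of h) : haff := (t, 0, 0).
Definition haff_K : haff := (0, 1, 0).
Definition haff_d : haff := (0, 0, 1).

(* the index [ord_max] is the affine node *)
Definition aff_coroot (i : 'I_n.+1) : haff :=
  if unlift ord_max i is Some j then haff_h (coroot (alpha j))
  else haff_K - haff_h (coroot (theta G)).

Definition delta1 : haff_dual := linfun (snd : haff -> C^o).

Definition is_fundamental (La : 'I_n.+1 -> haff_dual) : Prop :=
  forall i, (forall j, La i (aff_coroot j) = (i == j)%:R) /\ La i haff_d = 0.

Definition Paff_plus (la : haff_dual) : Prop :=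
  exists La, is_fundamental La /\
  exists (m : 'I_n.+1 -> nat) (c : C), la = \sum_i La i *+ m i + c *: delta1.

Fact haff_h_linear : linear haff_h.
Proof. by move=> a x y; congr (_, _, _); rewrite [RHS]addr0 [RHS]mulr0. Qed.
HB.instance Definition _ := GRing.isLinear.Build C _ _ _ haff_h haff_h_linear.

Definition restr_h (la : haff_dual) : hdual h := (la \o linfun haff_h)%VF.

Lemma restr_hE la t : restr_h la t = la (haff_h t).
Proof. by rewrite comp_lfunE lfunE. Qed.

Lemma Paff_plus_restr la : Paff_plus la -> restr_h la \in Pfin_pred.
Proof.
case=> La [fundLa [m [c ->]]]; apply/asboolP => j.
exists (m (lift ord_max j))%:Z; rewrite restr_hE.
have -> : haff_h (coroot (alpha j)) = aff_coroot (lift ord_max j).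
  by rewrite /aff_coroot liftK.
rewrite add_lfunE scale_lfunE sum_lfunE (bigD1 (lift ord_max j)) //= big1; last first.
  by move=> i /negPf ij; rewrite -scaler_nat scale_lfunE (fundLa i).1 ij scaler0.
rewrite -scaler_nat scale_lfunE (fundLa _).1 eqxx lfunE /aff_coroot liftK /=.
by rewrite scaler0 !addr0 [LHS]mulr1.
Qed.

End Lattices.

(** * Toroidal Lie algebras and their modules *)

Section Toroidal.
Variables (R : realType) (G : simpleLie R).
Local Notation C := R[i].
Local Notation h := (hfin G).

(* The symbols spanning the toroidal algebra in [k] variables: [x (x) t^m],
   [t^m K_i] and [d_i]. *)
Inductive tgen (k : nat) : Type :=
| GX of gfin G & zk k
| GK of zk k & 'I_k
| GD of 'I_k.

Definition comm (V : zmodType) (a b : V -> V) (v : V) : V := a (b v) - b (a v).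

(* The toroidal algebra is given by a spanning set of symbols, the linear
   relations between them and their brackets, so a module is a vector space with
   operators for the symbols that satisfy these linear relations and whose
   commutators are given by the brackets. *)
Record tmod (k : nat) := Tmod {
  tm_space :> lmodType C;
  act : tgen k -> tm_space -> tm_space;
  act_linear : forall u, linear (act u);
  act_X_linear : forall m v, linear (fun x => act (GX x m) v);
  act_K_rel : forall (r : zk k) v, \sum_i (r i)%:~R *: act (GK r i) v = 0;
  act_XX : forall x m y s v, comm (act (GX x m)) (act (GX y s)) v =
    act (GX (lbr x y) (m + s)) v
    + form x y *: \sum_i (m i)%:~R *: act (GK (m + s) i) v;
  act_KX : forall m i x s v, comm (act (GK m i)) (act (GX x s)) v = 0;
  act_KK : forall m i s j v, comm (act (GK m i)) (act (GK s j)) v = 0;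
  act_DX : forall i x m v, comm (act (GD i)) (act (GX x m)) v =
    (m i)%:~R *: act (GX x m) v;
  act_DK : forall i m j v, comm (act (GD i)) (act (GK m j)) v =
    (m i)%:~R *: act (GK m j) v;
  act_DD : forall i j v, comm (act (GD i)) (act (GD j)) v = 0
}.

(* [submod HW] is the submodule [W] as a module of its own. *)

Section Submodules.
Variables (k : nat) (V : tmod k).

Definition is_submod (W : set V) : Prop :=
  is_subspace W /\ forall u v, W v -> W (act u v).

Definition tgenerated (v : V) : set V :=
  [set w | forall W, is_submod W -> W v -> W w].

Lemma tgenerated_submod v : is_submod (tgenerated v).
Proof.
split; first split.
- by move=> W [[]].
- by move=> a x y xv yv W WS Wv; apply: WS.1.2; [exact: xv|exact: yv].
- by move=> u x xv W WS Wv; apply: WS.2; exact: xv.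
Qed.

Section SubTmod.
Variables (W : set V) (HW : is_submod W).

Definition sub_pred of is_submod W : {pred V} := fun v => `[< W v >].
Local Notation sub := (sub_pred HW).

Lemma sub_pred_closed : subsemimod_closed sub.
Proof.
have [[W0 Wl] _] := HW; split; first split.
- exact/asboolP.
- by move=> x y /asboolP Wx /asboolP Wy; apply/asboolP; rewrite -[x]scale1r; exact: Wl.
- by move=> a x /asboolP Wx; apply/asboolP; rewrite -[_ *: _]addr0; exact: Wl.
Qed.

HB.instance Definition _ := GRing.isSubmodClosed.Build C V sub sub_pred_closed.

Record sub_space := SubElt { sub_val :> V; _ : sub_val \in sub }.
HB.instance Definition _ := [isSub for sub_val].
HB.instance Definition _ := [Choice of sub_space by <:].
HB.instance Definition _ := [SubChoice_isSubLmodule of sub_space by <:].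

Lemma sub_act_subproof u (v : sub_space) : act u (sub_val v) \in sub.
Proof. by case: v => v /= /asboolP Wv; apply/asboolP; apply: HW.2. Qed.

Definition sub_act u (v : sub_space) : sub_space := SubElt (sub_act_subproof u v).

Lemma sub_val_linear : linear sub_val. Proof. by []. Qed.

Lemma sub_val_sum I (F : I -> sub_space) (r : seq I) :
  sub_val (\sum_(i <- r) F i) = \sum_(i <- r) sub_val (F i).
Proof. exact: (lin_sum sub_val_linear). Qed.

Definition submod : tmod k.
Proof.
refine (@Tmod k sub_space sub_act _ _ _ _ _ _ _ _ _).
- by move=> u a x y; apply: val_inj; exact: act_linear.
- by move=> m v a x y; apply: val_inj; exact: act_X_linear.
- by move=> r v; apply: val_inj; rewrite [LHS]sub_val_sum; exact: act_K_rel.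
- move=> x m y s v; apply: val_inj; rewrite [LHS]act_XX; congr (_ + _ *: _).
  by rewrite [RHS]sub_val_sum.
- by move=> *; apply: val_inj; exact: act_KX.
- by move=> *; apply: val_inj; exact: act_KK.
- by move=> *; apply: val_inj; exact: act_DX.
- by move=> *; apply: val_inj; exact: act_DK.
- by move=> *; apply: val_inj; exact: act_DD.
Defined.

End SubTmod.

Definition tirreducible : Prop :=
  (exists v : V, v != 0) /\
  forall W, is_submod W -> W = [set 0] \/ W = setT.

Definition tindecomposable : Prop :=
  (exists v : V, v != 0) /\
  forall W1 W2, is_submod W1 -> is_submod W2 -> W1 `&` W2 = [set 0] ->
    (forall v, exists w1 w2, [/\ W1 w1, W2 w2 & v = w1 + w2]) ->
    W1 = [set 0] \/ W2 = [set 0].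

(* existence of a composition series *)
Definition finite_length : Prop :=
  exists (l : nat) (W : nat -> set V),
  [/\ forall j, is_submod (W j), W 0 = [set 0], W l = setT &
      forall j, (j < l)%N -> W j `<` W j.+1 /\
        forall U, is_submod U -> W j `<=` U -> U `<=` W j.+1 ->
          U = W j \/ U = W j.+1].

(** ** Weights and integrability *)

(* the weight of [h_tor] with restriction [mu] to [h_fin] and with values
   [ka i] on [K_i] and [de i] on [d_i] *)
Definition weight_space (mu : hdual h) (ka de : 'I_k -> C) : set V :=
  [set v | [/\ forall t : subvs_of h, act (GX (vsval t) 0) v = mu t *: v,
               forall i, act (GK 0 i) v = ka i *: v &
               forall i, act (GD i) v = de i *: v]].

Definition htor_diagonalizable : Prop :=
  forall v : V, exists s : seq V, v = \sum_(w <- s) w /\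
    forall w, w \in s -> exists mu ka de, weight_space mu ka de w.

Definition integrable : Prop :=
  htor_diagonalizable /\
  forall (al : hdual h) x m (v : V), is_root al -> root_vector al x ->
    exists N : nat, iter N (act (GX x m)) v = 0.

Definition integral_d : Prop :=
  forall i c (v : V), v != 0 -> act (GD i) v = c *: v ->
    exists z : int, c = z%:~R.

Definition finite_dim_weight_spaces : Prop :=
  forall mu ka de, exists s : seq V,
    forall v, weight_space mu ka de v -> v \in span_pred [set` s].

End Submodules.

(** ** Morphisms *)

Section Morphisms.
Variables (k : nat) (V W : tmod k).

Definition is_thom (f : V -> W) : Prop :=
  linear f /\ forall u v, f (act u v) = act u (f v).

Definition hom_nonzero : Prop := exists f, is_thom f /\ exists v, f v != 0.

Definition tsum_act u (p : V * W) : V * W := (act u p.1, act u p.2).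

Fact pair_sum1 I (F : I -> V * W) (r : seq I) :
  (\sum_(i <- r) F i).1 = \sum_(i <- r) (F i).1.
Proof. by elim/big_rec2: _ => // i y1 y2 _ <-. Qed.

Fact pair_sum2 I (F : I -> V * W) (r : seq I) :
  (\sum_(i <- r) F i).2 = \sum_(i <- r) (F i).2.
Proof. by elim/big_rec2: _ => // i y1 y2 _ <-. Qed.

Fact pair_ext (p q : V * W) : p.1 = q.1 -> p.2 = q.2 -> p = q.
Proof. by case: p q => [? ?] [? ?] /= -> ->. Qed.

Definition tsum : tmod k.
Proof.
refine (@Tmod k (V * W)%type tsum_act _ _ _ _ _ _ _ _ _).
- by move=> u a x y; apply: pair_ext; exact: act_linear.
- by move=> m v a x y; apply: pair_ext; exact: act_X_linear.
- by move=> r v; apply: pair_ext; rewrite ?pair_sum1 ?pair_sum2; exact: act_K_rel.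
- move=> x m y s v; apply: pair_ext; rewrite [LHS]act_XX; congr (_ + _ *: _);
    by rewrite ?pair_sum1 ?pair_sum2.
- by move=> *; apply: pair_ext; exact: act_KX.
- by move=> *; apply: pair_ext; exact: act_KK.
- by move=> *; apply: pair_ext; exact: act_DX.
- by move=> *; apply: pair_ext; exact: act_DK.
- by move=> *; apply: pair_ext; exact: act_DD.
Defined.

End Morphisms.

(** ** The category *)

(* The toroidal algebra has at least one variable; index [ord0] is the
   distinguished variable [t_1]. *)
Section Category.
Variable k : nat.
Implicit Types U V A B : tmod k.+1.

(* [K_1] has integer eigenvalues on integrable modules, so that it is enough
   to consider integers [m]. *)
Definition J_int (m : nat) (V : tmod k.+1) : Prop :=
  [/\ integrable V, integral_d V, finite_length V,
      finite_dim_weight_spaces V &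
      forall v : V, act (GK 0 ord0) v = m%:R *: v /\
        forall i : 'I_k.+1, i != ord0 -> act (GK 0 i) v = 0].

(* The finite direct sums of objects of the categories [J_int m] for [m > 0]. *)
Definition J_plus (V : tmod k.+1) : Prop :=
  exists (N : nat) (W : nat -> set V) (HW : forall m, is_submod (W m)),
  [/\ forall m, (0 < m < N)%N -> J_int m (submod (HW m)),
      forall v, exists w : nat -> V, (forall m, W m (w m)) /\
        v = \sum_(1 <= m < N) w m &
      forall w : nat -> V, (forall m, W m (w m)) ->
        \sum_(1 <= m < N) w m = 0 -> forall m, (0 < m < N)%N -> w m = 0].

Definition indecomposable_object V : Prop := J_plus V /\ tindecomposable V.

Definition linked U V : Prop :=
  exists (r : nat) (S : nat -> tmod k.+1),
  [/\ S 0 = U, S r = V,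
      forall i, (i <= r)%N -> indecomposable_object (S i) &
      forall i, (i < r)%N -> hom_nonzero (S i) (S i.+1) \/ hom_nonzero (S i.+1) (S i)].

(* extensions [0 -> B -> E -> A -> 0] *)
Record extension A B := Extension {
  ext_mod :> tmod k.+1;
  ext_inj : B -> ext_mod;
  ext_proj : ext_mod -> A;
  ext_inj_hom : is_thom ext_inj;
  ext_proj_hom : is_thom ext_proj;
  ext_injective : injective ext_inj;
  ext_surjective : forall a, exists e, ext_proj e = a;
  ext_exact : forall e, ext_proj e = 0 <-> exists b, ext_inj b = e
}.

Arguments ext_inj {A B} _ _.
Arguments ext_proj {A B} _ _.

Definition ext_equiv A B (E E' : extension A B) : Prop :=
  exists f : E -> E', [/\ is_thom f, forall b, f (ext_inj E b) = ext_inj E' b &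
    forall e, ext_proj E' (f e) = ext_proj E e].

Fact split_inj_hom A B : @is_thom _ B (tsum B A) (fun b => (b, 0 : A)).
Proof.
split=> [a x y|u v]; apply: pair_ext => //=; first by rewrite scaler0 addr0.
by rewrite (lin0 (act_linear u)).
Qed.

(* the neutral element of the group of extensions *)
Definition split_extension A B : extension A B.
Proof.
refine (@Extension A B (tsum B A) (fun b => (b, 0 : A)) (fun e => e.2) _ _ _ _ _).
- exact: split_inj_hom.
- by [].
- by move=> x y [].
- by move=> a; exists (0, a).
- by case=> b a; split=> [/= ->|[? [_ <-]]]; first by exists b.
Defined.

(* $\operatorname{Ext}^1(A, B) = 0$ in the category: every extension there is
   equivalent to the split one. *)
Definition Ext1_zero A B : Prop :=
  forall E : extension A B, J_plus E -> ext_equiv E (split_extension A B).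

End Category.

(** * The simple modules *)

(** ** Irreducible integrable highest weight modules of the affine algebra *)

(* The affine algebra is the toroidal algebra in one variable. *)
Definition is_highest_weight_vector (V : tmod 1) (la : haff_dual G) (v : V) : Prop :=
  [/\ v != 0,
      forall be x, is_positive_root (@simple_root R G) be -> root_vector be x ->
        act (GX x 0) v = 0,
      forall x (m : zk 1), 0 < m ord0 -> act (GX x m) v = 0,
      forall t : subvs_of h, act (GX (vsval t) 0) v = la (haff_h t) *: v &
      act (GK 0 ord0) v = la (haff_K G) *: v /\
      act (GD ord0) v = la (haff_d G) *: v].

Record hwmod (la : haff_dual G) := Hwmod {
  hw_mod :> tmod 1;
  hw_vec : hw_mod;
  hw_irreducible : tirreducible hw_mod;
  hw_integrable : integrable hw_mod;
  hw_vecP : is_highest_weight_vector la hw_vec;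
  hw_generated : tgenerated hw_vec = setT
}.

Section Loop.
Variable k : nat.
Local Notation maxid := (maxspec C k).

Record PiSet := PiElt {
  pi_fun :> maxid -> haff_dual G;
  pi_dom : forall M, Paff_plus (pi_fun M);
  pi_finite : finite_set [set M | pi_fun M != 0]
}.

Variable X : forall la : haff_dual G, Paff_plus la -> hwmod la.
Variable p : PiSet.

Definition pi_supp : {fset maxid} := fset_set [set M | p M != 0].

Definition pi_factor (i : pi_supp) : hwmod (p (val i)) := X (pi_dom p (val i)).

Definition Xpi := tensor (fun i : pi_supp => pi_factor i : lmodType C).
HB.instance Definition _ := GRing.Lmodule.on Xpi.

Definition vpi : Xpi :=
  @tpure C _ (fun i : pi_supp => pi_factor i : lmodType C)
    (fun i => hw_vec (pi_factor i)).

(* the action of [Y (x) f] *)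
Definition Xpi_act (Y : tgen 1) (f : laurent C k) : Xpi -> Xpi :=
  slotsum (fun i : pi_supp => mev (val i) f)
    (fun i => act Y : pi_factor i -> pi_factor i).

Definition Xpi_d1 : Xpi -> Xpi :=
  slotsum (fun=> 1)
    (fun i : pi_supp => act (GD ord0) : pi_factor i -> pi_factor i).

(* [t^m] is [t_1^p (x) t^r] with [p = thead m] and [r = ttail m] *)
Definition thead (m : zk k.+1) : zk 1 := [ffun=> m ord0].
Definition ttail (m : zk k.+1) : zk k := [ffun j => m (lift ord0 j)].

(* $w \otimes t^{\mathbf s}$ is [fsdelta s w] *)
Definition Lpi_space := fsupp (zk k) Xpi.
HB.instance Definition _ := GRing.Lmodule.on Lpi_space.

(* [Lpi_act u] maps [w (x) t^s] to [Lpi_coef u s w (x) t^(Lpi_shift u + s)] *)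
Definition Lpi_shift (u : tgen k.+1) : zk k :=
  match u with GX _ m => ttail m | GK m _ => ttail m | GD _ => 0 end.

Definition Lpi_coef (u : tgen k.+1) (s : zk k) : Xpi -> Xpi :=
  match u with
  | GX x m => Xpi_act (GX x (thead m)) (lmono (ttail m) 1)
  | GK m i => if (i == ord0) && (m ord0 == 0)
              then Xpi_act (GK 0 ord0) (lmono (ttail m) 1) else fun=> 0
  | GD i => if unlift ord0 i is Some j then fun w => (s j)%:~R *: w else Xpi_d1
  end.

Definition Lpi_act (u : tgen k.+1) : Lpi_space -> Lpi_space :=
  fslift (fun s w => fsdelta (Lpi_shift u + s) (Lpi_coef u s w)).

Lemma Xpi_act_linear Y f : linear (Xpi_act Y f).
Proof. by apply: slotsum_linear => i; exact: act_linear. Qed.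

Lemma Xpi_d1_linear : linear Xpi_d1.
Proof. by apply: slotsum_linear => i; exact: act_linear. Qed.

Lemma Lpi_coef_linear u s : linear (Lpi_coef u s).
Proof.
case: u => [x m|m i|i] /=; first exact: Xpi_act_linear.
- case: ifP => _; first exact: Xpi_act_linear.
  by move=> a x y; rewrite scaler0 addr0.
- case: unlift => [j|]; last exact: Xpi_d1_linear.
  by move=> a x y; rewrite scalerDr !scalerA mulrC.
Qed.

Lemma Lpi_delta_linear u s :
  linear (fun w => fsdelta (Lpi_shift u + s) (Lpi_coef u s w) : Lpi_space).
Proof. by move=> a x y; rewrite Lpi_coef_linear fsdelta_linear. Qed.

Lemma Lpi_act_linear u : linear (Lpi_act u).
Proof. by apply: fslift_linear => s; exact: Lpi_delta_linear. Qed.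

Lemma Lpi_act_delta u s w :
  Lpi_act u (fsdelta s w) = fsdelta (Lpi_shift u + s) (Lpi_coef u s w).
Proof. by rewrite [LHS]fslift_delta // => r; exact: Lpi_delta_linear. Qed.

Lemma comm_linear (V : lmodType C) (a b : V -> V) :
  linear a -> linear b -> linear (comm a b).
Proof.
move=> alin blin c x y; rewrite /comm !(alin, blin) scalerBr opprD.
by rewrite addrACA.
Qed.

Lemma Xpi_act_comm Y Z f g w :
  comm (Xpi_act Y f) (Xpi_act Z g) w
  = slotsum (fun i : pi_supp => mev (val i) f * mev (val i) g)
    (fun i => comm (act Y) (act Z) : pi_factor i -> pi_factor i) w.
Proof. by rewrite [LHS]slotsum_comm // => i; exact: act_linear. Qed.

Lemma slotsum0 (c : pi_supp -> C) (w : Xpi) :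
  slotsum c (fun i => (fun=> 0) : pi_factor i -> pi_factor i) w = 0.
Proof.
have lin00 : all_linear (fun i : pi_supp => (fun=> 0) : pi_factor i -> pi_factor i).
  by move=> i a x y; rewrite scaler0 addr0.
have := slotsum_lincomb (-1) c w lin00 lin00.
by rewrite scaleN1r addNr => <-; apply: eq_slotsum => i x; rewrite scaler0 addr0.
Qed.

Lemma eq_slotsumc (c d : pi_supp -> C) a (w : Xpi) : c =1 d ->
  slotsum c a w = slotsum d a w.
Proof. by move=> cd; apply: eq_bigr => i _; rewrite cd. Qed.

Lemma Lpi_comm u u' s w : comm (Lpi_act u) (Lpi_act u') (fsdelta s w)
  = fsdelta (Lpi_shift u + Lpi_shift u' + s)
      (Lpi_coef u (Lpi_shift u' + s) (Lpi_coef u' s w)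
       - Lpi_coef u' (Lpi_shift u + s) (Lpi_coef u s w)).
Proof.
rewrite /comm !Lpi_act_delta (linB (fsdelta_linear _)) !addrA.
by rewrite (addrC (Lpi_shift u')).
Qed.

Lemma ttailD m s : ttail (m + s) = ttail m + ttail s.
Proof. by apply/ffunP => i; rewrite !ffunE. Qed.

Lemma theadD m s : thead (m + s) = thead m + thead s.
Proof. by apply/ffunP => i; rewrite !ffunE. Qed.

Lemma linear_addf (V W : lmodType C) (a b : V -> W) :
  linear a -> linear b -> linear (fun v => a v + b v).
Proof. by move=> alin blin c x y; rewrite alin blin scalerDr addrACA. Qed.

Lemma linear_scalef (V W : lmodType C) (c : C) (a : V -> W) :
  linear a -> linear (fun v => c *: a v).
Proof. by move=> alin d x y; rewrite alin scalerDr !scalerA mulrC. Qed.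

Lemma linear_sumf (V W : lmodType C) (I : finType) (a : I -> V -> W) :
  (forall i, linear (a i)) -> linear (fun v => \sum_i a i v).
Proof.
move=> alin c x y; rewrite scaler_sumr -big_split.
by apply: eq_bigr => i _; rewrite alin.
Qed.

Lemma linear_zero (V W : lmodType C) : linear ((fun=> 0) : V -> W).
Proof. by move=> c x y; rewrite scaler0 addr0. Qed.

Lemma Xpi_act_X_linear m f w : linear (fun x => Xpi_act (GX x m) f w).
Proof.
move=> a x y; rewrite -[RHS]slotsum_lincomb; first last.
- by move=> i; exact: act_linear.
- by move=> i; exact: act_linear.
by apply: eq_slotsum => i v; rewrite act_X_linear.
Qed.

Lemma Lpi_coef_K0 (m : zk k.+1) i s w : ~~ ((i == ord0) && (m ord0 == 0)) ->
  Lpi_coef (GK m i) s w = 0.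
Proof. by move=> /negPf /= ->. Qed.

Lemma Lpi_K_rel_coef (r : zk k.+1) i s w : (r i)%:~R *: Lpi_coef (GK r i) s w = 0.
Proof.
have [/andP[/eqP -> /eqP ->]|r0] := boolP ((i == ord0) && (r ord0 == 0)).
  by rewrite scale0r.
by rewrite Lpi_coef_K0 ?scaler0.
Qed.

Lemma Xpi_act_K0 (m : zk 1) f w : m ord0 != 0 -> Xpi_act (GK m ord0) f w = 0.
Proof.
move=> m0; rewrite -[RHS](slotsum0 (fun i => mev (val i) f) w).
apply: eq_slotsum => i v; have := act_K_rel m v; rewrite big_ord1 => /eqP.
by rewrite scaler_eq0 intr_eq0 (negPf m0) => /eqP.
Qed.

Lemma zk1_eq0 (m : zk 1) : m ord0 = 0 -> m = 0.
Proof. by move=> m0; apply/ffunP => i; rewrite (ord1 i) m0 ffunE. Qed.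

Lemma Lpi_coef_K_head (m : zk k.+1) s w :
  Lpi_coef (GK m ord0) s w = Xpi_act (GK (thead m) ord0) (lmono (ttail m) 1) w.
Proof.
rewrite /Lpi_coef eqxx /=; have [m0|m0] := eqVneq (m ord0) 0.
  by rewrite (@zk1_eq0 (thead m)) // ffunE.
by rewrite Xpi_act_K0 // ffunE.
Qed.

Lemma Xpi_act_bracket Y Z m s w :
  comm (Xpi_act Y (lmono m 1)) (Xpi_act Z (lmono s 1)) w
  = slotsum (fun i : pi_supp => mev (val i) (lmono (m + s) 1))
    (fun i => comm (act Y) (act Z) : pi_factor i -> pi_factor i) w.
Proof.
by rewrite Xpi_act_comm; apply: eq_slotsumc => i; rewrite mev_monoD.
Qed.

Lemma Xpi_act_comm0 Y Z m s w :
  (forall i (v : pi_factor i), comm (act Y) (act Z) v = 0) ->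
  comm (Xpi_act Y (lmono m 1)) (Xpi_act Z (lmono s 1)) w = 0.
Proof.
by move=> YZ; rewrite Xpi_act_bracket (eq_slotsum _ _ YZ) slotsum0.
Qed.

Lemma Xpi_d1_comm Y f c w :
  (forall i (v : pi_factor i), comm (act (GD ord0)) (act Y) v = c *: act Y v) ->
  comm Xpi_d1 (Xpi_act Y f) w = c *: Xpi_act Y f w.
Proof.
move=> YZ; rewrite [LHS]slotsum_comm; try by move=> i; exact: act_linear.
rewrite -[RHS]addr0 -(slotsum0 (fun i => mev (val i) f) w) /Xpi_act.
rewrite -slotsum_lincomb; [|by move=> i; exact: act_linear|by move=> i; exact: linear_zero].
rewrite (@eq_slotsumc _ (fun i => mev (val i) f)) => [|i]; last by rewrite mul1r.
by apply: eq_slotsum => i v; rewrite addr0 -YZ.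
Qed.

Lemma Lpi_ext (a b : Lpi_space -> Lpi_space) : linear a -> linear b ->
  (forall s w, a (fsdelta s w) = b (fsdelta s w)) -> forall v, a v = b v.
Proof. exact: fsupp_ext. Qed.

Lemma Lpi_comm_linear u u' : linear (comm (Lpi_act u) (Lpi_act u')).
Proof. by apply: comm_linear; exact: Lpi_act_linear. Qed.

Lemma Lpi_X_linear m v : linear (fun x => Lpi_act (GX x m) v).
Proof.
move=> a x y; move: v; apply: Lpi_ext => [||s w].
- exact: Lpi_act_linear.
- apply: linear_addf; last exact: Lpi_act_linear.
  by apply: linear_scalef; exact: Lpi_act_linear.
- by rewrite !Lpi_act_delta /= Xpi_act_X_linear fsdelta_linear.
Qed.

Lemma Lpi_K_rel (r : zk k.+1) v : \sum_i (r i)%:~R *: Lpi_act (GK r i) v = 0.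
Proof.
move: v; apply: Lpi_ext => [||s w].
- by apply: linear_sumf => i; apply: linear_scalef; exact: Lpi_act_linear.
- exact: linear_zero.
- rewrite big1 // => i _.
  by rewrite Lpi_act_delta -(linZ (fsdelta_linear _)) Lpi_K_rel_coef (lin0 (fsdelta_linear _)).
Qed.

Lemma Lpi_XX x m y s v : comm (Lpi_act (GX x m)) (Lpi_act (GX y s)) v =
  Lpi_act (GX (lbr x y) (m + s)) v
  + form x y *: \sum_i (m i)%:~R *: Lpi_act (GK (m + s) i) v.
Proof.
move: v; apply: Lpi_ext => [||r w].
- exact: Lpi_comm_linear.
- apply: linear_addf; first exact: Lpi_act_linear.
  by apply: linear_scalef; apply: linear_sumf => i; apply: linear_scalef;
    exact: Lpi_act_linear.
rewrite Lpi_comm (bigD1 ord0) //= big1 ?addr0; last first.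
  move=> i /negPf i0; rewrite Lpi_act_delta Lpi_coef_K0 ?i0 //.
  by rewrite (lin0 (fsdelta_linear _)) scaler0.
rewrite !Lpi_act_delta Lpi_coef_K_head /Lpi_shift /Lpi_coef ttailD theadD.
rewrite -!(linZ (fsdelta_linear _)) -(linD (fsdelta_linear _)); congr fsdelta.
rewrite -/(comm _ _ _) Xpi_act_bracket scalerA [RHS]addrC /Xpi_act -slotsum_lincomb; first last.
- by move=> i; exact: act_linear.
- by move=> i; exact: act_linear.
apply: eq_slotsum => i u; by rewrite act_XX big_ord1 ffunE scalerA addrC.
Qed.

Lemma Lpi_KX (m : zk k.+1) i x s v : comm (Lpi_act (GK m i)) (Lpi_act (GX x s)) v = 0.
Proof.
move: v; apply: Lpi_ext => [||r w]; [exact: Lpi_comm_linear|exact: linear_zero|].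
rewrite Lpi_comm; have [i0|i0] := eqVneq i ord0.
  rewrite i0 !Lpi_coef_K_head -/(comm _ _ _) Xpi_act_comm0.
    exact: lin0 (fsdelta_linear _).
  by move=> j u; exact: act_KX.
rewrite !Lpi_coef_K0 ?(negPf i0) // (lin0 (Lpi_coef_linear _ _)) subrr.
exact: lin0 (fsdelta_linear _).
Qed.

Lemma Lpi_KK m i s j v : comm (Lpi_act (GK m i)) (Lpi_act (GK s j)) v = 0.
Proof.
move: v; apply: Lpi_ext => [||r w]; [exact: Lpi_comm_linear|exact: linear_zero|].
have K0 := lin0 (Lpi_coef_linear _ _); rewrite Lpi_comm.
have [i0|i0] := eqVneq i ord0; last first.
  rewrite !(@Lpi_coef_K0 m i) ?(negPf i0) // K0 subrr.
  exact: lin0 (fsdelta_linear _).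
have [j0|j0] := eqVneq j ord0; last first.
  rewrite !(@Lpi_coef_K0 s j) ?(negPf j0) // K0 subrr.
  exact: lin0 (fsdelta_linear _).
rewrite i0 j0 !Lpi_coef_K_head -/(comm _ _ _) Xpi_act_comm0.
  exact: lin0 (fsdelta_linear _).
by move=> l u; exact: act_KK.
Qed.

Lemma Lpi_D_comm i u (c : C) r w :
  (forall w, i = ord0 -> comm Xpi_d1 (Lpi_coef u r) w = c *: Lpi_coef u r w) ->
  (forall j, i = lift ord0 j -> c = (Lpi_shift u j)%:~R) ->
  (forall s, Lpi_coef u s = Lpi_coef u r) ->
  comm (Lpi_act (GD i)) (Lpi_act u) (fsdelta r w) = c *: Lpi_act u (fsdelta r w).
Proof.
move=> u0 uj us; rewrite Lpi_comm Lpi_act_delta -(linZ (fsdelta_linear _)) !us.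
rewrite add0r; congr fsdelta; rewrite /=; case: unliftP => [j ij|i0].
  rewrite (linZ (Lpi_coef_linear _ _)) -scalerBl (uj _ ij) ffunE.
  by rewrite intrD addrK.
exact: u0.
Qed.

Lemma Lpi_DX i x m v : comm (Lpi_act (GD i)) (Lpi_act (GX x m)) v =
  (m i)%:~R *: Lpi_act (GX x m) v.
Proof.
move: v; apply: Lpi_ext => [||r w]; first exact: Lpi_comm_linear.
  by apply: linear_scalef; exact: Lpi_act_linear.
apply: Lpi_D_comm => //= [{}w ->|j ->]; last by rewrite ffunE.
by apply: Xpi_d1_comm => j u; rewrite act_DX ffunE.
Qed.

Lemma Lpi_DK i m j v : comm (Lpi_act (GD i)) (Lpi_act (GK m j)) v =
  (m i)%:~R *: Lpi_act (GK m j) v.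
Proof.
move: v; apply: Lpi_ext => [||r w]; first exact: Lpi_comm_linear.
  by apply: linear_scalef; exact: Lpi_act_linear.
apply: Lpi_D_comm => //= [{}w ->|l ->]; last by rewrite ffunE.
case: ifP => [/andP[_ /eqP m0]|_].
  by apply: Xpi_d1_comm => l u; rewrite act_DK ffunE m0.
by rewrite /comm (lin0 Xpi_d1_linear) subrr scaler0.
Qed.

Lemma Lpi_DD i j v : comm (Lpi_act (GD i)) (Lpi_act (GD j)) v = 0.
Proof.
move: v; apply: Lpi_ext => [||r w]; [exact: Lpi_comm_linear|exact: linear_zero|].
rewrite Lpi_comm !add0r /=.
case: unlift => [i'|]; case: unlift => [j'|].
- by rewrite !scalerA mulrC subrr (lin0 (fsdelta_linear _)).
- by rewrite (linZ Xpi_d1_linear) subrr (lin0 (fsdelta_linear _)).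
- by rewrite (linZ Xpi_d1_linear) subrr (lin0 (fsdelta_linear _)).
- by rewrite subrr (lin0 (fsdelta_linear _)).
Qed.

Definition Lpi : tmod k.+1 :=
  Tmod Lpi_act_linear Lpi_X_linear Lpi_K_rel Lpi_XX Lpi_KX Lpi_KK
       Lpi_DX Lpi_DK Lpi_DD.

(** ** The modules X_pi^g *)

(* [g] is an element of $\mathbb Z^{k+1}$ with first coordinate 0 *)
Definition Xpi_gen (g : zk k.+1) : Lpi := fsdelta (ttail g) vpi.

Definition Xpi_mod (g : zk k.+1) : tmod k.+1 :=
  submod (tgenerated_submod (Xpi_gen g)).

End Loop.

(** * Spectral characters *)

Section Spectral.
Variable k : nat.
Local Notation maxid := (maxspec C k).

Record Xi := XiElt {
  xi_fun :> maxid -> int * Gamma G;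
  xi_finite : finite_set [set M | xi_fun M != 0]
}.

(* the value at [K_1] of a weight in $P_{aff}^+$, which is an integer *)
Definition level (la : haff_dual G) : int :=
  xget 0 [set z : int | la (haff_K G) = z%:~R].

Definition weight_class (la : haff_dual G) (H : Paff_plus la) : Gamma G :=
  \pi_(Gamma G) (PfinElt (Paff_plus_restr H)).

Definition chi_fun (p : PiSet k) (M : maxid) : int * Gamma G :=
  (level (p M), weight_class (pi_dom p M)).

Lemma chi_finite p : finite_set [set M | chi_fun p M != 0].
Proof.
apply: sub_finite_set (pi_finite p) => M /=; apply: contra_neq => pM0.
congr pair.
  rewrite /level; case: xgetP => // z _; rewrite pM0 lfunE /= => /esym /eqP.
  by rewrite intr_eq0 => /eqP.
rewrite /weight_class; set y := PfinElt _; have -> : y = 0.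
  by apply: val_inj; apply/lfunP => t; rewrite /= restr_hE pM0 !lfunE.
exact: (raddf0 (\pi_(Quotient.quot (@Qfin_pred R G)))).
Qed.

Definition chi (p : PiSet k) : Xi := XiElt (@chi_finite p).

Definition torus_act_Xi (b : torus C k) (xi : Xi) (M : maxid) : int * Gamma G :=
  xi (torus_act b M).

Definition same_orbit (xi xi' : Xi) : Prop :=
  exists b : torus C k, forall M, xi' M = torus_act_Xi b xi M.

End Spectral.
End Toroidal.

(* Main.v *)
(* On the modules of the category, let [t^r K_1] and [t (x) t^r], for [t] in the
   Cartan subalgebra and [r] an exponent of [t_2, ..., t_k], act on formal sums
   of weight vectors whose degrees in [t_2, ..., t_k] are arbitrary. When the
   central elements [t_i^(l_i) K_1] act invertibly, the formal sums of a given
   weight that are periodic under them form a finite-dimensional space and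
   account for all weight vectors, so they decompose into joint generalized
   eigenvectors, with eigenvalues [eta t r]. A root vector of root [la] changes
   [eta t r] by a term [la t * M^r] with [M] a point of the torus, and shifting
   degrees multiplies it by [b^r]; any set of eigenvalues stable under these
   operations and its complement therefore split the module, in a way that
   homomorphisms preserve. On [X_pi^g] the eigenvalue is
   [\sum_M pi(M)(t) M^r], and its class modulo these operations determines the
   orbit of [chi(pi)].

   A splitting preserved by homomorphisms splits the extensions between modules
   lying on its two sides, and linked indecomposable modules lie on the same
   side. If some [t_i^(l_i) K_1] is not invertible on [X_psi^s], the same
   argument applies to the Fitting decomposition with respect to
   [t_i^(l_i) K_1 t_i^(-l_i) K_1]. *)

From HB Require Import structures.
From mathcomp Require Import all_boot all_order all_algebra generic_quotient ring_quotient finmap.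
From mathcomp Require Import cyclic separable cyclotomic.
From mathcomp Require Import all_classical reals complex.
From mathcomp Require Import zify ring lra.
Require Import Defs.

Set Implicit Arguments.
Unset Strict Implicit.
Unset Printing Implicit Defensive.

Import Order.TTheory GRing.Theory Num.Theory.
Local Open Scope classical_set_scope.
Local Open Scope ring_scope.

(** * Subspaces and spans *)

(** The operators [t^r K_1] and [t (x) t^r] change the degree, so weight spaces are not stable under
    them; formal sums over all degrees repair this, and periodicity restores finite dimension. Two
    such operators need not commute: [[t (x) t^r, t' (x) t^s]] is a combination of the [t^(r+s) K_i]
    with [i >= 2], and the category only prescribes that [K_i] itself acts by 0. These brackets
    commute with the operators, so double commutators vanish, and the theory of joint generalized
    eigenvectors rests on that alone. The periods [l_i] appear because [t_i K_1] can vanish on a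
    simple module of nonzero level: its eigenvalue is a sum of levels weighted by coordinates of
    points. Finally, a weight vector determines its periodic formal sum only on one coset of the
    period lattice. Restricting to this coset is an average over rescalings of the degrees by roots
    of unity, so the components are shown to be independent for sets of eigenvalues stable under
    such rescalings; this is why orbits of the torus enter and not the characters themselves. *)

Section Spans.
Variables (C : fieldType) (V : lmodType C).

Lemma subspace_sum (W : set V) (J : Type) (s : seq J) (P : pred J) (F : J -> V) :
  is_subspace W -> (forall i, P i -> W (F i)) -> W (\sum_(i <- s | P i) F i).
Proof.
case=> W0 Wl WF; apply: (big_ind W) => [|u v Wu Wv|i Pi]; [exact: W0| |exact: WF].
by rewrite -[u]scale1r; exact: Wl.
Qed.

Lemma subspaceD (W : set V) u v : is_subspace W -> W u -> W v -> W (u + v).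
Proof. by case=> _ Wl Wu Wv; rewrite -[u]scale1r; exact: Wl. Qed.

Lemma subspaceZ (W : set V) a u : is_subspace W -> W u -> W (a *: u).
Proof. by case=> W0 Wl Wu; rewrite -[_ *: _]addr0; exact: Wl. Qed.

Lemma subspaceB (W : set V) u v : is_subspace W -> W u -> W v -> W (u - v).
Proof. by move=> Ws Wu Wv; rewrite -scaleN1r; apply: subspaceD => //; exact: subspaceZ. Qed.

Lemma span0 (S : set V) : 0 \in span_pred S.
Proof. exact: rpred0. Qed.

Lemma spanD (S : set V) u v :
  u \in span_pred S -> v \in span_pred S -> u + v \in span_pred S.
Proof. by move=> Su Sv; exact: rpredD. Qed.

Lemma spanZ (S : set V) a u : u \in span_pred S -> a *: u \in span_pred S.
Proof. by move=> Su; exact: rpredZ. Qed.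

Lemma span_sum (S : set V) (J : Type) (s : seq J) (P : pred J) (F : J -> V) :
  (forall i, P i -> F i \in span_pred S) -> \sum_(i <- s | P i) F i \in span_pred S.
Proof. by move=> SF; exact: rpred_sum. Qed.

Lemma subspace_span (S : set V) : is_subspace [set v | v \in span_pred S].
Proof.
by split=> /= [|a u v Su Sv]; [exact: span0|apply: spanD => //; exact: spanZ].
Qed.

Lemma subspaceI (U W : set V) : is_subspace U -> is_subspace W -> is_subspace (U `&` W).
Proof.
move=> [U0 Ul] [W0 Wl]; split; first by split.
by move=> a u v [? ?] [? ?]; split; [exact: Ul|exact: Wl].
Qed.

Lemma span_incl (S S' : set V) v : (forall u, S u -> u \in span_pred S') ->
  v \in span_pred S -> v \in span_pred S'.
Proof.
move=> SS'; exact: (@span_min _ _ S [set v | v \in span_pred S'] (subspace_span _) SS').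
Qed.

Lemma span_mono (S S' : set V) v : S `<=` S' ->
  v \in span_pred S -> v \in span_pred S'.
Proof. by move=> SS'; apply: span_incl => u /SS'; exact: span_sub. Qed.

Lemma span_seq (S : set V) v : (forall a u, S u -> S (a *: u)) ->
  v \in span_pred S ->
  exists s : seq V, (forall u, u \in s -> S u) /\ v = \sum_(u <- s) u.
Proof.
move=> SZ; apply: (@span_min _ _ _ [set v | exists s : seq V,
  (forall u, u \in s -> S u) /\ v = \sum_(u <- s) u]); last first.
  move=> u Su; exists [:: u]; split; last by rewrite big_seq1.
  by move=> w; rewrite inE => /eqP ->.
split; first by exists [::]; rewrite big_nil.
move=> a _ _ [s [sS ->]] [s' [s'S ->]]; exists ([seq a *: u | u <- s] ++ s'); split.
  move=> u; rewrite mem_cat => /orP[/mapP[w ws ->]|]; last exact: s'S.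
  by apply: SZ; exact: sS.
by rewrite big_cat big_map scaler_sumr.
Qed.

Lemma span_bigsum (S : set V) v : v \in span_pred S ->
  exists (n : nat) (c : 'I_n -> C) (u : 'I_n -> V),
    (forall i, S (u i)) /\ v = \sum_i c i *: u i.
Proof.
move=> vS; pose S' := [set w | exists a u, S u /\ w = a *: u].
have SZ a u : S' u -> S' (a *: u).
  by move=> [b [w [Sw ->]]]; exists (a * b), w; rewrite scalerA.
have /(span_seq SZ)[s [sS ->]] : v \in span_pred S'.
  by apply: span_mono vS => u Su; exists 1, u; rewrite scale1r.
have sE (i : 'I_(size s)) : exists cu : C * V, S cu.2 /\ tnth (in_tuple s) i = cu.1 *: cu.2.
  by have /sS[c [u ucu]] := mem_tnth i (in_tuple s); exists (c, u).
have [f fP] := choice sE.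
exists (size s), (fun i => (f i).1), (fun i => (f i).2); split=> [i|]; first exact: (fP i).1.
by rewrite big_tnth; apply: eq_bigr => i _; exact: (fP i).2.
Qed.

End Spans.

Lemma span_map (C : fieldType) (V V' : lmodType C) (f : V -> V') (S : set V)
    (S' : set V') v : linear f -> (forall u, S u -> f u \in span_pred S') ->
  v \in span_pred S -> f v \in span_pred S'.
Proof.
move=> flin SS'; apply: (@span_min _ _ _ [set v | f v \in span_pred S']) => //.
split=> /= [|a u w fu fw]; first by rewrite (lin0 flin) span0.
by rewrite flin spanD // spanZ.
Qed.

Lemma lin_bigsum (C : fieldType) (V V' : lmodType C) (f : V -> V') : linear f ->
  forall (J : Type) (s : seq J) (P : pred J) (F : J -> V),
  f (\sum_(i <- s | P i) F i) = \sum_(i <- s | P i) f (F i).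
Proof. by move=> flin J s P F; rewrite -big_filter (lin_sum flin) big_filter. Qed.

(** * Generalized eigenvectors *)

Section GenEigen.
Variables (C : fieldType) (V : lmodType C).
Implicit Types (T : V -> V) (c : C) (v : V) (W : set V).

Definition shiftop T c : V -> V := fun v => T v - c *: v.

Definition geig T c v := exists n, iter n (shiftop T c) v = 0.

Lemma shiftop_linear T c : linear T -> linear (shiftop T c).
Proof.
move=> Tlin a u v; rewrite /shiftop Tlin scalerBr scalerDr !scalerA mulrC opprD.
by rewrite addrACA.
Qed.

Lemma iter_linear T n : linear T -> linear (iter n T).
Proof. by move=> Tlin; elim: n => [|n IH] a u v //=; rewrite IH Tlin. Qed.

Lemma iter0 T n : linear T -> iter n T 0 = 0.
Proof. by move=> Tlin; exact: (lin0 (iter_linear n Tlin)). Qed.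

Lemma iter_vanish T m n v : linear T -> (m <= n)%N -> iter m T v = 0 -> iter n T v = 0.
Proof. by move=> Tlin mn v0; rewrite -(subnK mn) iterD v0 iter0. Qed.

Lemma subspace_stable_shift T c W : is_subspace W ->
  (forall v, W v -> W (T v)) -> forall v, W v -> W (shiftop T c v).
Proof. by move=> Ws WT v Wv; apply: subspaceB => //; [exact: WT|exact: subspaceZ]. Qed.

Lemma subspace_geig T c : linear T -> is_subspace (geig T c).
Proof.
move=> Tlin; have Slin := shiftop_linear c Tlin; split; first by exists 0.
move=> a u v [m um] [n vn]; exists (maxn m n).
rewrite (iter_linear _ Slin) (iter_vanish Slin (leq_maxl _ _) um).
by rewrite (iter_vanish Slin (leq_maxr _ _) vn) scaler0 addr0.
Qed.

Lemma geig_eig T c v : T v = c *: v -> geig T c v.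
Proof. by move=> Tv; exists 1%N; rewrite /= /shiftop Tv subrr. Qed.

Lemma shiftopC T a b v : linear T -> shiftop T a (shiftop T b v) = shiftop T b (shiftop T a v).
Proof.
move=> Tlin; rewrite {1 3}/shiftop !(linB Tlin) !(linZ Tlin) /shiftop !scalerBr.
rewrite !scalerA (mulrC b) !opprB !addrA.
by rewrite addrAC [RHS]addrAC; congr (_ + _); rewrite addrAC.
Qed.

Lemma iter_shiftopC T a b n v : linear T ->
  iter n (shiftop T a) (shiftop T b v) = shiftop T b (iter n (shiftop T a) v).
Proof. by move=> Tlin; elim: n => //= n ->; rewrite shiftopC. Qed.

Lemma shiftopB T a b v : shiftop T a v - shiftop T b v = (b - a) *: v.
Proof. by rewrite /shiftop opprB addrC addrA subrK scalerBl. Qed.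

(** Bezout for [(x - a)^m] and [(x - b)^n], done by a double induction from the fact that the two
    shifts differ by the nonzero scalar [b - a]. The form modulo a stable subspace [W] serves to
    show that a component of a vector of [W] is again in [W]. *)
Lemma geig_coprime T a b m n v W : linear T -> is_subspace W ->
  (forall u, W u -> W (T u)) -> a != b ->
  W (iter m (shiftop T a) v) -> W (iter n (shiftop T b) v) -> W v.
Proof.
move=> Tlin Ws WT ab; have WS c := subspace_stable_shift c Ws WT.
elim: m v => [//|m IHm] v; rewrite iterSr => Wa Wb.
have {IHm Wa} Wav : W (shiftop T a v).
  by apply: IHm Wa _; rewrite iter_shiftopC //; exact: WS.
elim: n v Wb Wav => [//|n IHn] v; rewrite iterSr => Wb Wav.
have Wbv : W (shiftop T b v).
  by apply: IHn Wb _; rewrite shiftopC //; exact: WS.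
have ab0 : b - a != 0 by rewrite subr_eq0 eq_sym.
have -> : v = (b - a)^-1 *: (shiftop T a v - shiftop T b v).
  by rewrite shiftopB scalerA mulVf // scale1r.
by apply: subspaceZ => //; exact: subspaceB.
Qed.

Lemma subspace0 : is_subspace [set (0 : V)].
Proof. by split=> // a u v -> ->; rewrite scaler0 addr0. Qed.

Lemma geig_uniq T a b v : linear T -> a != b -> geig T a v -> geig T b v -> v = 0.
Proof.
move=> Tlin ab [m vm] [n vn].
apply: (geig_coprime (W := [set 0]) Tlin subspace0 _ ab vm vn) => u ->.
exact: (lin0 Tlin).
Qed.

(** Induction on the nilpotency exponent: if [(T - b) u = (T - a) w], then
    [(T - b) (w - u) = (a - b) w], so [w - u] divided by [a - b] is a preimage of [w]. *)
Lemma geig_solve T a b W w : linear T -> is_subspace W ->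
  (forall u, W u -> W (T u)) -> a != b -> W w -> geig T a w ->
  exists u, [/\ W u, geig T a u & shiftop T b u = w].
Proof.
move=> Tlin Ws WT ab + [n]; elim: n w => [|n IHn] w Ww.
  move=> /= w0; exists w; split=> //; first by exists 0%N.
  by rewrite w0 (lin0 (shiftop_linear b Tlin)).
rewrite iterSr => wn.
have [u [Wu ua ub]] := IHn _ (subspace_stable_shift a Ws WT Ww) wn.
have wa : geig T a w by exists n.+1; rewrite iterSr.
exists ((a - b)^-1 *: (w - u)); split.
- by apply: subspaceZ => //; exact: subspaceB.
- have Gs := subspace_geig a Tlin.
  by apply: subspaceZ => //; exact: subspaceB.
- have Sl := shiftop_linear b Tlin.
  rewrite (linZ Sl) (linB Sl) ub shiftopB scalerA mulVf ?scale1r //.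
  by rewrite subr_eq0.
Qed.

(** The list may have repetitions. Induction on its last factor [c]: the decomposition of
    [(T - c) w] is lifted through [T - c], which is onto on the components of eigenvalue other than
    [c]; what then remains of [w] is killed by a power of [T - c]. *)
Lemma geig_decomp T W (l : seq C) w : linear T -> is_subspace W ->
  (forall u, W u -> W (T u)) -> W w -> foldr (fun c v => shiftop T c v) w l = 0 ->
  w \in span_pred [set u | W u /\ exists c, geig T c u].
Proof.
move=> Tlin Ws WT; elim/last_ind: l w => [|l c IH] w Ww /=; first by move=> ->; rewrite span0.
rewrite foldr_rcons => /IH - /(_ (subspace_stable_shift c Ws WT Ww)) {IH}.
 set S := [set u | _] => Sw.
suff [w' [Sw' w'w]] : exists w', w' \in span_pred S /\ geig T c (w - w') /\ W w'.
  have -> : w = w' + (w - w') by rewrite addrC subrK.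
  apply: spanD => //; apply: span_sub; split; last by exists c; exact: w'w.1.
  by apply: subspaceB w'w.2.
have H v : v \in span_pred S -> exists u, [/\ u \in span_pred S, W u &
    geig T c (v - shiftop T c u)].
  have Sl := shiftop_linear c Tlin; have Gs := subspace_geig c Tlin.
  apply: (@span_min _ _ _ [set v | exists u, [/\ u \in span_pred S, W u &
    geig T c (v - shiftop T c u)]]).
    split; first by exists 0; rewrite span0 (lin0 Sl) subr0; split=> //; [exact: Ws.1|exists 0%N].
    move=> a x y [u [Su Wu xu]] [u' [Su' Wu' yu]]; exists (a *: u + u'); split.
    - by rewrite spanD // spanZ.
    - exact: Ws.2.
    - rewrite Sl opprD addrACA -scalerBr; exact: Gs.2.
  move=> x [Wx [d dx]]; have [<-|cd] := eqVneq d c.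
    exists 0; split; [exact: span0|exact: Ws.1|by rewrite (lin0 (shiftop_linear d Tlin)) subr0].
  have [u [Wu du uw]] := geig_solve Tlin Ws WT cd Wx dx.
  exists u; split=> //; first by apply: span_sub; split=> //; exists d.
  by rewrite uw subrr; exists 0%N.
have [u [Su Wu [n cn]]] := H _ Sw; exists u; split=> //; split=> //; exists n.+1.
by rewrite iterSr (linB (shiftop_linear c Tlin)).
Qed.

End GenEigen.

(* [(T' - (c + ka)) \o F p = F p \o (T - c) + F p.+1]: Leibniz's rule for a
   sequence of iterated commutators. *)
Lemma geig_leibniz (C : fieldType) (V V' : lmodType C) (T : V -> V) (T' : V' -> V')
    (F : nat -> V -> V') (U : set V) (ka c : C) (n : nat) (u : V) :
  linear T -> linear T' -> is_subspace U -> (forall u, U u -> U (T u)) ->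
  (forall p a u v, U u -> U v -> F p (a *: u + v) = a *: F p u + F p v) ->
  (forall p u, U u -> T' (F p u) = F p (T u) + ka *: F p u + F p.+1 u) ->
  (forall u, U u -> F n u = 0) -> U u ->
  geig T c u -> geig T' (c + ka) (F 0%N u).
Proof.
move=> Tlin Tlin' Us UT Flin FT Fn Uu [m um].
have F0 p : F p 0 = 0.
  have [U0 _] := Us; have := Flin p 1 0 0 U0 U0.
  by rewrite scaler0 add0r scale1r => /eqP; rewrite -subr_eq0 opprD addrA subrr sub0r oppr_eq0 => /eqP.
have FB p v : U v -> F p (T v - c *: v) = F p (T v) - c *: F p v.
  by move=> Uv; rewrite addrC -scaleNr Flin ?scaleNr; [rewrite addrC| |exact: UT].
have FS p v : U v -> shiftop T' (c + ka) (F p v) = F p (shiftop T c v) + F p.+1 v.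
  move=> Uv; rewrite /shiftop FT // FB // scalerDl opprD addrA addrAC.
  by rewrite [X in X - _]addrAC addrK addrAC.
have S'l := shiftop_linear (c + ka) Tlin'.
(* Each application of the shifted [T'] lowers the exponent [m] or raises [p], so [m + (n - p)]
   applications suffice. *)
suff : forall N p m u, U u -> iter m (shiftop T c) u = 0 -> (m + (n - p) <= N)%N ->
    (p <= n)%N -> iter N (shiftop T' (c + ka)) (F p u) = 0.
  by move=> /(_ _ 0%N m u Uu um (leqnn _) isT) H; exists (m + (n - 0))%N.
elim=> [|N IH] p {}m {}u {}Uu {}um mN pn.
  by move: mN um; rewrite leqn0 addn_eq0 => /andP[/eqP -> _] /= ->.
have [->|np] := eqVneq p n; first by rewrite Fn // iter0.
case: m um mN => [/= -> mN|m um mN]; first by rewrite F0 (iter0 _ S'l) (lin0 S'l).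
rewrite iterSr FS // (linD (iter_linear N S'l)).
have pn' : (p < n)%N by rewrite ltn_neqAle np.
rewrite (IH p m); first 1 last.
- exact: subspace_stable_shift.
- by rewrite -iterSr.
- by lia.
- by [].
by rewrite add0r (IH p.+1 m.+1) //; lia.
Qed.

Lemma commop_linear (C : fieldType) (V : lmodType C) (a b : V -> V) :
  linear a -> linear b -> linear (comm a b).
Proof.
by move=> alin blin c x y; rewrite /comm !(alin, blin) scalerBr opprD addrACA.
Qed.

(** Leibniz's rule for the sequence [B], [[T, B]], [0] with [ka = 0]. A vanishing double commutator
    is what the Cartan operators of the toroidal algebra offer in place of commutation. *)
Lemma geig_comm2 (C : fieldType) (V : lmodType C) (T B : V -> V) (W : set V) c v :
  linear T -> linear B -> is_subspace W -> (forall u, W u -> W (T u)) ->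
  (forall u, W u -> comm T (comm T B) u = 0) -> W v ->
  geig T c v -> geig T c (B v).
Proof.
pose F p := if p is p'.+1 then if p' is _.+1 then fun=> 0 else comm T B else B.
move=> Tlin Blin Ws WT TB Wv vc; rewrite -[c]addr0.
have cl := commop_linear Tlin Blin.
apply: (@geig_leibniz _ _ _ T T F W 0 c 2) => //.
- by case=> [|[|p]] a u w _ _ /=; rewrite ?Blin ?cl ?scaler0 ?addr0.
- case=> [|[|p]] u Wu /=; rewrite scale0r addr0.
  + by rewrite /comm addrC subrK.
  + by rewrite addr0; apply/eqP; rewrite -subr_eq0; apply/eqP; exact: TB.
  + by rewrite addr0 (lin0 Tlin).
Qed.

(** * Joint generalized eigenvectors of a family of operators *)

Section JointEigen.
Variables (C : fieldType) (V : lmodType C) (I : Type) (A : I -> V -> V).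
Hypothesis Alin : forall i, linear (A i).

Definition jgen (eta : I -> C) (v : V) := forall i, geig (A i) (eta i) v.

Lemma subspace_jgen eta : is_subspace (jgen eta).
Proof.
split=> [i|a u v uj vj i]; first exact: (subspace_geig _ (Alin i)).1.
exact: (subspace_geig _ (Alin i)).2.
Qed.

Hypothesis A2 : forall i j v, comm (A i) (comm (A i) (A j)) v = 0.

Lemma geig_stable i j c v : geig (A i) c v -> geig (A i) c (A j v).
Proof. by apply: (geig_comm2 (W := setT)) => // *; exact: A2. Qed.

Lemma jgen_stable eta j v : jgen eta v -> jgen eta (A j v).
Proof. by move=> vj i; exact: geig_stable. Qed.

(** Induction on the number of terms. If two indices lie on different sides of [K], their
    eigenvalues differ at some [A i]. A power of [A i] minus either eigenvalue deletes a term, so by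
    induction it sends the [K]-part into [W]; [geig_coprime] then removes both powers. *)
Lemma jgen_component (W : set V) (K : set (I -> C)) (J : finType) (S : {set J})
    (eta : J -> I -> C) (w : J -> V) :
  is_subspace W -> (forall i v, W v -> W (A i v)) ->
  (forall j, j \in S -> jgen (eta j) (w j)) ->
  W (\sum_(j in S) w j) -> W (\sum_(j in S | `[< K (eta j) >]) w j).
Proof.
move=> Ws WA; move: {2}#|S| (leqnn #|S|) => n; elim: n S w => [|n IH] S w.
  rewrite leqn0 cards_eq0 => /eqP -> _ _.
  by rewrite big1 => [|j]; [exact: Ws.1|rewrite inE].
move=> Sn Sw WS.
have [j0 /andP[j0S /asboolP Kj0]|nK] := pickP [pred j in S | `[< K (eta j) >]]; last first.
  by rewrite big_pred0 //; exact: Ws.1.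
have [j1 /andP[j1S /asboolP Kj1]|aK] := pickP [pred j in S | ~~ `[< K (eta j) >]]; last first.
  rewrite (eq_bigl (mem S)) // => j; have := aK j; rewrite /=.
  by case: (j \in S) => //= /negbFE.
have [i ij] : exists i, eta j0 i != eta j1 i.
  apply: contrapT => /forallNP H; apply: Kj1; suff <- : eta j0 = eta j1 by [].
  by apply/funext => i; apply/eqP/negP => /negP; exact: H.
have kill j : j \in S -> exists N,
    W (iter N (shiftop (A i) (eta j i)) (\sum_(j in S | `[< K (eta j) >]) w j)).
  move=> jS; have [N wN] := Sw j jS i; exists N.
  set B := iter N _; have Blin : linear B by apply/iter_linear/shiftop_linear/Alin.
  have BW v : W v -> W (B v).
    rewrite /B => Wv; elim: N {wN B Blin} => //= N IHN.
    by apply: subspace_stable_shift => //; exact: WA.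
  have Bw : B (w j) = 0 by [].
  have -> : B (\sum_(j in S | `[< K (eta j) >]) w j)
      = \sum_(k in S :\ j | `[< K (eta k) >]) B (w k).
    rewrite (lin_bigsum Blin) big_mkcondr [in RHS]big_mkcondr /= (big_setD1 j) //=.
    by rewrite Bw if_same add0r.
  apply: IH; first by rewrite (cardsD1 j) jS in Sn.
    move=> k; rewrite inE => /andP[_ kS] i'; rewrite /B.
    elim: N {wN B Blin BW Bw} => [|N IHN] /=; first exact: Sw.
    have Gs := subspace_geig (eta k i') (Alin i').
    apply: subspace_stable_shift => // v; exact: geig_stable.
  have : W (B (\sum_(j in S) w j)) by exact: BW.
  by rewrite (lin_bigsum Blin) (big_setD1 j) //= Bw add0r.
have [[m Wm] [p Wp]] := (kill _ j0S, kill _ j1S).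
exact: (geig_coprime (Alin i) Ws (WA i) ij Wm Wp).
Qed.

Lemma jgen_componentT (W : set V) (K : set (I -> C)) (J : finType)
    (eta : J -> I -> C) (w : J -> V) :
  is_subspace W -> (forall i v, W v -> W (A i v)) ->
  (forall j, jgen (eta j) (w j)) ->
  W (\sum_j w j) -> W (\sum_(j | `[< K (eta j) >]) w j).
Proof.
move=> Ws WA Jw; have := @jgen_component W K J [set: J]%SET eta w Ws WA (fun j _ => Jw j).
rewrite (eq_bigl xpredT) => [|j]; last by rewrite inE.
by rewrite [X in _ -> W X](eq_bigl (fun j => `[< K (eta j) >])) // => j; rewrite inE.
Qed.

Definition jspan (K : set (I -> C)) :=
  span_pred [set v | exists2 eta, K eta & jgen eta v].

(** The difference of the two expressions of [v] is a vanishing sum of joint generalized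
    eigenvectors; its part over [K] is [v], and it lies in the stable subspace 0. *)
Lemma jspan_indep K v : v \in jspan K -> v \in jspan (~` K) -> v = 0.
Proof.
move=> /span_bigsum[n [c [u [uK vE]]]] /span_bigsum[m [d [x [xK vE']]]].
have /choice[eu euP] : forall i, exists e, K e /\ jgen e (u i).
  by move=> i; have [e] := uK i; exists e.
have /choice[ex exP] : forall i, exists e, ~ K e /\ jgen e (x i).
  by move=> i; have [e] := xK i; exists e.
pose eta j := match j with inl i => eu i | inr i => ex i end.
pose w j := match j with inl i => c i *: u i | inr i => - (d i *: x i) end.
have A0 i x0 : [set 0] x0 -> [set 0] (A i x0) by move=> ->; exact: (lin0 (Alin i)).
have wP j : jgen (eta j) (w j).
  case: j => i /=; first exact: (subspaceZ _ (subspace_jgen _) (euP i).2).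
  by rewrite -scaleNr; exact: (subspaceZ _ (subspace_jgen _) (exP i).2).
have := @jgen_componentT [set 0] K ('I_n + 'I_m)%type eta w (subspace0 V) A0 wP.
rewrite [X in _ -> [set 0] X]big_mkcond !big_sumType /= sumrN -vE -vE' subrr.
have -> : \sum_(i < n) (if `[< K (eu i) >] then c i *: u i else 0) = v.
  by rewrite vE; apply: eq_bigr => i _; case: asboolP => // /(_ (euP i).1).
have -> : \sum_(i < m) (if `[< K (ex i) >] then - (d i *: x i) else 0) = 0.
  by rewrite big1 // => i _; case: asboolP => // /(exP i).1.
by rewrite addr0; apply.
Qed.

End JointEigen.

(** * Finite-dimensional subspaces *)

Section FDim.
Variables (C : fieldType) (V : lmodType C).
Implicit Types (W : set V).

(** An upper bound on the dimension in terms of linear dependence alone; it makes sense for any set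
    of vectors and passes to subsets. *)
Definition fdim n W := forall v : 'I_n.+1 -> V, (forall i, W (v i)) ->
  exists c : 'I_n.+1 -> C, (exists i, c i != 0) /\ \sum_i c i *: v i = 0.

Lemma fdim_proper n W W' w : is_subspace W' -> W' `<=` W -> W w -> ~ W' w ->
  fdim n.+1 W -> fdim n W'.
Proof.
move=> W's W'W Ww W'w Wn v W'v.
pose x (i : 'I_n.+2) := if unlift ord0 i is Some j then v j else w.
have [i|c [[i ci] /eqP]] := Wn x; first by rewrite /x; case: unlift => // j; exact: W'W.
rewrite big_ord_recl {1}/x unlift_none.
rewrite (eq_bigr (fun j => c (lift ord0 j) *: v j)) => [/eqP|j _]; last by rewrite /x liftK.
set S := \sum_(_ < _) _ => cS.
have W'S : W' S by apply: subspace_sum => // j _; exact: subspaceZ.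
have c0 : c ord0 = 0.
  apply: contra_notP W'w => /eqP c0.
  have -> : w = - (c ord0)^-1 *: S.
    rewrite scaleNr -[S]opprK scalerN opprK.
    move/eqP: cS; rewrite addr_eq0 => /eqP <-.
    by rewrite scalerA mulVf ?scale1r.
  exact: subspaceZ.
exists (fun j => c (lift ord0 j)); split.
  by move: ci; case: (unliftP ord0 i) => [j ->|->]; [exists j|rewrite c0 eqxx].
by move: cS; rewrite c0 scale0r add0r.
Qed.

Lemma fdim0 W w : fdim 0 W -> W w -> w = 0.
Proof.
move=> W0 Ww; have [//|c [[i ci]]] := W0 (fun=> w).
rewrite big_ord1 => /eqP; rewrite scaler_eq0 => /orP[/eqP c0|/eqP //].
by rewrite (ord1 i) c0 eqxx in ci.
Qed.

Lemma fdim_spanning n W : is_subspace W -> fdim n W ->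
  exists s : seq V, (forall u, u \in s -> W u) /\ forall w, W w -> w \in span_pred [set` s].
Proof.
move=> Ws; elim: n => [|n IH] Wn.
  exists [::]; split=> // w /(fdim0 Wn) ->; exact: span0.
have [|/existsNP[v /not_implyP[Wv vfree]]] := pselect (fdim n W); first exact: IH.
exists (codom v); split=> [u /codomP[i ->] //|w Ww].
pose x (i : 'I_n.+2) := if unlift ord0 i is Some j then v j else w.
have [i|c [[i ci] /eqP]] := Wn x; first by rewrite /x; case: unlift.
rewrite big_ord_recl {1}/x unlift_none.
rewrite (eq_bigr (fun j => c (lift ord0 j) *: v j)) => [/eqP|j _]; last by rewrite /x liftK.
set S := \sum_(_ < _) _ => cS.
have [c0|c0] := eqVneq (c ord0) 0.
  case: vfree; exists (fun j => c (lift ord0 j)); split; last by move: cS; rewrite c0 scale0r add0r.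
  by move: ci; case: (unliftP ord0 i) => [j ->|->]; [exists j|rewrite c0 eqxx].
have -> : w = - (c ord0)^-1 *: S.
  rewrite scaleNr -[S]opprK scalerN opprK.
  move/eqP: cS; rewrite addr_eq0 => /eqP <-.
  by rewrite scalerA mulVf ?scale1r.
apply: spanZ; apply: span_sum => j _; apply: spanZ.
by apply: span_sub; exact: codom_f.
Qed.

(** Coordinates are chosen for each finite family separately. This admits coefficients in a spanning
    list, which are not unique and need not depend linearly on the vector. *)
Lemma fdim_coord (J : finType) W :
  (forall m (v : 'I_m -> V), (forall i, W (v i)) -> exists M : 'I_m -> J -> C,
    forall c : 'I_m -> C, (forall j, \sum_i c i * M i j = 0) -> \sum_i c i *: v i = 0) ->
  fdim #|J| W.
Proof.
move=> WM v /WM[M MP]; pose A : 'M_(#|J|.+1, #|J|) := \matrix_(i, j) M i (enum_val j).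
have : kermx A != 0.
  rewrite kermx_eq0 /row_free; apply: contraTneq (rank_leq_col A) => ->.
  by rewrite -ltnNge.
case/rowV0Pn => x /sub_kermxP xA x0.
exists (fun i => x 0 i); split.
  by have /rV0Pn[i xi] := x0; exists i.
apply: MP => j; have /rowP/(_ (enum_rank j)) := xA.
rewrite !mxE => jx; rewrite -[RHS]jx; apply: eq_bigr => i _; by rewrite mxE enum_rankK.
Qed.

Lemma span_seqP (s : seq V) w : w \in span_pred [set` s] ->
  exists c : 'I_(size s) -> C, w = \sum_i c i *: s`_i.
Proof.
apply: (@span_min _ _ _ [set w | exists c : 'I_(size s) -> C, w = \sum_i c i *: s`_i]).
  split=> /= [|a _ _ [c ->] [d ->]].
    by exists (fun=> 0); rewrite big1 // => i _; rewrite scale0r.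
  exists (fun i => a * c i + d i); rewrite scaler_sumr -big_split /=.
  by apply: eq_bigr => i _; rewrite scalerDl scalerA.
move=> u /= us; have us' : (index u s < size s)%N by rewrite index_mem.
exists (fun i => (i == Ordinal us')%:R); rewrite (bigD1 (Ordinal us')) //= eqxx scale1r.
rewrite big1 ?addr0 ?nth_index // => i /negPf ->; exact: scale0r.
Qed.

Lemma fdim_span (s : seq V) W : (forall w, W w -> w \in span_pred [set` s]) ->
  fdim (size s) W.
Proof.
move=> Ws; rewrite -[size s]card_ord; apply: fdim_coord => m v Wv.
have /choice[M MP] : forall i, exists c : 'I_(size s) -> C, v i = \sum_j c j *: s`_j.
  by move=> i; apply: span_seqP; exact: Ws.
exists M => c cM; under eq_bigr do rewrite MP scaler_sumr.
rewrite exchange_big big1 //= => j _.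
under eq_bigr do rewrite scalerA.
by rewrite -scaler_suml cM scale0r.
Qed.

End FDim.

(** * Decomposition into joint generalized eigenvectors in finite dimension *)

Section JointDecomposition.
Variables (C : closedFieldType) (V : lmodType C).

(** A relation between the vectors [w, T w, .., T^n w] is a nonzero polynomial in [T] killing [w];
    the list consists of its roots. *)
Lemma fdim_annihilator n (W : set V) (T : V -> V) w : linear T ->
  (forall u, W u -> W (T u)) -> fdim n W -> W w ->
  exists l : seq C, foldr (fun c v => shiftop T c v) w l = 0.
Proof.
move=> Tlin WT Wn Ww; have Wi i : W (iter i T w) by elim: i => //= i; exact: WT.
have [//|c [[i ci] cw]] := Wn (fun i => iter i T w).
pose papp (p : {poly C}) v := \sum_(i < size p) p`_i *: iter i T v.
have pappE m (p : {poly C}) v : (size p <= m)%N -> papp p v = \sum_(i < m) p`_i *: iter i T v.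
  move=> pm; rewrite /papp (big_ord_widen m (fun i => p`_i *: iter i T v) pm).
  rewrite big_mkcond; apply: eq_bigr => j _; case: ltnP => // /(nth_default 0) ->.
  by rewrite scale0r.
have pappM (p : {poly C}) z v : papp (p * ('X - z%:P)) v = papp p (shiftop T z v).
  have sp : (size (p * ('X - z%:P))%R <= (size p).+1)%N.
    apply: leq_trans (size_polyMleq _ _) _; by rewrite size_XsubC addn2.
  rewrite (pappE _ _ v sp) mulrBr /papp.
  under eq_bigr do rewrite coefB coefMX coefMC scalerBl.
  rewrite sumrB big_ord_recl /= scale0r add0r [X in _ - X]big_ord_recr /=.
  rewrite nth_default // mul0r scale0r addr0 -sumrB; apply: eq_bigr => j _.
  rewrite /shiftop (linB (iter_linear _ Tlin)) (linZ (iter_linear _ Tlin)).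
  by rewrite scalerBr scalerA -iterSr.
pose p := \poly_(i < n.+1) (if insub i is Some j then c j else 0).
have pw : papp p w = 0.
  rewrite (pappE n.+1) ?size_poly // -[RHS]cw; apply: eq_bigr => j _.
  by rewrite coef_poly ltn_ord (valK j).
have p0 : p != 0.
  apply: contra_neq ci => p0; have : p`_i = 0 by rewrite p0 coef0.
  by rewrite coef_poly ltn_ord (valK i).
have [rs rsE] := closed_field_poly_normal p; exists rs.
have lc0 : lead_coef p != 0 by rewrite lead_coef_eq0.
suff H v : papp (lead_coef p *: \prod_(z <- rs) ('X - z%:P)) v
    = lead_coef p *: foldr (fun c v => shiftop T c v) v rs.
  by apply/eqP; move/eqP: pw; rewrite rsE H scaler_eq0 (negPf lc0).
elim/last_ind: rs v {rsE} => [|rs z IH] v /=.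
  rewrite big_nil (@pappE 1%N) ?big_ord1 ?alg_polyC ?coefC //; exact: size_polyC_leq1.
by rewrite -cats1 big_cat big_seq1 /= scalerAl pappM IH foldr_cat.
Qed.

Variables (I : Type) (A : I -> V -> V).
Hypothesis Alin : forall i, linear (A i).
(** The family may be infinite, so the induction is on the dimension: either every [A i] has a
    single generalized eigenvalue on all of [W], or some [A i] cuts [W] into proper stable
    pieces. *)
Lemma joint_decomp n (W : set V) w : is_subspace W ->
  (forall i v, W v -> W (A i v)) ->
  (forall i j v, W v -> comm (A i) (comm (A i) (A j)) v = 0) -> fdim n W -> W w ->
  w \in span_pred [set u | W u /\ exists eta, jgen A eta u].
Proof.
elim: n W w => [|n IH] W w Ws WA A2 Wn Ww; first by rewrite (fdim0 Wn Ww) span0.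
have [/choice[eta etaP]|/existsNP[i ni]] :=
    pselect (forall i, exists c, forall u, W u -> geig (A i) c u).
  by apply: span_sub; split=> //; exists eta => i; exact: etaP.
have [l lw] := fdim_annihilator (Alin i) (WA i) Wn Ww.
apply: span_incl (geig_decomp (Alin i) Ws (WA i) Ww lw) => u [Wu [c cu]].
pose W' := W `&` geig (A i) c.
have W's : is_subspace W' by apply: subspaceI => //; exact: subspace_geig.
have W'A j v : W' v -> W' (A j v).
  case=> Wv cv; split; first exact: WA.
  by apply: (geig_comm2 (W := W)) => // *; [exact: WA|exact: A2].
have [x Wx W'x] : exists2 x, W x & ~ W' x.
  apply: contrapT => H; apply: ni; exists c => x Wx; apply: contrapT => cx.
  by apply: H; exists x => // -[].
have W'n : fdim n W' by apply: fdim_proper Wx W'x Wn => // v [].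
have W'2 j j' v : W' v -> comm (A j) (comm (A j) (A j')) v = 0 by case=> /A2.
have W'u : W' u by [].
by apply: span_mono (IH _ _ W's W'A W'2 W'n W'u) => v [[Wv _] ?].
Qed.

End JointDecomposition.

Lemma comm2_commuting (C : fieldType) (V : lmodType C) (I : Type) (A : I -> V -> V)
    (W : set V) : (forall i, linear (A i)) -> (forall i v, W v -> W (A i v)) ->
  (forall i j v, W v -> A i (A j v) = A j (A i v)) ->
  forall i j v, W v -> comm (A i) (comm (A i) (A j)) v = 0.
Proof.
move=> Alin WA Acom i j v Wv.
have c0 w : W w -> comm (A i) (A j) w = 0 by move=> Ww; rewrite /comm Acom ?subrr.
by rewrite {1}/comm !c0 ?(lin0 (Alin i)) ?subrr //; exact: WA.
Qed.

(** Split off the [c]-part of a decomposition of [v] into eigenvectors: the rest is both a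
    generalized eigenvector for [c] and a sum of eigenvectors for other eigenvalues, hence 0. *)
Lemma span_eigen_geig (C : fieldType) (V : lmodType C) (T : V -> V) c v : linear T ->
  v \in span_pred [set u | exists a, T u = a *: u] -> geig T c v -> T v = c *: v.
Proof.
move=> Tlin vS vc; have Al (i : unit) : linear ((fun=> T) i) by [].
have A2 i j w := @comm2_commuting C V unit (fun=> T) setT Al (fun _ _ _ => I)
  (fun _ _ _ _ => erefl) i j w I.
pose K := [set eta : unit -> C | eta tt = c].
suff [v1 [v2 [vE v1c v2K]]] : exists v1 v2,
    [/\ v = v1 + v2, T v1 = c *: v1 & v2 \in jspan (fun=> T) (~` K)].
  suff v20 : v2 = 0 by rewrite vE v20 addr0.
  apply: (jspan_indep Al A2) v2K; apply: span_sub; exists (fun=> c) => // i.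
  have -> : v2 = v - v1 by rewrite vE addrC addKr.
  by apply: (subspaceB (subspace_geig c Tlin)) => //; exact: geig_eig.
move: vS; apply: (@span_min _ _ _ [set v | exists v1 v2,
    [/\ v = v1 + v2, T v1 = c *: v1 & v2 \in jspan (fun=> T) (~` K)]]).
  split; first by exists 0, 0; rewrite addr0 (lin0 Tlin) scaler0 span0.
  move=> a _ _ [u1 [u2 [-> u1c u2K]]] [w1 [w2 [-> w1c w2K]]].
  exists (a *: u1 + w1), (a *: u2 + w2); split.
  - by rewrite scalerDr addrACA.
  - by rewrite Tlin u1c w1c scalerDr !scalerA mulrC.
  - by apply: spanD => //; exact: spanZ.
move=> u [a ua]; have [ac|ac] := eqVneq a c; first by exists u, 0; rewrite addr0 -ac span0.
exists 0, u; rewrite add0r (lin0 Tlin) scaler0; split=> //; apply: span_sub.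
exists (fun=> a); first by move/eqP: ac.
by move=> _; exact: geig_eig.
Qed.

(** The last nonzero image of [w] under powers of [A i - eta i] is an eigenvector of [A i], and
    commutation preserves what was gained for the earlier operators. Finite lists are enough later,
    where each identity between eigenvalues involves a few operators. *)
Lemma jgen_eigenvector (C : fieldType) (V : lmodType C) (I : eqType) (A : I -> V -> V)
    (W : set V) (eta : I -> C) (u : V) (s : seq I) :
  (forall i, linear (A i)) -> is_subspace W -> (forall i v, W v -> W (A i v)) ->
  (forall i j v, W v -> A i (A j v) = A j (A i v)) ->
  W u -> jgen A eta u -> u != 0 ->
  exists u', [/\ W u', u' != 0, jgen A eta u' & forall i, i \in s -> A i u' = eta i *: u'].
Proof.
move=> Alin Ws WA Acom Wu ju u0; elim: s => [|i s [w [Ww w0 jw ws]]]; first by exists u.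
have [N wN] := jw i.
have [M MN wM] : exists2 M, iter M (shiftop (A i) (eta i)) w != 0 &
    iter M.+1 (shiftop (A i) (eta i)) w = 0.
  elim: N wN => [/= /eqP|N IH wN]; first by rewrite (negPf w0).
  by have [/IH //|N0] := eqVneq (iter N (shiftop (A i) (eta i)) w) 0; exists N.
have WS j m v : W v -> W (iter m (shiftop (A j) (eta j)) v).
  by move=> Wv; elim: m => //= m; apply: subspace_stable_shift => //; exact: WA.
have Scom j v : W v ->
    iter M (shiftop (A i) (eta i)) (A j v) = A j (iter M (shiftop (A i) (eta i)) v).
  move=> Wv; elim: M {MN wM} => //= M ->.
  by rewrite /shiftop Acom ?(linB (Alin j)) ?(linZ (Alin j)) //; exact: WS.
exists (iter M (shiftop (A i) (eta i)) w); split=> // [|j|j]; first exact: WS.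
  have [m wm] := jw j; exists m.
  have SSC v : W v -> shiftop (A j) (eta j) (iter M (shiftop (A i) (eta i)) v)
      = iter M (shiftop (A i) (eta i)) (shiftop (A j) (eta j) v).
    have Ml := iter_linear M (shiftop_linear (eta i) (Alin i)).
    by move=> Wv; rewrite /shiftop (linB Ml) (linZ Ml) -Scom.
  rewrite (_ : iter m _ _ = iter M (shiftop (A i) (eta i)) (iter m (shiftop (A j) (eta j)) w)).
    by rewrite wm (iter0 _ (shiftop_linear (eta i) (Alin i))).
  by elim: (m) => //= p ->; rewrite SSC //; exact: WS.
rewrite inE => /predU1P[->|js].
  by apply/eqP; rewrite -subr_eq0; apply/eqP.
by rewrite -Scom // ws // (linZ (iter_linear M (shiftop_linear (eta i) (Alin i)))).
Qed.

(** * Generalized root decomposition of the finite-dimensional algebra *)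

Section Lie.
Variables (R : realType) (G : simpleLie R).
Local Notation C := R[i].
Local Notation h := (hfin G).
Local Notation alpha := (@simple_root R G).

Definition Qlat (la : hdual h) := exists c : 'I_(\dim h) -> int, la = \sum_i alpha i *~ c i.

(** The simple roots are a free family of [dim h] elements of the dual of [h], hence a basis of
    it. *)
Lemma simple_root_separate (s : subvs_of h) : (forall i, alpha i s = 0) -> s = 0.
Proof.
move=> s0; have [_ afree _] := simple_rootP G.
have sz : size [seq alpha i | i <- enum 'I_(\dim h)] = \dim h by rewrite size_map size_enum_ord.
pose X := [tuple of [seq alpha i | i <- enum 'I_(\dim h)]].
have Xb : basis_of fullv X.
  rewrite basisEfree afree subvf /= sz dimvf /=.
  by rewrite /dim /= muln1.
have phi0 (phi : hdual h) : phi s = 0.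
  have := memvf phi; rewrite -(span_basis Xb) => /coord_span ->.
  rewrite sum_lfunE big1 // => i _; rewrite scale_lfunE.
  have /mapP[j _ ->] : X`_i \in X by apply: mem_nth; rewrite size_tuple.
  by rewrite s0 scaler0.
rewrite (coord_vbasis (memvf s)) big1 // => i _.
have := phi0 (linfun (coord (vbasis fullv) i : subvs_of h -> C^o)).
by rewrite lfunE /= => ->; rewrite scale0r.
Qed.

Lemma lbr_anti (x y : G) : lbr x y = - lbr y x.
Proof.
apply/eqP; rewrite -addr_eq0; apply/eqP; have := lbrxx (x + y).
by rewrite (linD (lbr_linearl _)) !(linD (lbr_linearr _)) !lbrxx add0r addr0.
Qed.

Lemma lbr_jacobil (x y z : G) : lbr (lbr x y) z = lbr x (lbr y z) - lbr y (lbr x z).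
Proof.
rewrite [LHS]lbr_anti; apply/esym/eqP; rewrite -subr_eq0 opprK.
have := lbr_jacobi x y z; rewrite (lbr_anti z x) -[- lbr x z]scaleN1r.
by rewrite (linZ (lbr_linearr _)) scaleN1r => ->.
Qed.

(** [is_cartan] provides nilpotency. Commutativity comes from the roots: on a simple root vector
    [[t, t']] acts by the commutator of two scalars, so every simple root vanishes at it. *)
Lemma hfin_abelian (t t' : subvs_of h) : lbr (vsval t) (vsval t') = 0.
Proof.
have [hh _ _] := hfin_cartan G; have tt' := hh _ _ (subvsP t) (subvsP t').
have := vsprojK tt'; set s := vsproj h _ => sE; rewrite -sE.
suff -> : s = 0 by rewrite linear0.
apply: simple_root_separate => i; have [rooti _ _] := simple_rootP G.
have [_ [x [x0 xi]]] := rooti i.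
have := xi s; rewrite sE lbr_jacobil !xi !(linZ (lbr_linearr _)) !xi !scalerA mulrC subrr.
by move=> /esym/eqP; rewrite scaler_eq0 (negPf x0) orbF => /eqP.
Qed.

Lemma lbr_hfinC (t t' : subvs_of h) x :
  lbr (vsval t) (lbr (vsval t') x) = lbr (vsval t') (lbr (vsval t) x).
Proof.
apply/eqP; rewrite -subr_eq0 -lbr_jacobil hfin_abelian.
by rewrite (lin0 (lbr_linearl _)).
Qed.

Lemma Qlat_root (be : hdual h) : is_root be -> Qlat be.
Proof.
have [_ _ rootQ] := simple_rootP G; case/rootQ => c [->|->]; last first.
  exists (fun i => - (c i)%:Z); rewrite -sumrN; apply: eq_bigr => i _.
  by rewrite mulrNz.
by exists (fun i => (c i)%:Z); apply: eq_bigr.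
Qed.

(** A genuine eigenvector for a basis of [h] shows that [eta], a priori a mere function, is linear;
    it is then 0 or a root. *)
Lemma ad_weight_Qlat (x : G) (eta : subvs_of h -> C) : x != 0 ->
  jgen (fun t => lbr (vsval t)) eta x -> exists2 la, Qlat la & eta = la.
Proof.
move=> x0 jx; have Al (t : subvs_of h) : linear (lbr (vsval t) : G -> G) by exact: lbr_linearr.
have Ts : @is_subspace C G setT by [].
have [y [_ y0 jy yb]] := jgen_eigenvector (vbasis (fullv : {vspace subvs_of h})) Al Ts
  (fun _ _ _ => I) (fun t t' z _ => lbr_hfinC t t' z) I jx x0.
pose la : hdual h := \sum_(i < \dim (fullv : {vspace subvs_of h}))
  eta (vbasis fullv)`_i *: linfun (coord (vbasis fullv) i : subvs_of h -> C^o).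
have laE t : lbr (vsval t) y = la t *: y.
  rewrite {1}(coord_vbasis (memvf t)) linear_sum.
  rewrite (lin_sum (lbr_linearl y)).
  rewrite sum_lfunE scaler_suml; apply: eq_bigr => i _.
  rewrite scale_lfunE lfunE /= (linZ (lbr_linearl y)) yb ?scalerA 1?mulrC //.
  by apply: mem_nth; rewrite size_tuple.
exists la; last first.
  apply/funext => t; apply: contraTeq isT => tla; suff : y = 0 by move/eqP: y0.
  by apply: (geig_uniq (Al t) tla (jy t)); exact: geig_eig.
have [->|la0] := eqVneq la 0; first by exists (fun=> 0); rewrite big1.
by apply: Qlat_root; split=> //; exists y.
Qed.

(** A weak root space decomposition: its terms are only generalized weight vectors of [ad h], and
    become genuine ones when acting on a diagonalizable module ([xweight_geig]). *)
Lemma lie_decomp (x : G) : x \in span_pred [set u | exists la : hdual h, Qlat la /\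
  forall t, geig (lbr (vsval t)) (la t) u].
Proof.
have Al (t : subvs_of h) : linear (lbr (vsval t) : G -> G) by exact: lbr_linearr.
have A2 := @comm2_commuting _ _ _ _ setT Al (fun _ _ _ => I) (fun t t' x _ => lbr_hfinC t t' x).
have Wn : @fdim C G (size (vbasis (fullv : {vspace G}))) setT.
  apply: fdim_span => w _; rewrite (coord_vbasis (memvf w)); apply: span_sum => i _.
  by apply: spanZ; apply: span_sub; apply: mem_nth; rewrite size_tuple.
have Ts : @is_subspace C G setT by [].
apply: span_incl (joint_decomp Al Ts (fun _ _ _ => I) A2 Wn (I : setT x)) => u [_ [eta jeta]].
have [->|u0] := eqVneq u 0; first exact: span0.
have [la Qla etaE] := ad_weight_Qlat u0 jeta.
by apply: span_sub; exists la; split=> // t; rewrite -etaE.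
Qed.

End Lie.

(** * Operators on formal sums *)

Section Exponents.
Variable k : nat.

Definition zcons (m : int) (r : zk k) : zk k.+1 :=
  [ffun i => if unlift ord0 i is Some j then r j else m].

Lemma zcons0 m r : zcons m r ord0 = m. Proof. by rewrite ffunE unlift_none. Qed.

Lemma ttail_cons m r : ttail (zcons m r) = r.
Proof. by apply/ffunP => i; rewrite !ffunE liftK. Qed.

Lemma zcons00 : zcons 0 0 = 0.
Proof. by apply/ffunP => i; rewrite !ffunE; case: unlift => // j; rewrite ffunE. Qed.

Lemma zconsD m r n s : zcons m r + zcons n s = zcons (m + n) (r + s).
Proof. by apply/ffunP => i; rewrite !ffunE; case: unlift => // j; rewrite ffunE. Qed.

Definition zdelta (i : 'I_k) : zk k := [ffun j => (j == i)%:Z].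

Lemma zk_sum (a : zk k) : a = \sum_i zdelta i *~ a i.
Proof.
apply/ffunP => j; rewrite (big_morph (fun f : zk k => f j) (id1 := 0) (op1 := +%R));
  [|by move=> f g; rewrite ffunE|by rewrite ffunE].
rewrite (bigD1 j) //= big1 ?addr0 => [|i ij]; rewrite ffunMzE ffunE ?eqxx ?intz //.
by rewrite eq_sym (negPf ij) mul0rz.
Qed.

Lemma zk_ind (Q : zk k -> Prop) : Q 0 -> (forall a i, Q a -> Q (a + zdelta i)) ->
  (forall a i, Q a -> Q (a - zdelta i)) -> forall a, Q a.
Proof.
move=> Q0 QD QB a.
have Qi b i (n : int) : Q b -> Q (b + zdelta i *~ n).
  move=> Qb; elim/int_ind: n => [|n IH|n IH]; first by rewrite mulr0z addr0.
    by rewrite -pmulrn mulrSr addrA; apply: QD.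
  by rewrite mulrNz -pmulrn mulrSr opprD addrA; apply: QB; rewrite pmulrn -mulrNz.
rewrite [a]zk_sum; move: (a) => b; elim: (index_enum _) => [|i s IH]; first by rewrite big_nil.
by rewrite big_cons addrC; exact: Qi.
Qed.

End Exponents.

Section Hat.
Variables (R : realType) (G : simpleLie R) (k : nat).
Local Notation C := R[i].
Local Notation h := (hfin G).
Implicit Type E : tmod G k.+1.

Definition idx := (option (subvs_of h) * zk k)%type.

Definition igen (i : idx) : tgen G k.+1 :=
  if i.1 is Some t then GX (vsval t) (zcons 0 i.2) else GK G (zcons 0 i.2) ord0.

Lemma igen_shift i : Lpi_shift (igen i) = i.2.
Proof. by case: i => -[t|] r; rewrite /igen /= ttail_cons. Qed.

(* The operator of [u] on formal sums [\sum_g F g] with [F g] thought of as being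
   of degree [g] in [t_2, ...]. *)
Definition hact E (u : tgen G k.+1) (F : zk k -> E) : zk k -> E :=
  fun g => act u (F (g - Lpi_shift u)).

Definition hA E (i : idx) : (zk k -> E) -> zk k -> E := hact (igen i).

Section OneModule.
Variable E : tmod G k.+1.

Lemma hact_linear u : linear (@hact E u).
Proof. by move=> a F F'; apply/funext => g; rewrite /hact [LHS]act_linear. Qed.

Lemma hA_linear i : linear (@hA E i). Proof. exact: hact_linear. Qed.

Lemma hact_comm u u' (F : zk k -> E) g :
  comm (@hact E u) (@hact E u') F g = comm (act u) (act u') (F (g - Lpi_shift u - Lpi_shift u')).
Proof.
transitivity (hact u (hact u' F) g - hact u' (hact u F) g); first by [].
by rewrite /hact /comm [X in _ - act _ (act _ (F X))]addrAC.
Qed.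

Lemma GX0 m (v : E) : act (GX 0 m) v = 0.
Proof. exact: (lin0 (act_X_linear m v)). Qed.

Lemma act_KXc m i x s (v : E) : act (GK G m i) (act (GX x s) v) = act (GX x s) (act (GK G m i) v).
Proof. by apply/eqP; rewrite -subr_eq0; apply/eqP; exact: act_KX. Qed.

Lemma act_KKc m i s j (v : E) : act (GK G m i) (act (GK G s j) v) = act (GK G s j) (act (GK G m i) v).
Proof. by apply/eqP; rewrite -subr_eq0; apply/eqP; exact: act_KK. Qed.

Lemma act_h_comm (t t' : subvs_of h) m s (v : E) :
  comm (act (GX (vsval t) m)) (act (GX (vsval t') s)) v
  = form (vsval t) (vsval t') *: \sum_i (m i)%:~R *: act (GK G (m + s) i) v.
Proof. by rewrite act_XX hfin_abelian GX0 add0r. Qed.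

(** The bracket of two Cartan elements consists of the [t^m K_i], which commute with all the
    [igen j]. *)
Lemma igen_comm2 i j (v : E) :
  comm (act (igen i)) (comm (act (igen i)) (act (igen j))) v = 0.
Proof.
case: i j => [[t|] r] [[t'|] r']; rewrite /igen /= {1}/comm.
- rewrite !act_h_comm (linZ (act_linear _)) -scalerBr (lin_sum (act_linear _)) -sumrB.
  rewrite big1 ?scaler0 // => i _; rewrite (linZ (act_linear _)) -scalerBr.
  by rewrite act_KXc subrr scaler0.
- by rewrite /comm !act_KXc !subrr (lin0 (act_linear _)) subrr.
- by rewrite !act_KX (lin0 (act_linear _)) subrr.
- by rewrite !act_KK (lin0 (act_linear _)) subrr.
Qed.

Lemma hact_comm2 i u :
  (forall v : E, comm (act (igen i)) (comm (act (igen i)) (act u)) v = 0) ->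
  forall F, comm (@hA E i) (comm (@hA E i) (@hact E u)) F = 0.
Proof.
move=> H F; apply/funext => g.
transitivity (act (igen i) (comm (hA i) (hact u) F (g - Lpi_shift (igen i)))
  - comm (hA i) (hact u) (hA i F) g); first by [].
rewrite !hact_comm.
apply: etrans (H (F (g - Lpi_shift (igen i) - Lpi_shift (igen i) - Lpi_shift u))).
rewrite [RHS]/comm; congr (_ - comm _ _ _); rewrite /hA /hact.
by congr (act _ (F _)); rewrite [RHS]addrAC.
Qed.

Lemma hA2 i j F : comm (@hA E i) (comm (@hA E i) (@hA E j)) F = 0.
Proof. by apply: hact_comm2 => v; exact: igen_comm2. Qed.

Definition dweight (c : C) (g : zk k) (i : 'I_k.+1) : C :=
  if unlift ord0 i is Some j then (g j)%:~R else c.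

Lemma dweightD c g (m : zk k.+1) i :
  dweight (c + (m ord0)%:~R) (g + ttail m) i = dweight c g i + (m i)%:~R.
Proof.
by rewrite /dweight; case: unliftP => [j ->|->] //; rewrite !ffunE intrD.
Qed.

Definition wt mu ka c g : set E := weight_space mu ka (dweight c g).

Lemma subspace_weight mu (ka de : 'I_k.+1 -> C) : @is_subspace C E (weight_space mu ka de).
Proof.
have L u := lin0 (@act_linear R G k.+1 E u).
split; first by split=> *; rewrite L scaler0.
move=> a u v [hu Ku du] [hv Kv dv]; split=> x; rewrite act_linear.
- by rewrite hu hv scalerDr !scalerA mulrC.
- by rewrite Ku Kv scalerDr !scalerA mulrC.
- by rewrite du dv scalerDr !scalerA mulrC.
Qed.

(* [x (x) t^m] behaves on [E] as if [x] had weight [la] *)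
Definition xweight (la : hdual h) x :=
  forall t m (v : E), act (GX (lbr (vsval t) x) m) v = la t *: act (GX x m) v.

Lemma xweight_h (t : subvs_of h) : xweight 0 (vsval t).
Proof. by move=> t' m v; rewrite hfin_abelian GX0 lfunE scale0r. Qed.

Lemma commE (V : zmodType) (a b : V -> V) v : a (b v) = b (a v) + comm a b v.
Proof. by rewrite /comm addrC subrK. Qed.

Lemma act_h0X x la t m (v : E) : xweight la x ->
  act (GX (vsval t) 0) (act (GX x m) v) = act (GX x m) (act (GX (vsval t) 0) v) + la t *: act (GX x m) v.
Proof.
move=> xla; rewrite commE act_XX xla add0r big1 ?scaler0 ?addr0 // => i _.
by rewrite ffunE scale0r.
Qed.

Lemma wt_GX x la mu ka c g (m : zk k.+1) v : xweight la x -> wt mu ka c g v ->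
  wt (mu + la) ka (c + (m ord0)%:~R) (g + ttail m) (act (GX x m) v).
Proof.
move=> xla [hv Kv dv]; split=> [t|i|i].
- by rewrite (act_h0X _ _ _ xla) hv (linZ (act_linear _)) add_lfunE scalerDl.
- by rewrite act_KXc Kv (linZ (act_linear _)).
- by rewrite commE act_DX dv (linZ (act_linear _)) dweightD scalerDl.
Qed.

Lemma wt_GK j mu ka c g (m : zk k.+1) v : wt mu ka c g v ->
  wt mu ka (c + (m ord0)%:~R) (g + ttail m) (act (GK G m j) v).
Proof.
move=> [hv Kv dv]; split=> [t|i|i].
- by rewrite -act_KXc hv (linZ (act_linear _)).
- by rewrite act_KKc Kv (linZ (act_linear _)).
- by rewrite commE act_DK dv (linZ (act_linear _)) dweightD scalerDl.
Qed.

Lemma wt_igen i mu ka c g v : wt mu ka c g v -> wt mu ka c (g + i.2) (act (igen i) v).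
Proof.
case: i => -[t|] r wv; rewrite /igen /=.
  by have := wt_GX (zcons 0 r) (xweight_h t) wv; rewrite zcons0 !addr0 ttail_cons.
by have := wt_GK ord0 (zcons 0 r) wv; rewrite zcons0 addr0 ttail_cons.
Qed.

End OneModule.
End Hat.

(** * Periodic formal sums *)

Section Period.
Variables (R : realType) (G : simpleLie R) (k : nat).
Local Notation C := R[i].
Local Notation h := (hfin G).
Variable l : 'I_k -> nat.
Hypothesis l_gt0 : forall i, (0 < l i)%N.

Definition per i : zk k := zdelta i *+ l i.

Definition lat (a : zk k) : zk k := \sum_i per i *~ a i.

Lemma latE a j : lat a j = a j * (l j)%:Z.
Proof.
rewrite /lat sum_ffunE (bigD1 j) //= big1 ?addr0 => [|i ij].
  by rewrite ffunMzE ffunMnE ffunE eqxx natz mulrzz mulrC.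
by rewrite ffunMzE ffunMnE ffunE eq_sym (negPf ij) mul0rn mul0rz.
Qed.

Lemma lat0 : lat 0 = 0.
Proof. by apply/ffunP => j; rewrite latE !ffunE mul0r. Qed.

Lemma latD a i : lat (a + zdelta i) = lat a + per i.
Proof.
apply/ffunP => j; rewrite ffunE !latE /per ffunMnE !ffunE mulrDl; congr (_ + _).
by case: eqVneq => [->|_]; rewrite ?mul1r ?mul0r ?mul0rn ?natz.
Qed.

Lemma latB a i : lat (a - zdelta i) = lat a - per i.
Proof. by rewrite -[in RHS](subrK (zdelta i) a) latD addrK. Qed.

Lemma lat_box (g : zk k) : exists b a : zk k,
  (forall i, (`|b i| < l i)%N /\ b i = `|b i|%N :> int) /\ g = b + lat a.
Proof.
exists [ffun i => (g i %% l i)%Z], [ffun i => (g i %/ l i)%Z]; split=> [i|].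
  have l0 : (l i)%:Z != 0 by rewrite eqz_nat -lt0n.
  rewrite ffunE gez0_abs ?modz_ge0 //; split=> //.
  by rewrite -ltz_nat gez0_abs ?modz_ge0 // ltz_pmod ?ltz_nat.
by apply/ffunP => i; rewrite ffunE latE !ffunE addrC -divz_eq.
Qed.

Variable E : tmod G k.+1.

Definition Zop (i : 'I_k) : E -> E := act (GK G (zcons 0 (per i)) ord0).

Definition periodic (F : zk k -> E) := forall i g, F (g + per i) = Zop i (F g).

Lemma Zop_linear i : linear (Zop i). Proof. exact: act_linear. Qed.

Hypothesis Zinj : forall i, injective (Zop i).

Lemma periodic_eq (F F' : zk k -> E) g a : periodic F -> periodic F' ->
  F g = F' g -> F (g + lat a) = F' (g + lat a).
Proof.
move=> pF pF' FF'; elim/zk_ind: a => [|a i IH|a i IH]; first by rewrite lat0 addr0.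
  by rewrite latD addrA pF pF' IH.
by apply: (Zinj (i := i)); rewrite -pF -pF' latB addrA subrK.
Qed.

Lemma subspace_periodic : is_subspace periodic.
Proof.
split=> [i g|a F F' pF pF' i g]; first by rewrite (lin0 (Zop_linear i)).
have FE g' : (a *: F + F') g' = a *: F g' + F' g' by [].
by rewrite !FE pF pF' (Zop_linear i).
Qed.

Lemma hact_periodic u (F : zk k -> E) : (if u is GD _ then False else True) ->
  periodic F -> periodic (hact u F).
Proof.
move=> uG pF i g; rewrite /hact [g + per i - _]addrAC pF /Zop.
by case: u uG => // [x m|m j] _; rewrite ?act_KXc // act_KKc.
Qed.

(* [F] stands for the formal sum of the vectors [F g], of degree [g] in
   [t_2, ...]; periodicity keeps the space of such sums finite-dimensional. *)
Definition PW mu ka c : set (zk k -> E) :=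
  [set F | (forall g, wt mu ka c g (F g)) /\ periodic F].

Lemma subspace_PW mu ka c : is_subspace (PW mu ka c).
Proof.
have W g := subspace_weight E mu ka (dweight c g).
split; first by split=> [g|]; [exact: (W g).1|exact: subspace_periodic.1].
move=> a F F' [wF pF] [wF' pF']; split; last exact: subspace_periodic.2.
by move=> g; exact: ((W g).2 a _ _ (wF g) (wF' g)).
Qed.

(** A periodic formal sum is determined by its values at the degrees of the finite box
    [0 <= g i < l i], and each of these values lies in a finite-dimensional weight space. *)
Lemma fdim_PW mu ka c : finite_dim_weight_spaces E -> exists n, fdim n (PW mu ka c).
Proof.
move=> Efd; pose L := (\max_i l i)%N; pose box := {ffun 'I_k -> 'I_L}.
pose pt (b : box) : zk k := [ffun i => (b i)%:Z].
have bs (b : box) : exists s : seq E, forall v, wt mu ka c (pt b) v -> v \in span_pred [set` s].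
  exact: Efd.
have [s sP] := choice bs.
exists #|{: {b : box & 'I_(size (s b))}}|; apply: fdim_coord => m v Pv.
have vd (ib : 'I_m * box) : exists d : nat -> C,
    v ib.1 (pt ib.2) = \sum_(j < size (s ib.2)) d j *: (s ib.2)`_j.
  case: ib => i b; have /span_seqP[d ->] := sP _ _ ((Pv i).1 (pt b)).
  exists (fun j => if insub j is Some j' then d j' else 0).
  by apply: eq_bigr => j _; rewrite (valK j).
have [f fP] := choice vd.
exists (fun i bj => f (i, tag bj) (tagged bj : 'I_(size (s (tag bj))))) => d dM.
have Sw : PW mu ka c (\sum_i d i *: v i).
  by apply: subspace_sum => [|i _]; [exact: subspace_PW|apply: subspaceZ => //; exact: subspace_PW].
have SE g : (\sum_i d i *: v i) g = \sum_i d i *: v i g.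
  by elim/big_rec2: _ => // i y1 y2 _ <-.
apply/funext => g; have [b [a [bb ->]]] := lat_box g.
apply: (@periodic_eq _ (fun=> 0)) => [||]; first exact: Sw.2.
  by move=> i g'; rewrite (lin0 (Zop_linear i)).
have bL i : (`|b i| < L)%N by apply: leq_trans (bb i).1 _; exact: (leq_bigmax i).
pose b' : box := [ffun i => Ordinal (bL i)].
have -> : b = pt b' by apply/ffunP => i; rewrite !ffunE /=; exact: (bb i).2.
have fP' i : v i (pt b') = \sum_(j < size (s b')) f (i, b') j *: (s b')`_j by exact: (fP (i, b')).
rewrite SE; under eq_bigr do rewrite fP' scaler_sumr.
rewrite exchange_big big1 // => j _; under eq_bigr do rewrite scalerA.
rewrite -scaler_suml; have := dM (Tagged (fun b => 'I_(size (s b))) j).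
by move=> /= ->; rewrite scale0r.
Qed.

Hypothesis Zsurj : forall i v, exists w, Zop i w = v.

Lemma Zop_comm i j v : Zop i (Zop j v) = Zop j (Zop i v).
Proof. exact: act_KKc. Qed.

Lemma wt_Zop_inv i mu ka c g v : wt mu ka c (g + per i) (Zop i v) -> wt mu ka c g v.
Proof.
have Zl := Zop_linear i; case=> hv Kv dv; split=> [t|j|j]; apply: (Zinj (i := i)).
- by rewrite (linZ Zl) -hv /Zop act_KXc.
- by rewrite (linZ Zl) -Kv /Zop act_KKc.
- rewrite (linZ Zl) -[LHS](addrK ((zcons 0 (per i) j)%:~R *: Zop i v)).
  have -> : Zop i (act (GD G j) v) + (zcons 0 (per i) j)%:~R *: Zop i v = act (GD G j) (Zop i v).
    by rewrite [RHS]commE act_DK.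
  rewrite dv -scalerBl; congr (_ *: _); apply/eqP; rewrite subr_eq; apply/eqP.
  by rewrite -[zcons 0 _ j in RHS]/(zcons 0 (per i) j) -dweightD zcons0 addr0 ttail_cons.
Qed.

(** [Zp a] is the product of the powers [Zop i ^ (a i)], with a chosen inverse of [Zop i] for
    negative exponents. *)
Lemma Zop_powers : exists Zp : zk k -> E -> E, (forall v, Zp 0 v = v) /\
  forall a i v, Zp (a + zdelta i) v = Zop i (Zp a v).
Proof.
have [Zi ZiK] : exists Zi : 'I_k -> E -> E, forall i, cancel (Zi i) (Zop i).
  by have [Zi ZiK] := choice (fun iv : 'I_k * E => Zsurj iv.1 iv.2);
    exists (fun i v => Zi (i, v)) => i v; exact: (ZiK (i, v)).
have ZiC i j v : Zi i (Zop j v) = Zop j (Zi i v).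
  by apply: (Zinj (i := i)); rewrite ZiK Zop_comm ZiK.
pose zit i (n : int) v := match n with Posz m => iter m (Zop i) v | Negz m => iter m.+1 (Zi i) v end.
have zitS i n v : zit i (n + 1) v = Zop i (zit i n v).
  case: n => [m|[|m]]; first by rewrite -PoszD addn1.
    by rewrite /= ZiK.
  have -> : Negz m.+1 + 1 = Negz m by rewrite !NegzE; lia.
  by rewrite /= ZiK.
have zitC i j n v : zit i n (Zop j v) = Zop j (zit i n v).
  case: n => m; first by elim: m => //= m ->; rewrite Zop_comm.
  by rewrite /= -ZiC; congr Zi; elim: m => //= m ->; rewrite ZiC.
pose Zp a v := foldr (fun i x => zit i (a i) x) v (enum 'I_k).
exists Zp; split=> [v|a i v]; rewrite /Zp.
  by elim: (enum _) => //= i s ->; rewrite ffunE.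
suff : forall s, uniq s -> foldr (fun j x => zit j ((a + zdelta i) j) x) v s
    = if i \in s then Zop i (foldr (fun j x => zit j (a j) x) v s)
      else foldr (fun j x => zit j (a j) x) v s.
  by move=> /(_ _ (enum_uniq _)) ->; rewrite mem_enum.
elim=> //= j s IH /andP[js us]; rewrite (IH us) !ffunE inE eq_sym.
have [ij|ij] := eqVneq i j; last by rewrite addr0; case: ifP => // _; rewrite zitC.
by subst j; rewrite (negPf js) zitS.
Qed.

(** The vector is spread along the coset [g + lat] by the products of powers of the [Zop i], and the
    formal sum is 0 off this coset. In this way every weight vector with integral degrees becomes a
    value of a periodic formal sum. *)
Lemma periodic_ext mu ka c g v : wt mu ka c g v ->
  exists F, [/\ PW mu ka c F, F g = v & forall g', (forall a, g' <> g + lat a) -> F g' = 0].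
Proof.
move=> wv; have [Zp [Zp0 ZpD]] := Zop_powers.
have ZpB a i : Zop i (Zp (a - zdelta i) v) = Zp a v by rewrite -ZpD subrK.
have latI : injective lat.
  move=> a b /ffunP ab; apply/ffunP => i; have := ab i; rewrite !latE.
  by apply: mulIf; rewrite eqz_nat -lt0n.
pose F g' := if pselect (exists a, g' = g + lat a) is left e then Zp (projT1 (cid e)) v else 0.
have FE a : F (g + lat a) = Zp a v.
  rewrite /F; case: pselect => [e|[]]; last by exists a.
  by case: (cid e) => /= b /addrI/latI ->.
have wF a : wt mu ka c (g + lat a) (Zp a v).
  elim/zk_ind: a => [|a i IH|a i IH]; first by rewrite lat0 addr0 Zp0.
    rewrite latD addrA ZpD; have := wt_GK ord0 (zcons 0 (per i)) IH.
    by rewrite zcons0 addr0 ttail_cons.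
  by apply: (@wt_Zop_inv i); rewrite latB addrA subrK ZpB.
have F0 g' : (forall a, g' <> g + lat a) -> F g' = 0.
  by move=> n; rewrite /F; case: pselect => // e; have [a ga] := e; have := n _ ga.
exists F; split=> //; last by rewrite -[g]addr0 -lat0 FE Zp0.
split=> [g'|i g'].
  have [[a ->]|n] := pselect (exists a, g' = g + lat a); first by rewrite FE.
  rewrite F0 => [|a ga]; last by apply: n; exists a.
  exact: (subspace_weight _ _ _ _).1.
have [[a ->]|n] := pselect (exists a, g' = g + lat a).
  by rewrite -addrA -latD !FE ZpD.
rewrite (F0 g') => [|a ga]; last by apply: n; exists a.
rewrite (lin0 (Zop_linear i)) F0 // => a ga.
by apply: n; exists (a - zdelta i); rewrite latB addrA -ga addrK.
Qed.

End Period.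

(** * The effect of root vectors on joint eigenvalues *)

Section Moves.
Variables (R : realType) (G : simpleLie R) (k : nat).
Local Notation C := R[i].
Local Notation h := (hfin G).
Variable E : tmod G k.+1.

Lemma diag_span : htor_diagonalizable E -> forall v : E,
  v \in span_pred [set w | exists mu ka de, weight_space mu ka de w].
Proof.
move=> Ed v; have [s [-> sP]] := Ed v; rewrite big_seq; apply: span_sum => w /sP ws.
exact: span_sub.
Qed.

(* The [h]-diagonalizability of [E] turns generalized [ad h]-eigenvectors of the
   Lie algebra into elements that act as genuine ones. *)
Lemma xweight_geig (la : hdual h) (x : G) : htor_diagonalizable E ->
  (forall t, geig (lbr (vsval t)) (la t) x) -> xweight E la x.
Proof.
move=> Ed xla t m v; pose D : set E := [set w | exists mu ka de, weight_space mu ka de w].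
have fl w : linear (fun y => act (GX y m) w : E) by exact: act_X_linear.
have gl w : linear (fun y => act (GX (lbr (vsval t) y) m) w : E).
  by move=> a y z; rewrite lbr_linearr act_X_linear.
suff : forall w, D w -> act (GX (lbr (vsval t) x) m) w = la t *: act (GX x m) w.
  move=> Dw; apply: (@span_min C E D [set v | act (GX (lbr (vsval t) x) m) v
    = la t *: act (GX x m) v] _ Dw v (diag_span Ed v)).
  split=> /= [|a u w uE wE]; first by rewrite !(lin0 (act_linear _)) scaler0.
  by rewrite !act_linear uE wE scalerDr !scalerA mulrC.
move=> w [mu [ka [de [hw _ _]]]].
have Tf y : act (GX (vsval t) 0) (act (GX y m) w)
    = act (GX (lbr (vsval t) y) m) w + mu t *: act (GX y m) w.
  rewrite commE act_XX add0r big1 ?scaler0 ?addr0 => [|i _]; last by rewrite ffunE scale0r.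
  by rewrite hw (linZ (act_linear _)) addrC.
have Sf n y : iter n (shiftop (act (GX (vsval t) 0)) (mu t + la t)) (act (GX y m) w)
    = act (GX (iter n (shiftop (lbr (vsval t)) (la t)) y) m) w.
  elim: n => //= n ->; rewrite /shiftop Tf (linB (fl w)) (linZ (fl w)) scalerDl.
  by rewrite opprD addrA addrK.
have [n xn] := xla t.
have fg : geig (act (GX (vsval t) 0)) (mu t + la t) (act (GX x m) w).
  by exists n; rewrite Sf xn GX0.
have fs : act (GX x m) w \in span_pred [set u | exists a, act (GX (vsval t) 0) u = a *: u].
  apply: span_mono (diag_span Ed _) => u [mu' [ka' [de' [hu _ _]]]].
  by exists (mu' t); exact: hu.
have := span_eigen_geig (act_linear _) fs fg.
by rewrite Tf scalerDl [RHS]addrC => /addIr.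
Qed.

(** By invariance [t] is orthogonal to [[t0, y]] for all [y], so applying [ad t0 - a] to [y]
    multiplies [(t | y)] by [- a]; iterating until [x] dies leaves [(- a)^n (t | x) = 0]. This kills
    the central term of the bracket of [t (x) t^r] with [x (x) t^m]. *)
Lemma form_geig0 (x : G) (t0 t : subvs_of h) a : a != 0 ->
  geig (lbr (vsval t0)) a x -> form (vsval t) x = 0.
Proof.
move=> a0 [n xn]; have [fl fC fi] := form_invariant G.
have fad y : form (vsval t) (lbr (vsval t0) y) = 0.
  by rewrite -fi hfin_abelian (lin0 (fl y)).
have fr : linear (form (vsval t) : G -> C^o).
  by move=> b y z; rewrite fC (fl (vsval t)) !(fC (vsval t)).
have fS y : form (vsval t) (shiftop (lbr (vsval t0)) a y) = - a *: (form (vsval t) y : C^o).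
  by rewrite /shiftop (linB fr) (linZ fr) fad sub0r scaleNr.
have : form (vsval t) (iter n (shiftop (lbr (vsval t0)) a) x) = (- a) ^+ n * form (vsval t) x.
  elim: n {xn} => [|n IH]; first by rewrite expr0 mul1r.
  by rewrite iterS fS IH exprS -mulrA.
rewrite xn (lin0 fr) => /esym/eqP; rewrite mulf_eq0 expf_eq0 oppr_eq0 (negPf a0) andbF.
by move/eqP.
Qed.

Lemma hact_K_igen i u j (F : zk k -> E) :
  comm (@hA R G k E i) (hact (GK G u j)) F = 0.
Proof.
apply/funext => g; rewrite hact_comm; case: i => -[t|] r; rewrite /igen /=.
  by rewrite /comm act_KXc subrr.
by rewrite act_KK.
Qed.

Lemma jgen_hact_K u j eta (F : zk k -> E) : jgen (@hA R G k E) eta F ->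
  jgen (@hA R G k E) eta (hact (GK G u j) F).
Proof.
move=> jF i; apply: (geig_comm2 (W := setT)) (jF i) => //; try exact: hact_linear.
by move=> F' _; rewrite {1}/comm !hact_K_igen (lin0 (hA_linear i)) subrr.
Qed.

Definition shift_eig (eta : idx G k -> C) (la : hdual h) (M : 'I_k -> C) (i : idx G k) : C :=
  eta i + (if i.1 is Some t then la t * mono M i.2 else 0).

Lemma comm_hA_GX x la i m (F : zk k -> E) : xweight E la x ->
  (forall t : subvs_of h, form (vsval t) x = 0) ->
  comm (hA i) (hact (GX x m)) F
  = if i.1 is Some t then la t *: hact (GX x (m + zcons 0 i.2)) F else 0.
Proof.
move=> xla xform; apply/funext => g; rewrite hact_comm.
case: i => -[t|] r; rewrite /igen /= ttail_cons; last by rewrite act_KX.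
rewrite act_XX xla xform scale0r addr0 addrC; congr (_ *: act _ (F _)).
by rewrite /= ttailD ttail_cons opprD addrA addrAC.
Qed.

End Moves.

Section Move.
Variables (R : realType) (G : simpleLie R) (k : nat).
Local Notation C := R[i].
Local Notation h := (hfin G).
Variables (l : 'I_k -> nat) (E : tmod G k.+1).
Hypothesis l_gt0 : forall i, (0 < l i)%N.
Hypothesis Zinj : forall i, injective (@Zop R G k l E i).
Hypothesis Efd : finite_dim_weight_spaces E.
Variables (mu : hdual h) (ka : 'I_k.+1 -> C) (c : C) (eta : idx G k -> C).
Variables (la : hdual h) (x : G) (m : zk k.+1).
Hypothesis xla : xweight E la x.
Hypothesis xform : forall t : subvs_of h, form (vsval t) x = 0.

Let Fn := (zk k -> E).
Let A := @hA R G k E.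
Let U : set Fn := [set F | PW l mu ka c F /\ jgen A eta F].
Let W' : set Fn := PW l (mu + la) ka (c + (m ord0)%:~R).
Let X (s : zk k) : Fn -> Fn := hact (GX x (m + zcons 0 s)).

Lemma PW_hA mu' ka' c' i F : PW l mu' ka' c' F -> PW l mu' ka' c' (A i F).
Proof.
move=> [wF pF]; split=> [g|].
  have := wt_igen i (wF (g - i.2)); rewrite subrK.
  by rewrite /A /hA /hact igen_shift.
by apply: hact_periodic => //; case: i => -[].
Qed.

Lemma PW_GX mu' ka' c' (n : zk k.+1) F : PW l mu' ka' c' F ->
  PW l (mu' + la) ka' (c' + (n ord0)%:~R) (hact (GX x n) F : Fn).
Proof.
move=> [wF pF]; split=> [g|]; last exact: hact_periodic.
by have := wt_GX n xla (wF (g - ttail n)); rewrite subrK.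
Qed.

Let Alin i : linear (A i). Proof. exact: hA_linear. Qed.

Let Us : is_subspace U.
Proof.
by apply: subspaceI; [exact: subspace_PW|exact: subspace_jgen].
Qed.

Let UA i F : U F -> U (A i F).
Proof.
by case=> PF jF; split; [exact: PW_hA|apply: jgen_stable => //; exact: hA2].
Qed.

Let XW s F : U F -> W' (X s F).
Proof.
move=> [PF _]; have := PW_GX (m + zcons 0 s) PF.
by rewrite [(m + _) ord0]ffunE zcons0 addr0.
Qed.

(* the linear maps from [U] to [W'], extended by 0 off [U] *)
Let Y' : set (Fn -> Fn) := [set f | [/\ forall F, ~ U F -> f F = 0,
  forall a F F', U F -> U F' -> f (a *: F + F') = a *: f F + f F' &
  forall F, U F -> W' (f F)]].

Let x_ s : Fn -> Fn := fun F => if `[< U F >] then X s F else 0.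

(** The commutator with [A i]. Cutting it off outside [U] keeps it among the maps that represent
    linear maps from [U] to [W']. *)
Let B i (f : Fn -> Fn) : Fn -> Fn :=
  fun F => if `[< U F >] then A i (f F) - f (A i F) else 0.

Let Y : set (Fn -> Fn) := [set f | f \in span_pred (range x_)].

Let onU F (a b : Fn) : U F -> (if `[< U F >] then a else b) = a.
Proof. by move=> UF; case: asboolP. Qed.

Let Y's : is_subspace Y'.
Proof.
split; first by split=> // [a F F' _ _|F _]; [rewrite scaler0 addr0|exact: (subspace_PW _ _ _ _ _).1].
move=> a f g [f0 fl fW] [g0 gl gW].
have E1 F : (a *: f + g) F = a *: f F + g F by [].
split=> [F nU|b F F' UF UF'|F UF]; rewrite !E1.
- by rewrite f0 // g0 // scaler0 addr0.
- rewrite fl // gl // !scalerDr !scalerA (mulrC a) -!addrA; congr (_ + _).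
  by rewrite addrCA.
- by apply: (subspace_PW _ _ _ _ _).2; [exact: fW|exact: gW].
Qed.

Let Y'x s : Y' (x_ s).
Proof.
split=> [F nU|a F F' UF UF'|F UF]; rewrite /x_.
- by case: asboolP.
- by have UFF := Us.2 a _ _ UF UF'; rewrite !onU // /X hact_linear.
- by rewrite onU //; exact: XW.
Qed.

Let YY' : Y `<=` Y'.
Proof. by apply: span_min => // _ [s _ <-]. Qed.

Let Blin i : linear (B i).
Proof.
move=> a f g; apply/funext => F.
have -> : (a *: B i f + B i g) F = a *: B i f F + B i g F by [].
rewrite /B; case: asboolP => _; last by rewrite scaler0 addr0.
have E1 F' : (a *: f + g) F' = a *: f F' + g F' by [].
by rewrite !E1 Alin scalerBr opprD addrACA.
Qed.

(** On the generators of [Y], [B (Some t, r)] is [la t] times the shift of the exponent by [r].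
    Hence [Y] is stable and the [B i] commute on it, although the [A i] may not commute. *)
Let Bx i s : B i (x_ s) = if i.1 is Some t then la t *: x_ (s + i.2) else 0.
Proof.
apply/funext => F; rewrite /B /x_; case: asboolP => UF; last first.
  case: i => -[t|] r //=. 
  have -> : (la t *: x_ (s + r)) F = la t *: x_ (s + r) F by [].
  by rewrite /x_; case: asboolP; rewrite // scaler0.
rewrite onU ?onU //; last exact: UA.
rewrite -/(comm (A i) (X s) F) (comm_hA_GX _ _ _ xla xform); case: i => -[t|] r //=.
transitivity (la t *: (if `[< U F >] then X (s + r) F else 0)); last by [].
by rewrite onU // -addrA zconsD addr0.
Qed.

Hypothesis la0 : la != 0.

Let Yext (f g : (Fn -> Fn) -> Fn -> Fn) : linear f -> linear g ->
  (forall s, f (x_ s) = g (x_ s)) -> forall y, Y y -> f y = g y.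
Proof.
move=> fl gl fg; apply: span_min => [|_ [s _ <-] //].
split=> [|a u v /= fu fv]; first by rewrite /= (lin0 fl) (lin0 gl).
by rewrite fl gl fu fv.
Qed.

Let YB i y : Y y -> Y (B i y).
Proof.
move=> Yy; apply: (span_map (Blin i)) Yy => _ [s _ <-]; rewrite Bx.
by case: i => -[t|] r /=; [apply/spanZ/span_sub; exists (s + r)|exact: span0].
Qed.

Let comp_linear (f g : (Fn -> Fn) -> Fn -> Fn) : linear f -> linear g -> linear (f \o g).
Proof. by move=> fl gl a u v /=; rewrite gl fl. Qed.

Let BC i j y : Y y -> B i (B j y) = B j (B i y).
Proof.
apply: (Yext (f := B i \o B j) (g := B j \o B i)); try exact: comp_linear.
move=> s /=; rewrite !Bx; case: i j => [[t|] r] [[t'|] r'] /=;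
  rewrite ?(linZ (Blin _)) ?(lin0 (Blin _)) ?Bx /= ?scaler0 //.
by rewrite !scalerA mulrC [s + r' + r]addrAC.
Qed.

(** An element of [Y] is determined by its values on a finite spanning list of [U], and these values
    lie in the finite-dimensional [W']. *)
Let Yfd : exists n, fdim n Y.
Proof.
have [n Pn] := @fdim_PW R G k l l_gt0 E Zinj mu ka c Efd.
have Un : fdim n U by move=> v Uv; apply: Pn => i; exact: (Uv i).1.
have [s [sU sP]] := fdim_spanning Us Un.
have [n' W'n] := @fdim_PW R G k l l_gt0 E Zinj (mu + la) ka (c + (m ord0)%:~R) Efd.
have [s' [_ s'P]] := fdim_spanning (subspace_PW _ _ _ _ _) W'n.
exists #|{: 'I_(size s) * 'I_(size s')}|; apply: fdim_coord => p v Yv.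
have vd (ij : 'I_p * 'I_(size s)) : exists d : 'I_(size s') -> C,
    v ij.1 s`_ij.2 = \sum_j d j *: s'`_j.
  case: ij => i j /=; apply: span_seqP; apply: s'P; have [_ _ vW] := YY' (Yv i).
  by apply: vW; apply: sU; exact: mem_nth.
have [f fP] := choice vd.
exists (fun i pq => f (i, pq.1) pq.2) => d dM; set g := \sum_i _.
have Yg : Y' g by apply: subspace_sum => // i _; apply: subspaceZ => //; exact: YY'.
have gE F : g F = \sum_i d i *: v i F.
  by rewrite /g; elim/big_rec2: _ => // i y1 y2 _ <-.
have [g0 gl gW] := Yg.
have gs i : (i < size s)%N -> g s`_i = 0.
  move=> si; rewrite gE.
  have fP' j : v j s`_i = \sum_q f (j, Ordinal si) q *: s'`_q by exact: (fP (j, Ordinal si)).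
  under eq_bigr do rewrite fP' scaler_sumr.
  rewrite exchange_big big1 // => q _; under eq_bigr do rewrite scalerA.
  by rewrite -scaler_suml (dM (Ordinal si, q)) scale0r.
apply/funext => F; have [UF|/g0 //] := pselect (U F).
suff [] : U F /\ g F = 0 by [].
apply: (@span_min _ _ _ [set F | U F /\ g F = 0]) (sP _ UF).
  split=> /= [|a u w [Uu gu] [Uw gw]].
    split; first exact: Us.1.
    by have := gl (-1) 0 0 Us.1 Us.1; rewrite scaler0 addr0 scaleN1r addNr.
  by split; [exact: Us.2|rewrite gl // gu gw scaler0 addr0].
move=> u /= us; split; first exact: sU.
by rewrite -(nth_index 0 us) gs // index_mem.
Qed.

Let kappaE kappa y : Y y -> jgen B kappa y -> y != 0 ->
  exists M : 'I_k -> C, (forall i, M i != 0) /\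
    forall i, kappa i = if i.1 is Some t then la t * mono M i.2 else 0.
Proof.
move=> Yy jy y0.
(* With this normalization [B (Some t0, r)] is exactly the shift by [r] on the generators, so its
   eigenvalue is a character of [r], that is, a point of the torus. *)
have [t0 lat0] : exists t0, la t0 = 1.
  have [t lat] : exists t, la t != 0.
    apply: contrapT => n; move/eqP: la0; apply; apply/lfunP => t; rewrite zero_lfunE.
    by apply/eqP/negP => /negP lat; apply: n; exists t.
  by exists ((la t)^-1 *: t); rewrite linearZ /= [LHS]mulVf.
(* Operator identities on [Y] become identities of eigenvalues on a genuine joint eigenvector,
   chosen anew for the few operators at hand. *)
have eig (L : seq (idx G k)) : exists y', [/\ Y y', y' != 0 & forall i, i \in L -> B i y' = kappa i *: y'].
  by have [y' [? ? _ ?]] := jgen_eigenvector L Blin (subspace_span _) YB BC Yy jy y0; exists y'.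
have kN r : kappa (None, r) = 0.
  have [y' [Yy' y'0 /(_ (None, r))]] := eig [:: (None, r)]; rewrite inE eqxx => /(_ isT).
  have -> : B (None, r) y' = 0.
    have z0 : linear ((fun=> 0) : (Fn -> Fn) -> Fn -> Fn).
      by move=> a u v; rewrite scaler0 addr0.
    by apply: (Yext (Blin (None, r)) z0 _ Yy') => s; rewrite Bx.
  by move=> /esym/eqP; rewrite scaler_eq0 (negPf y'0) orbF => /eqP.
pose M r := kappa (Some t0, r).
have kS t r : kappa (Some t, r) = la t * M r.
  have [y' [Yy' y'0 ky]] := eig [:: (Some t, r); (Some t0, r)].
  have := ky (Some t, r); have := ky (Some t0, r).
  rewrite !inE !eqxx orbT => /(_ isT) k1 /(_ isT) k2.
  have : B (Some t, r) y' = la t *: B (Some t0, r) y'.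
    apply: (Yext (f := B (Some t, r)) (g := fun f => la t *: B (Some t0, r) f)) Yy' => //.
      by move=> a u v; rewrite Blin scalerDr !scalerA mulrC.
    by move=> s; rewrite !Bx /= lat0 scale1r.
  rewrite k1 k2 scalerA => /eqP; rewrite -subr_eq0 -scalerBl scaler_eq0 (negPf y'0) orbF.
  by rewrite subr_eq0 => /eqP.
have M0 : M 0 = 1.
  have [y' [Yy' y'0 /(_ (Some t0, 0))]] := eig [:: (Some t0, 0)]; rewrite inE eqxx => /(_ isT).
  have -> : B (Some t0, 0) y' = y'.
    apply: (Yext (g := id) (Blin (Some t0, 0)) _ _ Yy') => // s.
    by rewrite Bx /= lat0 scale1r addr0.
  rewrite -[X in X = _]scale1r => /eqP; rewrite -subr_eq0 -scalerBl scaler_eq0 (negPf y'0) orbF.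
  by rewrite subr_eq0 => /eqP.
have MD r s : M (r + s) = M r * M s.
  have [y' [Yy' y'0 ky]] := eig [:: (Some t0, r); (Some t0, s); (Some t0, r + s)].
  have := ky (Some t0, r); have := ky (Some t0, s); have := ky (Some t0, r + s).
  rewrite !inE !eqxx !orbT => /(_ isT) k1 /(_ isT) k2 /(_ isT) k3.
  have : B (Some t0, r + s) y' = B (Some t0, r) (B (Some t0, s) y').
    apply: (Yext (f := B _) (g := B _ \o B _)) Yy' => //; first exact: comp_linear.
    by move=> p; rewrite /= !Bx /= lat0 !scale1r Bx /= lat0 scale1r [r + s]addrC addrA.
  rewrite k1 k2 (linZ (Blin _)) k3 scalerA => /eqP.
  rewrite -subr_eq0 -scalerBl scaler_eq0 (negPf y'0) orbF subr_eq0 => /eqP krs.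
  by rewrite /M krs mulrC.
have Mn0 r : M r != 0.
  apply: contraTneq isT => Mr; have := MD r (- r); rewrite subrr M0 Mr mul0r => /eqP.
  by rewrite oner_eq0.
have mD (r s : zk k) : mono (fun i => M (zdelta i)) (r + s)
    = mono (fun i => M (zdelta i)) r * mono (fun i => M (zdelta i)) s by apply: monoD.
have ME : mono (fun i => M (zdelta i)) = M.
  have md i : mono (fun i => M (zdelta i)) (zdelta i) = M (zdelta i).
    rewrite /mono (bigD1 i) //= big1 => [|j ji]; rewrite ffunE ?eqxx ?expr1z ?mulr1 //.
    by rewrite (negPf ji) expr0z.
  apply/funext; apply: zk_ind => [|a i IH|a i IH]; first by rewrite mono0 M0.
    by rewrite mD md IH MD.
  by apply: (mulIf (Mn0 (zdelta i))); rewrite -MD -[X in _ * X]md -mD !subrK IH.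
exists (fun i => M (zdelta i)); split=> // -[[t|] r] /=; last exact: kN.
by rewrite kS ME.
Qed.

(* The operators of [h (x) C[t_2, ...]] act by commutators on the span of the
   maps [x (x) t^(m + s)] from [U] to [W'], which is finite-dimensional; their
   joint eigenvalues there are of the form [la t * mono M r], because the shifts
   in [s] multiply. *)
Lemma move_eig F : PW l mu ka c F -> jgen A eta F ->
  (hact (GX x m) F : Fn) \in span_pred [set F' | W' F' /\
    exists M : 'I_k -> C, (forall i, M i != 0) /\ jgen A (shift_eig eta la M) F'].
Proof.
move=> PF jF; have UF : U F by [].
have [n Yn] := Yfd.
have Yx : Y (x_ 0) by apply: span_sub; exists 0.
have -> : hact (GX x m) F = x_ 0 F by rewrite /x_ onU // /X zcons00 addr0.
have ev : linear (fun y : Fn -> Fn => y F) by [].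
have B2 := comm2_commuting Blin YB BC.
apply: (span_map ev) (joint_decomp Blin (subspace_span _) YB B2 Yn Yx) => y [Yy [kappa jy]].
have [->|y0] := eqVneq y 0; first exact: span0.
have [M [M0 kE]] := kappaE Yy jy y0.
have [_ yl yW] := YY' Yy.
apply: span_sub; split; first exact: yW.
exists M; split=> // i; rewrite /shift_eig -kE.
have [p yp] := jy i.
(* The sequence for [geig_leibniz]: since [B i] is the commutator with [A i], the failure of [f q]
   to shift eigenvalues by exactly [kappa i] is [f q.+1], and [f p = 0]. *)
pose f q := iter q (shiftop (B i) (kappa i)) y.
have Yf q : Y (f q).
  by elim: q => //= q IH; apply: (subspace_stable_shift _ (subspace_span _)) => // v; exact: YB.
have jFi := jF i.
apply: (@geig_leibniz _ _ _ (A i) (A i) f U (kappa i) (eta i) p) => //.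
- by move=> u; exact: UA.
- by move=> q a u v Uu Uv; have [_ fl _] := YY' (Yf q); exact: fl.
- move=> q u Uu; rewrite /f /= -/(f q).
  have -> : shiftop (B i) (kappa i) (f q) u = B i (f q) u - kappa i *: f q u by [].
  by rewrite /B onU // -[X in _ = _ + X]addrA -opprD [RHS]addrC subrK.
- by move=> u _; rewrite /f yp.
Qed.

End Move.

(** * Sums over classes and over roots of unity *)

Section RootsOfUnity.

Lemma sum_by_class (C : fieldType) (V : lmodType C) (T : Type) (J : finType)
    (eta : J -> T) (w : J -> V) (W : set V) : is_subspace W ->
  (forall j, W (\sum_(i | `[< eta i = eta j >]) w i)) -> W (\sum_j w j).
Proof.
(* The type [T] has no boolean equality, so a class is named by an index picked in it. *)
move=> Ws Wj; pose r j := odflt j [pick i | `[< eta i = eta j >]].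
have rP i j : (r i == r j) = `[< eta i = eta j >].
  have er i' : eta (r i') = eta i'.
    by rewrite /r; case: pickP => [x /asboolP //|/(_ i')]; rewrite /= asboolT.
  apply/eqP/asboolP => [rij|eij]; first by rewrite -(er i) rij er.
  rewrite /r (eq_pick (Q := fun x => `[< eta x = eta j >])) => [|x]; last by rewrite /= eij.
  by case: pickP => // /(_ j); rewrite /= asboolT.
rewrite (partition_big r xpredT) //=; apply: subspace_sum => // i _.
have [[j <-]|n] := pselect (exists j, r j = i); first by under eq_bigl do rewrite rP.
rewrite big_pred0 => [|j]; first exact: Ws.1.
by apply/eqP => ji; apply: n; exists j.
Qed.

Lemma geig_semi (C : fieldType) (V V' : lmodType C) (T : V -> V) (T' : V' -> V')
    (f : V -> V') (q a : C) v : linear f -> linear T' ->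
  (forall u, T' (f u) = q *: f (T u)) -> geig T a v -> geig T' (q * a) (f v).
Proof.
move=> fl T'l fT [n vn]; exists n.
suff -> : iter n (shiftop T' (q * a)) (f v) = q ^+ n *: f (iter n (shiftop T a) v).
  by rewrite vn (lin0 fl) scaler0.
have S'l := shiftop_linear (q * a) T'l.
elim: n {vn} => [|n IH]; first by rewrite expr0 scale1r.
rewrite iterS IH (linZ S'l) /shiftop fT [in RHS]iterS /shiftop (linB fl) (linZ fl).
by rewrite exprSr -[RHS]scalerA; congr (_ *: _); rewrite scalerBr scalerA.
Qed.

Lemma prim_root_exists (C : closedFieldType) (n : nat) : n%:R != 0 :> C ->
  (0 < n)%N -> exists z : C, n.-primitive_root z.
Proof.
move=> C0 n0; have [r Er] := closed_field_poly_normal ('X^n - 1 : {poly C}).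
move: Er; rewrite (monicP (monicXnsubC 1 n0)) scale1r => Er.
have size_r : (n < (size r).+1)%N by rewrite -(size_prod_XsubC r id) -Er size_XnsubC.
have uniq_r : uniq r by rewrite -separable_prod_XsubC -Er separable_Xn_sub_1.
have unity_r : all n.-unity_root r by apply/allP => z; rewrite -root_prod_XsubC -Er.
by have /hasP[z _ zn] := has_prim_root n0 unity_r uniq_r size_r; exists z.
Qed.

Lemma prim_root_neq0 (C : fieldType) (n : nat) (z : C) : (0 < n)%N ->
  n.-primitive_root z -> z != 0.
Proof.
move=> n0 zn; apply/eqP => z0; have := prim_expr_order zn.
by rewrite z0 expr0n gtn_eqF // => /esym/eqP; rewrite oner_eq0.
Qed.

Lemma prim_root_sum (C : fieldType) (n : nat) (z : C) (d : int) : (0 < n)%N ->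
  n.-primitive_root z ->
  \sum_(q < n) (z ^+ q) ^ d = if (n %| d)%Z then n%:R else 0.
Proof.
move=> n0 zn; have z0 := prim_root_neq0 n0 zn.
have zE q : (z ^+ q) ^ d = (z ^ d) ^+ q by rewrite !exprnP !exprz_exp mulrC.
have zd : (z ^ d == 1) = (n %| d)%Z.
  rewrite dvdzE /= (prim_order_dvd zn); case: d {zE} => m //=.
  by rewrite -[z ^ Negz m]/((z ^+ m.+1)^-1) invr_eq1.
under eq_bigr do rewrite zE; rewrite -zd; case: eqVneq => [->|zd1].
  by under eq_bigr do rewrite expr1n; rewrite sumr_const card_ord.
apply: (mulfI (x := z ^ d - 1)); first by rewrite subr_eq0.
by rewrite mulr0 -subrX1 -zE (prim_expr_order zn) exp1rz subrr.
Qed.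

End RootsOfUnity.

(** * Rescaling of degrees and restriction to cosets *)

Section Components.
Variables (R : realType) (G : simpleLie R) (k : nat).
Local Notation C := R[i].
Local Notation h := (hfin G).

Definition twist (b : 'I_k -> C) (eta : idx G k -> C) : idx G k -> C :=
  fun i => mono b i.2 * eta i.

Definition twist_stable (K : set (idx G k -> C)) :=
  forall b eta, (forall i, b i != 0) -> K eta -> K (twist b eta).

Definition shift_stable (K : set (idx G k -> C)) :=
  forall la M eta, Qlat la -> (forall i, M i != 0) -> K eta -> K (shift_eig eta la M).

Section Fourier.
Variable E : tmod G k.+1.
Local Notation A := (@hA R G k E).

Definition tau (b : 'I_k -> C) (F : zk k -> E) : zk k -> E := fun g => mono b g *: F g.

Lemma tau_linear b : linear (tau b).
Proof.
move=> a F F'; apply/funext => g; rewrite /tau.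
have -> : (a *: F + F') g = a *: F g + F' g by [].
by rewrite scalerDr !scalerA mulrC -scalerA.
Qed.

Lemma hA_tau b i F : (forall j, b j != 0) ->
  A i (tau b F) = mono (fun j => (b j)^-1) i.2 *: tau b (A i F).
Proof.
move=> b0; apply/funext => g.
transitivity (mono (fun j => (b j)^-1) i.2 *: (mono b g *: A i F g)); last by [].
rewrite /hA /hact /tau igen_shift (linZ (act_linear _)) scalerA; congr (_ *: _).
rewrite monoD // mulrC; congr (_ * _).
by apply: eq_bigr => j _; rewrite ffunE exprz_inv.
Qed.

Lemma jspan_tau K b F : twist_stable K -> (forall i, b i != 0) ->
  F \in jspan A K -> tau b F \in jspan A K.
Proof.
move=> KT b0; apply: (span_map (tau_linear b)) => F' [eta Keta jF'].
apply: span_sub; exists (twist (fun j => (b j)^-1) eta).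
  by apply: KT => // j; rewrite invr_eq0.
move=> i; apply: (geig_semi (tau_linear b) (hA_linear i) _ (jF' i)) => F''.
exact: hA_tau.
Qed.

(* The restriction to a residue class is an average of twists by roots of unity. *)
Lemma jspan_restr_coord K F i (n : nat) (d : int) : twist_stable K -> (0 < n)%N ->
  F \in jspan A K ->
  (fun g : zk k => if (n %| g i - d)%Z then F g else 0) \in jspan A K.
Proof.
move=> KT n0 FK; have C0 : n%:R != 0 :> C by rewrite pnatr_eq0 -lt0n.
have [z zn] := prim_root_exists C0 n0.
have z0 := prim_root_neq0 n0 zn.
pose b (q : nat) (j : 'I_k) := if j == i then z ^+ q else 1.
have b0 q j : b q j != 0 by rewrite /b; case: ifP; rewrite ?oner_eq0 ?expf_neq0.
have bE q g : mono (b q) g = (z ^+ q) ^ (g i).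
  rewrite /mono (bigD1 i) //= big1 ?mulr1 ?/b ?eqxx // => j ji.
  by rewrite /b (negPf ji) exp1rz.
have -> : (fun g : zk k => if (n %| g i - d)%Z then F g else 0)
    = n%:R^-1 *: \sum_(q < n) (z ^+ q) ^ (- d) *: tau (b q) F.
  apply/funext => g.
  have -> : (n%:R^-1 *: \sum_(q < n) (z ^+ q) ^ (- d) *: tau (b q) F) g
      = n%:R^-1 *: \sum_(q < n) (z ^+ q) ^ (g i - d) *: F g.
    rewrite [LHS]/(n%:R^-1 *: (\sum_(q < n) (z ^+ q) ^ (- d) *: tau (b q) F) g); congr (_ *: _).
    elim/big_rec2: _ => // q y1 y2 _ <-.
    rewrite [LHS]/((z ^+ q) ^ (- d) *: (mono (b q) g *: F g) + y2 g); congr (_ + _).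
    by rewrite scalerA bE mulrC -expfzDr // expf_neq0.
  rewrite -scaler_suml prim_root_sum //; case: ifP => _; last by rewrite scale0r scaler0.
  by rewrite scalerA mulVf ?scale1r // pnatr_eq0 -lt0n.
by apply: spanZ; apply: span_sum => q _; apply: spanZ; exact: jspan_tau.
Qed.

Variable l : 'I_k -> nat.
Hypothesis l_gt0 : forall i, (0 < l i)%N.

Definition restr (g : zk k) (F : zk k -> E) : zk k -> E :=
  fun g' => if `[< exists a, g' = g + lat l a >] then F g' else 0.

(** A coset of the period lattice is cut out by one congruence modulo [l i] in each coordinate. *)
Lemma jspan_restr K g F : twist_stable K -> F \in jspan A K -> restr g F \in jspan A K.
Proof.
move=> KT FK.
have H (s : seq 'I_k) : (fun g' : zk k => if all (fun i => (l i %| g' i - g i)%Z) s then F g' else 0)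
    \in jspan A K.
  elim: s => //= i s IH; have := jspan_restr_coord i (g i) KT (l_gt0 i) IH.
  move/(eq_ind _ (fun F' => F' \in jspan A K)); apply; apply/funext => g' /=.
  by case: ifP.
have := H (enum 'I_k); move/(eq_ind _ (fun F' => F' \in jspan A K)); apply.
apply/funext => g'; rewrite /restr.
case: asboolP => [[a ->]|n].
  by case: allP => // -[] i _; rewrite ffunE addrC addKr latE dvdz_mull.
case: allP => // all_l; case: n.
exists [ffun i => ((g' i - g i) %/ l i)%Z]; apply/ffunP => i; rewrite !ffunE latE ffunE.
by rewrite divzK ?all_l ?mem_enum // addrC subrK.
Qed.

Lemma restr_periodic g F : periodic l F -> periodic l (restr g F).
Proof.
move=> pF i g'; rewrite /restr.
have -> : `[< exists a, g' + per l i = g + lat l a >] = `[< exists a, g' = g + lat l a >].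
  apply: asbool_equiv_eq; split=> -[a ga].
    by exists (a - zdelta i); rewrite latB addrA -ga addrK.
  by exists (a + zdelta i); rewrite latD addrA -ga.
by case: asboolP => _; rewrite ?pF // (lin0 (Zop_linear l i)).
Qed.

End Fourier.
End Components.

(** * Components of a module attached to sets of eigenvalues *)

Section Tame.
Variables (R : realType) (G : simpleLie R) (k : nat).
Local Notation C := R[i].
Local Notation h := (hfin G).

(** Conditions shared by all the [J_int m], which their finite direct sums inherit. *)
Definition tame (E : tmod G k.+1) :=
  [/\ htor_diagonalizable E, integral_d E & finite_dim_weight_spaces E].

Section Weights.
Variable E : tmod G k.+1.

(** The elements of [h_tor] as one family of operators: weight spaces become joint eigenspaces, and
    [jgen_componentT] separates weights. *)
Definition hidx := (subvs_of h + 'I_k.+1 + 'I_k.+1)%type.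

Definition hop (a : hidx) : E -> E :=
  match a with
  | inl (inl t) => act (GX (vsval t) 0)
  | inl (inr i) => act (GK G 0 i)
  | inr i => act (GD G i)
  end.

Definition hwt (mu : hdual h) (ka de : 'I_k.+1 -> C) (a : hidx) : C :=
  match a with inl (inl t) => mu t | inl (inr i) => ka i | inr i => de i end.

Lemma hwtP mu ka de v : weight_space mu ka de v <-> forall a, hop a v = hwt mu ka de a *: v.
Proof.
split=> [[hv Kv dv] [[t|i]|i]|H]; [exact: hv|exact: Kv|exact: dv|split=> x].
- exact: (H (inl (inl x))).
- exact: (H (inl (inr x))).
- exact: (H (inr x)).
Qed.

Lemma hwt_inj mu ka de mu' ka' de' : hwt mu ka de = hwt mu' ka' de' ->
  [/\ mu = mu', ka = ka' & de = de'].
Proof.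
move=> e; split; first by apply/lfunP => t; exact: (congr1 (fun f => f (inl (inl t))) e).
- by apply/funext => i; exact: (congr1 (fun f => f (inl (inr i))) e).
- by apply/funext => i; exact: (congr1 (fun f => f (inr i)) e).
Qed.

Lemma dweight_inj c g c' g' : @dweight R k c g = dweight c' g' -> c = c' /\ g = g'.
Proof.
move=> e; split; first by have := congr1 (fun f => f ord0) e; rewrite /dweight unlift_none.
apply/ffunP => i; have := congr1 (fun f => f (lift ord0 i)) e; rewrite /dweight liftK.
by move/intr_inj.
Qed.

Lemma hop_linear a : linear (hop a).
Proof. by case: a => [[t|i]|i]; exact: act_linear. Qed.

Lemma hopC a b v : hop a (hop b v) = hop b (hop a v).
Proof.
have z i (u : E) : ((0 : zk k.+1) i)%:~R *: u = 0 by rewrite ffunE scale0r.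
have DK i j (u : E) : act (GD G i) (act (GK G 0 j) u) = act (GK G 0 j) (act (GD G i) u).
  by rewrite commE act_DK z addr0.
have DX i t (u : E) : act (GD G i) (act (GX (vsval t) 0) u) = act (GX (vsval t) 0) (act (GD G i) u).
  by rewrite commE act_DX z addr0.
have KX i t (u : E) : act (GK G 0 i) (act (GX (vsval t) 0) u) = act (GX (vsval t) 0) (act (GK G 0 i) u).
  exact: act_KXc.
case: a b => [[t|i]|i] [[t'|j]|j] //=.
- rewrite commE act_h_comm big1 ?scaler0 ?addr0 // => i _; exact: z.
- exact: act_KKc.
- by rewrite commE act_DD addr0.
Qed.

Lemma hop2 a b v : comm (hop a) (comm (hop a) (hop b)) v = 0.
Proof.
exact: (@comm2_commuting _ _ _ _ setT hop_linear (fun _ _ _ => I) (fun a b v _ => hopC a b v)).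
Qed.

Lemma submod_hop (W : set E) a v : is_submod W -> W v -> W (hop a v).
Proof. by move=> [_ WA] Wv; case: a => [[t|i]|i]; exact: WA. Qed.

Lemma jgen_hop mu ka de v : weight_space mu ka de v -> jgen hop (hwt mu ka de) v.
Proof. by move/hwtP => hv a; exact: geig_eig. Qed.

Lemma integral_wt mu ka (de : 'I_k.+1 -> C) (v : E) : integral_d E -> v != 0 -> weight_space mu ka de v ->
  exists g, wt mu ka (de ord0) g v.
Proof.
move=> Ei v0 [hv Kv dv].
have gz (j : 'I_k) : exists z : int, de (lift ord0 j) = z%:~R by apply: Ei v0 (dv _).
have [g gP] := choice gz; exists [ffun j => g j]; split=> // i; rewrite dv /dweight.
by case: unliftP => [j ->|->] //; rewrite ffunE -gP.
Qed.

End Weights.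

Section Ecomp.
Variables (l : 'I_k -> nat) (E : tmod G k.+1).
Local Notation A := (@hA R G k E).

Definition comp_gen (K : set (idx G k -> C)) : set E :=
  [set v | exists mu ka c F g eta, [/\ PW l mu ka c F, K eta, jgen A eta F & v = F g]].

Definition Ecomp K : set E := [set v | v \in span_pred (comp_gen K)].

Lemma subspace_Ecomp K : is_subspace (Ecomp K).
Proof. exact: subspace_span. Qed.

Hypothesis l_gt0 : forall i, (0 < l i)%N.
Hypothesis Zinj : forall i, injective (@Zop R G k l E i).
Hypothesis Zsurj : forall i v, exists w, Zop l i w = v :> E.
Hypothesis Et : tame E.

Let Ed : htor_diagonalizable E. Proof. by case: Et. Qed.
Let Ei : integral_d E. Proof. by case: Et. Qed.
Let Efd : finite_dim_weight_spaces E. Proof. by case: Et. Qed.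

Lemma comm2_GX0 i x m (v : E) : xweight E 0 x ->
  comm (act (igen i)) (comm (act (igen i)) (act (GX x m))) v = 0.
Proof.
move=> x0; case: i => -[t|] r; rewrite /igen /= {1}/comm.
  rewrite !act_XX !x0 !lfunE !scale0r !add0r (linZ (act_linear _)) -scalerBr.
  rewrite (lin_sum (act_linear _)) -sumrB big1 ?scaler0 // => i _.
  by rewrite (linZ (act_linear _)) -scalerBr act_KXc subrr scaler0.
by rewrite !act_KX (lin0 (act_linear _)) subrr.
Qed.

Lemma Ecomp_submod K : shift_stable K -> is_submod (Ecomp K).
Proof.
move=> Ks; split; first exact: subspace_Ecomp.
move=> u v; apply: (span_map (act_linear u)) => _ [mu [ka [c [F [g [eta [PF Keta jF ->]]]]]]].
case: u => [x m|m j|i].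
- apply: (@span_min _ _ _ [set x | act (GX x m) (F g) \in span_pred (comp_gen K)]) (lie_decomp x).
    split=> /= [|a y z yE zE]; first by rewrite GX0 span0.
    by rewrite act_X_linear; apply: spanD => //; exact: spanZ.
  move=> y [la [Qla yla]] /=; have yw := xweight_geig Ed yla.
  have FE : act (GX y m) (F g) = hact (GX y m) F (g + ttail m) by rewrite /hact addrK.
  have ev : linear (fun F' : zk k -> E => F' (g + ttail m)) by [].
  (* For weight 0 the form need not vanish on [y], but the double commutators do, so [eta] is kept.
     For nonzero weight the form vanishes and [move_eig] applies. *)
  rewrite FE; have [la0|la0] := eqVneq la 0.
    apply: span_sub; exists (mu + la), ka, (c + (m ord0)%:~R), (hact (GX y m) F), (g + ttail m), eta.
    split=> //; first exact: PW_GX.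
    move=> i; apply: (geig_comm2 (W := setT)) (jF i) => //; try exact: hact_linear.
    by move=> F' _; apply: hact_comm2 => v'; apply: comm2_GX0; rewrite -la0.
  have yf (t : subvs_of h) : form (vsval t) y = 0.
    have [t0 lat0] : exists t0, la t0 != 0.
      apply: contrapT => n; move/eqP: la0; apply; apply/lfunP => t0; rewrite zero_lfunE.
      by apply/eqP/negP => /negP lat; apply: n; exists t0.
    exact: (form_geig0 t lat0 (yla t0)).
  apply: (@span_map _ _ _ _ _ _ (hact (GX y m) F) ev _ (move_eig l_gt0 Zinj Efd m yw yf la0 PF jF)).
  move=> F' [PF' [M [M0 jF']]].
  apply: span_sub; exists (mu + la), ka, (c + (m ord0)%:~R), F', (g + ttail m), (shift_eig eta la M).
  by split=> //; exact: Ks.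
- apply: span_sub; exists mu, ka, (c + (m ord0)%:~R), (hact (GK G m j) F), (g + ttail m), eta.
  split=> //; last by rewrite /hact addrK.
    case: PF => wF pF; split=> [g'|]; last exact: hact_periodic.
    by have := wt_GK j m (wF (g' - ttail m)); rewrite subrK.
  exact: jgen_hact_K.
- have [_ _ ->] := PF.1 g; apply: spanZ; apply: span_sub.
  by exists mu, ka, c, F, g, eta.
Qed.

Definition PWK mu ka c K : set (zk k -> E) :=
  [set F | PW l mu ka c F /\ exists2 eta, K eta & jgen A eta F].

Lemma PW_split mu ka c K F : PW l mu ka c F -> exists F1 F2,
  [/\ F = F1 + F2, F1 \in span_pred (PWK mu ka c K) & F2 \in span_pred (PWK mu ka c (~` K))].
Proof.
move=> PF; have [n Pn] := @fdim_PW R G k l l_gt0 E Zinj mu ka c Efd.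
have A2 i j F' : PW l mu ka c F' -> comm (A i) (comm (A i) (A j)) F' = 0.
  by move=> _; exact: hA2.
have FS := joint_decomp (@hA_linear R G k E) (subspace_PW _ _ _ _ _)
  (fun i F' => @PW_hA R G k l E mu ka c i F') A2 Pn PF.
apply: (@span_min _ _ _ [set F | exists F1 F2, [/\ F = F1 + F2,
  F1 \in span_pred (PWK mu ka c K) & F2 \in span_pred (PWK mu ka c (~` K))]]) FS.
  split; first by exists 0, 0; rewrite addr0; split=> //; exact: span0.
  move=> a _ _ [F1 [F2 [-> KF1 KF2]]] [F1' [F2' [-> KF1' KF2']]].
  exists (a *: F1 + F1'), (a *: F2 + F2'); split.
  - by rewrite scalerDr addrACA.
  - exact: (subspace_span _).2.
  - exact: (subspace_span _).2.
move=> F' [PF' [eta jF']]; have [Keta|nK] := pselect (K eta).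
  exists F', 0; rewrite addr0; split=> //; last exact: span0.
  by apply: span_sub; split=> //; exists eta.
exists 0, F'; rewrite add0r; split=> //; first exact: span0.
by apply: span_sub; split=> //; exists eta.
Qed.

Lemma PWK_Ecomp mu ka c K F g : F \in span_pred (PWK mu ka c K) -> Ecomp K (F g).
Proof.
have ev : linear (fun F' : zk k -> E => F' g) by [].
move=> KF; apply: (@span_map _ _ _ _ _ _ F ev _ KF) => F' [PF' [eta Keta jF']].
by apply: span_sub; exists mu, ka, c, F', g, eta.
Qed.

Lemma Ecomp_sum K v : exists v1 v2, [/\ Ecomp K v1, Ecomp (~` K) v2 & v = v1 + v2].
Proof.
have Ss (K' : set (idx G k -> C)) := subspace_Ecomp K'.
pose W : set E := [set v | exists v1 v2, [/\ Ecomp K v1, Ecomp (~` K) v2 & v = v1 + v2]].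
have Ws : is_subspace W.
  split; first by exists 0, 0; split; [exact: (Ss _).1|exact: (Ss _).1|rewrite addr0].
  move=> a _ _ [u1 [u2 [Ku1 Ku2 ->]]] [w1 [w2 [Kw1 Kw2 ->]]].
  exists (a *: u1 + w1), (a *: u2 + w2); split; try exact: (Ss _).2.
  by rewrite scalerDr addrACA.
apply: (@span_min _ _ _ W Ws) (diag_span Ed v) => {v} v [mu [ka [de wv]]].
have [->|v0] := eqVneq v 0; first exact: Ws.1.
have {wv} [g wv] := integral_wt Ei v0 wv.
have [F [PF <- _]] := periodic_ext l_gt0 Zinj Zsurj wv.
have [F1 [F2 [-> KF1 KF2]]] := PW_split K PF.
by exists (F1 g), (F2 g); split; [exact: (PWK_Ecomp g KF1)|exact: (PWK_Ecomp g KF2)|].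
Qed.

(** Set [- v] beside the terms of an expression of [v]: the total is 0, hence so is its part of the
    weight of [v]. The surviving terms have the same weight and degree, so their formal sums can be
    added. *)
Lemma Ecomp_weight K mu ka c g v : Ecomp K v -> wt mu ka c g v ->
  exists F, [/\ PW l mu ka c F, F \in jspan A K & F g = v].
Proof.
move=> /span_bigsum[n [d [u [uK vE]]]] wv.
pose Q j (q : hdual h * ('I_k.+1 -> C) * C * (zk k -> E) * zk k) :=
  [/\ PW l q.1.1.1.1 q.1.1.1.2 q.1.1.2 q.1.2, q.1.2 \in jspan A K & u j = q.1.2 q.2].
have uQ j : exists q, Q j q.
  have [mu' [ka' [c' [F [g' [eta [PF Keta jF uE]]]]]]] := uK j.
  by exists (mu', ka', c', F, g'); split=> //; apply: span_sub; exists eta.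
have [f fP] := choice uQ.
pose wf j := hwt (f j).1.1.1.1 (f j).1.1.1.2 (dweight (f j).1.1.2 (f j).2).
pose w0 := hwt mu ka (dweight c g).
pose eta (j : 'I_n + 'I_1) := if j is inl j' then wf j' else w0.
pose w (j : 'I_n + 'I_1) := if j is inl j' then d j' *: u j' else - v.
have z0 a x : [set (0 : E)] x -> [set (0 : E)] (hop a x).
  by move=> ->; exact: (lin0 (hop_linear a)).
have wP j : jgen (@hop E) (eta j) (w j).
  have Js e := subspace_jgen (@hop_linear E) e.
  case: j => [j|j] /=.
    have [PF _ ->] := fP j; have juj := jgen_hop (PF.1 (f j).2).
    exact: (subspaceZ (d j) (Js _) juj).
  by rewrite -scaleN1r; exact: (subspaceZ _ (Js _) (jgen_hop wv)).
have := jgen_componentT (@hop_linear E) (@hop2 E) [set w0] (subspace0 E) z0 wP.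
rewrite [X in _ -> [set 0] X]big_mkcond !big_sumType !big_ord1 /= -vE subrr => /(_ erefl).
case: asboolP => [_|[] //]; rewrite -big_mkcond /= => /eqP; rewrite subr_eq0 => /eqP <-.
pose F := \sum_(j | `[< wf j = w0 >]) d j *: (f j).1.2.
have FE : F g = \sum_(j | `[< wf j = w0 >]) d j *: (f j).1.2 g.
  by rewrite /F; elim/big_rec2: _ => // j y1 y2 _ <-.
exists F; split.
- apply: subspace_sum => [|j /asboolP /hwt_inj[e1 e2 /dweight_inj[e3 e4]]].
    exact: subspace_PW.
  apply: (subspaceZ _ (subspace_PW _ _ _ _ _)); have [PF _ _] := fP j.
  by move: PF; rewrite e1 e2 e3.
- by apply: span_sum => j _; apply: spanZ; have [] := fP j.
- rewrite FE; apply: eq_bigr => j /asboolP /hwt_inj[_ _ /dweight_inj[_ e4]].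
  by have [_ _ ->] := fP j; rewrite e4.
Qed.

(** Two formal sums with the value [v] in degree [g] may differ, but by periodicity they agree on
    [g + lat]. Their common restriction to this coset lies in the spans over [K] and over its
    complement, hence is 0. This treats weight vectors. *)
Lemma Ecomp_indep K v : twist_stable K -> twist_stable (~` K) ->
  shift_stable K -> shift_stable (~` K) ->
  Ecomp K v -> Ecomp (~` K) v -> v = 0.
Proof.
move=> Kt nKt Ks nKs Kv nKv.
have weight_case mu ka de w : weight_space mu ka de w -> Ecomp K w -> Ecomp (~` K) w -> w = 0.
  move=> ww Kw nKw; apply: contrapT => /eqP w0; move/eqP: (w0); apply.
  have {ww} [g ww] := integral_wt Ei w0 ww.
  have [F [PF FK Fg]] := Ecomp_weight Kw ww.
  have [F' [PF' F'K F'g]] := Ecomp_weight nKw ww.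
  suff RF : restr l g F = 0.
    rewrite -Fg; have := congr1 (fun f => f g) RF; rewrite /restr.
    by case: asboolP => // -[]; exists 0; rewrite lat0 addr0.
  apply: (jspan_indep (@hA_linear R G k E) (@hA2 R G k E) (K := K)).
    exact: jspan_restr.
  have <- : restr l g F' = restr l g F; last exact: jspan_restr.
  apply/funext => g'; rewrite /restr; case: asboolP => // -[a ->].
  apply: (periodic_eq Zinj) => //; [exact: PF'.2|exact: PF.2|by rewrite F'g].
(* The intersection of the two components is stable under [h_tor], so it contains the weight
   components of each of its vectors. *)
pose N : set E := Ecomp K `&` Ecomp (~` K).
have Ns : is_subspace N by apply: subspaceI; exact: subspace_Ecomp.
have NA a x : N x -> N (hop a x).
  by case=> K1 K2; split; apply: submod_hop => //; exact: Ecomp_submod.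
have [n [d [u [uK vE]]]] := span_bigsum Kv.
have uw j : exists q : hdual h * ('I_k.+1 -> C) * ('I_k.+1 -> C),
    weight_space q.1.1 q.1.2 q.2 (d j *: u j).
  have [mu [ka [c [F [g [eta [PF _ _ ->]]]]]]] := uK j.
  exists (mu, ka, dweight c g) => /=; apply: (subspaceZ _ (subspace_weight _ _ _ _)).
  exact: PF.1.
have [q qP] := choice uw; pose wf j := hwt (q j).1.1 (q j).1.2 (q j).2.
rewrite vE; apply: (sum_by_class (eta := wf) (subspace0 E)) => j.
set S := \sum_(_ | _) _.
have NS : N S.
  have vN : N (\sum_j d j *: u j) by rewrite -vE.
  by have := jgen_componentT (@hop_linear E) (@hop2 E) [set wf j] Ns NA
    (fun i => jgen_hop (qP i)) vN.
apply: (weight_case _ _ _ _ _ NS.1 NS.2); apply/(hwtP (q j).1.1 (q j).1.2 (q j).2) => a.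
rewrite (lin_bigsum (hop_linear a)) scaler_sumr; apply: eq_bigr => i /asboolP ij.
by move/hwtP: (qP i) => ->; rewrite -/(wf i) ij.
Qed.

End Ecomp.

Section Homomorphism.
Variables (E E' : tmod G k.+1) (f : E -> E').
Hypothesis fh : is_thom f.

Lemma thom_comp_linear : linear (fun F : zk k -> E => (f \o F) : zk k -> E').
Proof. by move=> a F1 F2; apply/funext => g'; exact: fh.1. Qed.

Lemma jgen_thom eta F : jgen (@hA R G k E) eta F -> jgen (@hA R G k E') eta (f \o F).
Proof.
move=> jF i; rewrite -[eta i]mul1r.
apply: (geig_semi thom_comp_linear (hA_linear i) _ (jF i)) => F'.
by rewrite scale1r; apply/funext => g'; rewrite /hA /hact /= fh.2.
Qed.

Lemma Ecomp_hom (l : 'I_k -> nat) K v : Ecomp l K v -> Ecomp l K (f v).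
Proof.
have [fl fA] := fh.
apply: (span_map fl) => _ [mu [ka [c [F [g [eta [[wF pF] Keta jF ->]]]]]]].
apply: span_sub; exists mu, ka, c, (f \o F), g, eta; split=> //; last exact: jgen_thom.
split=> [g'|i g'] /=; last by rewrite pF /Zop fA.
by have [hF KF dF] := wF g'; split=> x; rewrite -fA ?hF ?KF ?dF (linZ fl).
Qed.

End Homomorphism.
End Tame.

(** * Splittings preserved by homomorphisms *)

Section Splittings.
Variables (R : realType) (G : simpleLie R) (k : nat).
Local Notation C := R[i].
Local Notation h := (hfin G).
Local Notation tm := (tmod G k.+1).

Lemma submod0 (E : tm) : @is_submod R G k.+1 E [set 0].
Proof.
by split; [exact: subspace0|move=> u v ->; exact: lin0 (act_linear u)].
Qed.

(* The complement [B] of the image of [X] gives the retraction [r] of [E] onto [X]. *)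
Lemma ext_split_criterion (V X : tm) (E : extension V X) (B : set E) : is_submod B ->
  (forall x, B (ext_inj E x) -> x = 0) ->
  (forall e, exists x, B (e - ext_inj E x)) -> ext_equiv E (split_extension V X).
Proof.
move=> [Bs BA] B0 BE; have [r rP] := choice BE.
have [il iA] := ext_inj_hom E; have [pl pA] := ext_proj_hom E.
have runiq e x : B (e - ext_inj E x) -> r e = x.
  move=> Bx; apply/eqP; rewrite -subr_eq0; apply/eqP/B0; rewrite (linB il).
  have := subspaceB Bs Bx (rP e); rewrite opprB addrC addrA subrK.
  by [].
exists (fun e => (r e, ext_proj e)); split.
- split=> [a e e'|u e]; congr pair; rewrite ?pl ?pA //; apply: runiq.
    by rewrite il opprD addrACA -scalerBr; exact: Bs.2.
  by rewrite iA -(linB (act_linear u)); exact: BA.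
- move=> x; congr pair; first by apply: runiq; rewrite subrr; exact: Bs.1.
  by apply/(ext_exact (ext_inj E x)); exists x.
- by [].
Qed.

Definition natural_splitting (K : tm -> Prop) (A B : forall E : tm, set E) :=
  [/\ forall E, K E -> is_submod (A E) /\ is_submod (B E),
      forall E, K E -> forall v, A E v -> B E v -> v = 0,
      forall E, K E -> forall v, exists a b, [/\ A E a, B E b & v = a + b] &
      forall (E E' : tm) (f : E -> E') v, is_thom f ->
        (A E v -> A E' (f v)) /\ (B E v -> B E' (f v))].

(** The projection sends [A E] into [A V], which is 0 because [V] equals [B V]; so [A E] is the
    image of [X], and [B E] is a complement to it. *)
Lemma natural_splitting_ext K A B (V X : tm) (E : extension V X) :
  natural_splitting K A B -> K E -> K V ->
  (forall v, B V v) -> (forall x, A X x) -> ext_equiv E (split_extension V X).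
Proof.
move=> [AB ABi ABs ABh] KE KV BV AX; have [[As _] [Bs BA]] := AB _ KE.
apply: (@ext_split_criterion _ _ _ (B E)) => [|x Bx|e]; first by split.
  apply: (@ext_injective _ _ _ _ _ E); rewrite (lin0 (ext_inj_hom E).1).
  by apply: ABi => //; have [+ _] := ABh _ _ _ x (ext_inj_hom E); apply.
have [a [b [Aa Bb ->]]] := ABs _ KE e.
have : ext_proj a = 0.
  apply: (ABi _ KV) => //; have [+ _] := ABh _ _ _ a (ext_proj_hom E); exact.
by case/(ext_exact a) => x <-; exists x; rewrite addrC addrA addNr add0r.
Qed.

(** An indecomposable [W] equals [A W] or [B W]; in the first case naturality would make every
    homomorphism between [V] and [W] zero. *)
Lemma natural_splitting_link K A B (V W : tm) : natural_splitting K A B ->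
  K V -> K W -> tindecomposable W -> hom_nonzero V W \/ hom_nonzero W V ->
  (forall v, B V v) -> forall w, B W w.
Proof.
move=> [AB ABi ABs ABh] KV KW [_ Wind] VW BV w.
have [As Bs] := AB _ KW.
have ABI : A W `&` B W = [set 0].
  apply/seteqP; split=> [v [Av Bv]|_ ->]; first exact: (ABi _ KW).
  by split; [exact: As.1.1|exact: Bs.1.1].
have [a [b [Aa Bb ->]]] := ABs _ KW w.
case: (Wind _ _ As Bs ABI (ABs _ KW)) => [A0|B0].
  by move: Aa; rewrite A0 => ->; rewrite add0r.
case: VW => -[f [fh [v fv]]].
  have [_ /(_ (BV v))] := ABh _ _ _ v fh; rewrite B0 /= => fv0.
  by rewrite fv0 eqxx in fv.
have [x [y [Ax By vE]]] := ABs _ KW v.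
move: By; rewrite B0 /= => y0; move: vE; rewrite y0 addr0 => vx.
have [+ _] := ABh _ _ _ x fh; move=> /(_ Ax) Afx.
by move: fv; rewrite vx (ABi _ KV _ Afx (BV _)) eqxx.
Qed.

(** * Fitting decomposition for a product of two central elements *)

Section Fitting.
Variable r : zk k.

(* Being central of degree 0, it commutes with the [d_i] as well, so that the
   decomposition into generalized eigenspaces consists of submodules. *)
Definition cop (E : tm) : E -> E :=
  act (GK G (zcons 0 r) ord0) \o act (GK G (zcons 0 (- r)) ord0).

Lemma cop_linear E : linear (@cop E).
Proof. by move=> a u v; rewrite /cop /= !act_linear. Qed.

Lemma cop_act (E : tm) u (v : E) : cop (act u v) = act u (cop v).
Proof.
rewrite /cop /=; case: u => [x m|m j|i]; first by rewrite !act_KXc.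
  by rewrite (act_KKc _ _ m) (act_KKc _ _ m).
have := act_DK i (zcons 0 r) ord0 (act (GK G (zcons 0 (- r)) ord0) v).
have := act_DK i (zcons 0 (- r)) ord0 v.
rewrite /comm => /eqP; rewrite subr_eq => /eqP d1 /eqP; rewrite subr_eq => /eqP ->.
rewrite d1 act_linear addrA -scalerDl.
suff -> : (zcons 0 r i)%:~R + (zcons 0 (- r) i)%:~R = 0 :> C by rewrite scale0r add0r.
by rewrite -intrD !ffunE; case: unlift => [j|]; rewrite ?ffunE ?subrr ?addr0.
Qed.

Lemma submod_cop_eigen (E : tm) q : @is_submod R G k.+1 E [set v | cop v = q *: v].
Proof.
split; first split.
- by rewrite /= (lin0 (@cop_linear E)) scaler0.
- move=> a u v; rewrite /mkset => uq vq.
  by rewrite cop_linear uq vq scalerDr !scalerA mulrC.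
- by move=> u v; rewrite /mkset cop_act => ->; rewrite (linZ (act_linear u)).
Qed.

Definition nil_part (E : tm) : set E := geig (@cop E) 0.
Definition inv_part (E : tm) : set E :=
  [set v | v \in span_pred [set w | exists2 a, a != 0 & geig (@cop E) a w]].

Lemma nil_inv_indep (E : tm) (v : E) : nil_part v -> inv_part v -> v = 0.
Proof.
have Al (i : unit) : linear ((fun=> @cop E) i) by exact: cop_linear.
have A2 i j w := @comm2_commuting C E unit (fun=> @cop E) setT Al (fun _ _ _ => I)
  (fun _ _ _ _ => erefl) i j w I.
move=> v0 vi; apply: (jspan_indep (K := [set eta | eta tt = 0]) Al A2).
  by apply: span_sub; exists (fun=> 0).
apply: span_mono vi => w [a a0 aw]; exists (fun=> a) => //=.
by move/eqP: a0.
Qed.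

Lemma fitting_splitting : natural_splitting (@tame R G k) nil_part inv_part.
Proof.
have gA (E : tm) a u (v : E) : geig (@cop E) a v -> geig (@cop E) a (act u v).
  move=> av; rewrite -[a]mul1r.
  by apply: (geig_semi (act_linear u) (@cop_linear E) _ av) => w; rewrite scale1r cop_act.
split.
- move=> E _; split; split; first exact: subspace_geig (@cop_linear E).
  + by move=> u v; exact: gA.
  + exact: subspace_span.
  + move=> u v; apply: (span_map (act_linear u)) => w [a a0 aw].
    by apply: span_sub; exists a => //; exact: gA.
- by move=> E _ v; exact: nil_inv_indep.
- move=> E [Ed _ Efd] v.
  pose W : set E := [set v | exists a b, [/\ nil_part a, inv_part b & v = a + b]].
  have n0 := subspace_geig 0 (@cop_linear E).
  have Ws : is_subspace W.
    split; first by exists 0, 0; rewrite addr0; split=> //; [exact: n0.1|exact: span0].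
    move=> a _ _ [x [y [xn yi ->]]] [x' [y' [xn' yi' ->]]].
    exists (a *: x + x'), (a *: y + y'); split; first exact: n0.2.
      exact: (subspace_span _).2.
    by rewrite scalerDr addrACA.
  apply: (@span_min _ _ _ W Ws) (diag_span Ed v) => {}v [mu [ka [de wv]]].
  (* Being central of degree 0, [cop] acts on each weight space, which is finite-dimensional. *)
  have cW (u : E) : weight_space mu ka de u -> weight_space mu ka de (cop u).
    move=> [hu Ku du]; have cl := linZ (@cop_linear E).
    by split=> x; rewrite -cop_act ?hu ?Ku ?du cl.
  have [s sP] := Efd mu ka de.
  have [L vL] := fdim_annihilator (@cop_linear E) cW (fdim_span sP) wv.
  apply: (@span_min _ _ _ W Ws) (geig_decomp (@cop_linear E) (subspace_weight _ _ _ _) cW wv vL).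
  move=> u [_ [a ua]]; have [a0|a0] := eqVneq a 0.
    by exists u, 0; rewrite addr0; split; [rewrite /nil_part -a0|exact: span0|].
  exists 0, u; rewrite add0r; split=> //; first exact: n0.1.
  by apply: span_sub; exists a.
- move=> E E' f v [fl fA]; have fc a w : geig (@cop E) a w -> geig (@cop E') a (f w).
    move=> aw; rewrite -[a]mul1r; apply: (geig_semi fl (@cop_linear E') _ aw) => u.
    by rewrite scale1r /cop /= !fA.
  split; first exact: fc.
  apply: (span_map fl) => w [a a0 aw]; apply: span_sub; exists a => //; exact: fc.
Qed.

(** [cop] has no generalized eigenvalue 0, hence is bijective; it is a product of two commuting
    factors, so each factor is bijective. *)
Lemma inv_part_bij (E : tm) : (forall v : E, inv_part v) ->
  injective (act (GK G (zcons 0 r) ord0) : E -> E) /\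
  forall v : E, exists w, act (GK G (zcons 0 r) ord0) w = v.
Proof.
move=> Ei; have cl := @cop_linear E.
have ci v : @cop E v = 0 -> v = 0.
  by move=> v0; apply: nil_inv_indep => //; exists 1%N; rewrite /= /shiftop v0 scale0r subrr.
split=> [u v uv|v].
  apply/eqP; rewrite -subr_eq0; apply/eqP/ci; rewrite /cop /= act_KKc.
  by rewrite (linB (act_linear _)) uv subrr (lin0 (act_linear _)).
suff [w <-] : exists w, cop w = v by exists (act (GK G (zcons 0 (- r)) ord0) w).
have Ts : @is_subspace C E setT by [].
apply: (@span_min _ _ _ [set v | exists w, cop w = v]) (Ei v) => [|{}v [a a0 av]].
  split; first by exists 0; rewrite (lin0 cl).
  by move=> a _ _ [x <-] [y <-]; exists (a *: x + y); rewrite cl.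
have [w [_ _ <-]] := geig_solve cl Ts (fun _ _ => I) a0 (I : setT v) av.
by exists w; rewrite /shiftop scale0r subr0.
Qed.

End Fitting.

(* all the operators [t^(l_i e_i) K_1] are invertible on [E] *)
Definition invertible (l : 'I_k -> nat) (E : tm) :=
  tame E /\ forall i (v : E), inv_part (per l i) v.

Lemma Ecomp_splitting (l : 'I_k -> nat) (K : set (idx G k -> C)) :
  (forall i, (0 < l i)%N) -> twist_stable K -> twist_stable (~` K) ->
  shift_stable K -> shift_stable (~` K) ->
  natural_splitting (invertible l) (fun E => @Ecomp R G k l E K) (fun E => @Ecomp R G k l E (~` K)).
Proof.
move=> l0 Kt nKt Ks nKs.
have Zb E : invertible l E -> (forall i, injective (@Zop R G k l E i)) /\
    (forall i v, exists w, Zop l i w = v :> E).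
  by move=> [_ Ei]; split=> i; have [? ?] := inv_part_bij (Ei i).
split=> [E [Et Ei]|E [Et Ei]|E [Et Ei]|E E' f v fh].
- by have [zi zs] := Zb E (conj Et Ei); split; exact: Ecomp_submod.
- have [zi zs] := Zb E (conj Et Ei) => v /=; exact: Ecomp_indep.
- by have [zi zs] := Zb E (conj Et Ei); exact: Ecomp_sum.
- by split; exact: Ecomp_hom.
Qed.

End Splittings.

(** * The simple modules *)

Section SimpleModules.
Variables (R : realType) (G : simpleLie R) (k : nat).
Local Notation C := R[i].
Local Notation h := (hfin G).
Variable X : forall la : haff_dual G, Paff_plus la -> hwmod la.
Variable p : PiSet G k.
Local Notation L := (Lpi X p).
Local Notation vp := (vpi X p).

Definition pi_eig (i : idx G k) : C := \sum_(M : pi_supp p) mono (mpoint (val M)) i.2 *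
  (p (val M) (if i.1 is Some t then haff_h t else haff_K G) : C).

Lemma tpure_scale (I : choiceType) (W : I -> lmodType C) (v : forall i, W i) i a :
  tpure (eqtype.dfwith v (a *: v i)) = a *: tpure v.
Proof.
have fl := @tpure_multilinear C I W v i.
rewrite (linZ fl); congr (_ *: tpure _).
by apply: functional_extensionality_dep => j; case: eqtype.dfwithP.
Qed.

Lemma slotsum_vpi (c e : pi_supp p -> C) (a : forall i : pi_supp p, pi_factor X i -> pi_factor X i) :
  (forall i, linear (a i)) -> (forall i, a i (hw_vec (pi_factor X i)) = e i *: hw_vec (pi_factor X i)) ->
  slotsum c a vp = (\sum_i c i * e i) *: vp.
Proof.
move=> al ae; rewrite /slotsum scaler_suml; apply: eq_bigr => i _.
by rewrite -scalerA; congr (_ *: _); rewrite slot_pure // ae tpure_scale.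
Qed.

Lemma Xpi_act_vpi (Y : tgen G 1) r (la : maxspec C k -> C) :
  (forall M : pi_supp p, act Y (hw_vec (pi_factor X M)) = la (val M) *: hw_vec (pi_factor X M)) ->
  Xpi_act Y (lmono r 1) vp = (\sum_(M : pi_supp p) mono (mpoint (val M)) r * la (val M)) *: vp.
Proof.
move=> Yla; have al (M : pi_supp p) := @act_linear R G 1 (pi_factor X M) Y.
rewrite /Xpi_act (@slotsum_vpi _ (fun M => la (val M)) _ al Yla).
by congr (_ *: _); apply: eq_bigr => M _; rewrite /mev leval_mono mul1r.
Qed.

Lemma thead_cons m (r : zk k) : thead (zcons m r) = [ffun=> m].
Proof. by apply/ffunP => j; rewrite !ffunE unlift_none. Qed.

Lemma Lpi_igen i s : act (igen i) (fsdelta s vp : L) = pi_eig i *: (fsdelta (s + i.2) vp : L).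
Proof.
have hv (M : pi_supp p) := hw_vecP (pi_factor X M).
have z0 : [ffun=> 0] = 0 :> zk 1 by apply/ffunP => j; rewrite !ffunE.
rewrite -[LHS]/(Lpi_act (igen i) (fsdelta s vp)) Lpi_act_delta igen_shift addrC.
rewrite -(linZ (fsdelta_linear _)); congr fsdelta.
case: i => -[t|] r; rewrite /igen /=.
  rewrite thead_cons z0 ttail_cons.
  rewrite (@Xpi_act_vpi _ _ (fun M => p M (haff_h t))) // => M.
  by have [_ _ _ ht _] := hv M; exact: ht.
rewrite zcons0 eqxx ttail_cons (@Xpi_act_vpi _ _ (fun M => p M (haff_K G))) // => M.
by have [_ _ _ _ [hK _]] := hv M; exact: hK.
Qed.

Lemma Lpi_weight : exists mu ka c, forall s, wt mu ka c s (fsdelta s vp : L).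
Proof.
pose mu : hdual h := \sum_(M : pi_supp p) restr_h (p (val M)).
pose c : C := \sum_(M : pi_supp p) (p (val M) (haff_d G) : C).
exists mu, (fun i => if i == ord0 then pi_eig (None, 0) else 0), c => s.
split=> [t|i|i].
- have := Lpi_igen (Some t, 0) s; rewrite /igen /= zcons00 addr0 => ->; congr (_ *: _).
  rewrite /mu sum_lfunE; apply: eq_bigr => M _.
  by rewrite mono0 mul1r restr_hE.
- have [->|i0] := eqVneq i ord0.
    by have := Lpi_igen (None, 0) s; rewrite /igen /= zcons00 addr0.
  rewrite -[LHS]/(Lpi_act (GK G 0 i) (fsdelta s vp)) Lpi_act_delta Lpi_coef_K0 ?(negPf i0) //.
  by rewrite (lin0 (fsdelta_linear _)) scale0r.
- rewrite -[LHS]/(Lpi_act (GD G i) (fsdelta s vp)) Lpi_act_delta /= add0r.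
  rewrite /dweight; case: unlift => [j|]; first by rewrite (linZ (fsdelta_linear _)).
  rewrite -(linZ (fsdelta_linear _)); congr fsdelta.
  have al (M : pi_supp p) := @act_linear R G 1 (pi_factor X M) (GD G ord0).
  have dv (M : pi_supp p) : act (GD G ord0) (hw_vec (pi_factor X M))
      = p (val M) (haff_d G) *: hw_vec (pi_factor X M).
    by have [_ _ _ _ [_ hd]] := hw_vecP (pi_factor X M); exact: hd.
  rewrite /Xpi_d1 (@slotsum_vpi _ (fun M => p (val M) (haff_d G)) _ al dv).
  by congr (_ *: _); apply: eq_bigr => M _; rewrite mul1r.
Qed.

Section Submodule.
Variable g : zk k.+1.
Local Notation V := (Xpi_mod X p g).

Definition Xpi_val (v : V) : L := sub_val v.

Lemma Xpi_val_hom : is_thom Xpi_val.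
Proof. by []. Qed.

Lemma Xpi_gen_sub : Xpi_gen X p g \in sub_pred (tgenerated_submod (Xpi_gen X p g)).
Proof. by apply/asboolP => W _. Qed.

Definition Xpi_v0 : V := SubElt Xpi_gen_sub.

Lemma Xpi_generated (W : set V) : is_submod W -> W Xpi_v0 -> forall v, W v.
Proof.
move=> [Ws WA] W0 v; pose W' : set L := [set x | exists2 y, sub_val y = x & W y].
have W's : is_submod W'.
  split; first split; first by exists 0 => //; exact: Ws.1.
    by move=> a _ _ [x <- Wx] [y <- Wy]; exists (a *: x + y) => //; exact: Ws.2.
  by move=> u _ [x <- Wx]; exists (act u (x : V) : V) => //; exact: WA.
have := valP v; move/asboolP => /(_ W' W's) [|y yv Wy]; first by exists Xpi_v0.
by have -> : v = y by apply: val_inj.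
Qed.

(** [cop] commutes with the action, so its eigenvectors form a submodule, and the generator is one
    of them. *)
Lemma Xpi_cop r (v : V) : cop r v = (pi_eig (None, r) * pi_eig (None, - r)) *: v.
Proof.
apply: (Xpi_generated (submod_cop_eigen r _ _)); apply: val_inj; rewrite /cop /=.
have := Lpi_igen (None, - r) (ttail g); rewrite {1}/igen /= => ->.
rewrite (linZ (@Lpi_act_linear R G k X p _)).
have := Lpi_igen (None, r) (ttail g - r); rewrite {1}/igen /= => ->.
by rewrite subrK scalerA mulrC.
Qed.

Lemma Xpi_nil r : pi_eig (None, r) * pi_eig (None, - r) = 0 -> forall v : V, nil_part r v.
Proof.
by move=> q0 v; exists 1%N; rewrite /= /shiftop Xpi_cop q0 scale0r subrr.
Qed.

Lemma Xpi_inv r : pi_eig (None, r) * pi_eig (None, - r) != 0 -> forall v : V, inv_part r v.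
Proof.
move=> q0 v; apply: span_sub; exists (pi_eig (None, r) * pi_eig (None, - r)) => //.
by apply: geig_eig; exact: Xpi_cop.
Qed.

(** In [Lpi] the formal sum of suitable multiples of the [v_pi (x) t^s] is a genuine joint
    eigenvector, but its terms need not all lie in the submodule. Its restriction to the coset
    [g0 + lat] has values there and, by twist stability, still lies in the span over [K]. The
    splitting takes place in the submodule, where weight spaces are finite-dimensional, and a
    comparison inside [Lpi] shows that the complementary part vanishes. *)
Lemma Xpi_Ecomp (l : 'I_k -> nat) (K : set (idx G k -> C)) : (forall i, (0 < l i)%N) ->
  invertible l V -> twist_stable K -> shift_stable K -> K pi_eig ->
  forall v : V, Ecomp l K v.
Proof.
move=> l0 Vinv Kt Ks Kpi; have [Vt Vi] := Vinv.
have zinj i : injective (@Zop R G k l V i) by have [] := inv_part_bij (Vi i).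
have As := Ecomp_submod l0 zinj Vt Ks.
apply: (Xpi_generated As); have [->|v00] := eqVneq Xpi_v0 0; first exact: As.1.1.
pose q i := pi_eig (None, per l i); pose q' i := pi_eig (None, - per l i).
have qq' i : q i * q' i != 0.
  apply: contra_neq v00 => q0; apply: nil_inv_indep (Vi i Xpi_v0).
  exact: Xpi_nil.
have q0 i : q i != 0 by apply: contraNneq (qq' i) => ->; rewrite mul0r.
have q'0 i : q' i != 0 by apply: contraNneq (qq' i) => ->; rewrite mulr0.
set g0 := ttail g.
have [[T0 Tl] TA] := tgenerated_submod (Xpi_gen X p g).
have TZ a x : tgenerated (Xpi_gen X p g) x -> tgenerated (Xpi_gen X p g) (a *: x).
  by move=> Tx; rewrite -[_ *: _]addr0; exact: Tl.
(* Since [q i] and [q' i] are nonzero, the generator can be moved by a period in either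
   direction. *)
have memV a : tgenerated (Xpi_gen X p g) (fsdelta (g0 + lat l a) vp : L).
  elim/zk_ind: a => [|a i IH|a i IH].
  - by rewrite lat0 addr0 => W _.
  - have := TZ (q i)^-1 _ (TA (igen (None, per l i)) _ IH).
    by rewrite Lpi_igen scalerA mulVf // scale1r latD addrA.
  - have := TZ (q' i)^-1 _ (TA (igen (None, - per l i)) _ IH).
    by rewrite Lpi_igen scalerA mulVf // scale1r latB addrA.
(* A move by [per l i] then multiplies the coefficient by [q i], the eigenvalue of [Zop l i], which
   makes [vh] periodic. *)
pose b i := (l i).-root (q i).
have bE i : b i ^+ l i = q i by rewrite rootCK.
have b0 i : b i != 0 by rewrite rootC_eq0.
pose vh : zk k -> L := fun s => mono b (s - g0) *: fsdelta s vp.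
have per_mono i : mono b (per l i) = q i.
  rewrite /mono (bigD1 i) //= big1 ?mulr1 => [|j ji].
    by rewrite ffunMnE ffunE eqxx natz -exprnP bE.
  by rewrite ffunMnE ffunE (negPf ji) mul0rn expr0z.
have vhp : periodic l vh.
  move=> i s; rewrite /vh /Zop (linZ (act_linear _)).
  have := Lpi_igen (None, per l i) s; rewrite {1}/igen /= => ->.
  by rewrite scalerA -/(q i) -per_mono -monoD // addrAC.
pose F0 := restr l g0 vh.
have F0p : periodic l F0 by exact: restr_periodic.
have F0K : F0 \in jspan (@hA R G k L) K.
  apply: jspan_restr => //; apply: span_sub; exists (twist (fun j => (b j)^-1) pi_eig).
    by apply: Kt => // j; rewrite invr_eq0.
  move=> i; apply: geig_eig; apply/funext => s.
  transitivity ((twist (fun j => (b j)^-1) pi_eig i) *: vh s); last by [].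
  rewrite /hA /hact igen_shift /vh (linZ (act_linear _)) Lpi_igen subrK !scalerA.
  congr (_ *: _); rewrite /twist /= mulrAC.
  suff -> : mono b (s - i.2 - g0) = mono (fun j => (b j)^-1) i.2 * mono b (s - g0) by [].
  rewrite addrAC (monoD (s - g0) (- i.2) b0) mulrC; congr (_ * _).
  by apply: eq_bigr => j _; rewrite ffunE exprz_inv.
have [mu [ka [c wv]]] := Lpi_weight.
have F0w s : wt mu ka c s (F0 s).
  have ws := subspace_weight L mu ka (dweight c s).
  rewrite /F0 /restr; case: asboolP => _; last exact: ws.1.
  exact: (subspaceZ _ ws (wv s)).
have F0V s : exists x : V, sub_val x = F0 s :> L.
  suff Ts : F0 s \in sub_pred (tgenerated_submod (Xpi_gen X p g)) by exists (SubElt Ts).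
  apply/asboolP; rewrite /F0 /restr; case: asboolP => [[a ->]|_] //.
  exact: TZ.
have [F FE] := choice F0V.
have PF : PW l mu ka c F.
  split=> [s|i s]; last first.
    apply: val_inj; transitivity (Zop l i (sub_val (F s) : L)); last by [].
    by rewrite FE -F0p -FE.
  have [hF KF dF] := F0w s; split=> x; apply: val_inj.
  - transitivity (act (GX (vsval x) 0) (sub_val (F s) : L)); first by [].
    by rewrite FE hF -FE.
  - transitivity (act (GK G 0 x) (sub_val (F s) : L)); first by [].
    by rewrite FE KF -FE.
  - transitivity (act (GD G x) (sub_val (F s) : L)); first by [].
    by rewrite FE dF -FE.
have [F1 [F2 [F12 F1K F2K]]] := PW_split l0 zinj Vt K PF.
have vl := thom_comp_linear Xpi_val_hom.
have valK F' K' : F' \in span_pred (PWK l mu ka c K') ->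
    (Xpi_val \o F') \in jspan (@hA R G k L) K'.
  move=> F'K; apply: (@span_map _ _ _ _ _ _ F' vl _ F'K) => F'' [_ [eta Keta jF'']].
  by apply: span_sub; exists eta => //; exact: (jgen_thom Xpi_val_hom).
(* In [Lpi] the part [F2] equals [F0 - F1], so it lies in the spans over [K] and over its
   complement. *)
have F20 : Xpi_val \o F2 = 0.
  apply: (jspan_indep (@hA_linear R G k L) (@hA2 R G k L) (K := K)); last exact: valK.
  have -> : Xpi_val \o F2 = F0 - (Xpi_val \o F1).
    apply/funext => s; transitivity (F0 s - sub_val (F1 s)); last by [].
    by rewrite -FE F12 [F1 + F2]addrC; apply/esym; exact: addrK.
  by rewrite -scaleN1r; apply: spanD => //; apply: spanZ; exact: valK.
have -> : Xpi_v0 = F1 g0.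
  apply: val_inj; rewrite /= /Xpi_gen -/g0.
  have -> : sub_val (F1 g0) = sub_val (F g0).
    rewrite F12 -[LHS]addr0; congr (_ + _).
    by have := congr1 (fun f => f g0) F20.
  rewrite FE /F0 /restr; case: asboolP => [_|[]]; last by exists 0; rewrite lat0 addr0.
  by rewrite /vh subrr mono0 scale1r.
exact: (PWK_Ecomp g0 F1K).
Qed.

End Submodule.
End SimpleModules.

(** * Points of the torus *)

(** Nested intervals: the interval after [n] is followed by one avoiding [f n], and the supremum of
    the left ends lies in all of them. *)
Lemma real_uncountable (R : realType) (f : nat -> R) : exists x, forall n, f n != x.
Proof.
(* In the second case the right end goes below the midpoint, so that [y = m] is avoided as well. *)
pose step (ab : R * R) (y : R) := let m := (ab.1 + ab.2) / 2 in
  if y < m then (m, ab.2) else (ab.1, (ab.1 + m) / 2).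
pose ab := fix ab n := if n is m.+1 then step (ab m) (f m) else (0, 1).
have stepP p y : p.1 < p.2 -> [/\ p.1 <= (step p y).1, (step p y).2 <= p.2,
    (step p y).1 < (step p y).2 & ~~ ((step p y).1 <= y <= (step p y).2)].
  move=> p12; rewrite /step; set m := _ / 2.
  have [m1 m2] : p.1 < m /\ m < p.2 by rewrite /m; split; lra.
  case: ltP => ym /=; split; try lra; apply/negP => /andP[? ?]; lra.
have ablt n : (ab n).1 < (ab n).2.
  by elim: n => [|n IH] /=; [exact: ltr01|have [] := stepP _ (f n) IH].
have mono n d : (ab n).1 <= (ab (n + d)%N).1 /\ (ab (n + d)%N).2 <= (ab n).2.
  elim: d => [|d [IH1 IH2]]; first by rewrite addn0.
  rewrite addnS /=; have [s1 s2 _ _] := stepP _ (f (n + d)%N) (ablt (n + d)%N).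
  by split; [exact: le_trans s1|exact: le_trans IH2].
have cross n m : (ab n).1 <= (ab m).2.
  have [/subnK <-|/ltnW/subnK <-] := leqP n m; rewrite addnC.
    by have [h _] := mono n (m - n)%N; apply: le_trans h (ltW (ablt _)).
  by have [_ h] := mono m (n - m)%N; apply: le_trans (ltW (ablt _)) h.
pose A := [set x | exists n, x = (ab n).1].
have Asup : has_sup A.
  split; first by exists (ab 0%N).1, 0%N.
  by exists (ab 0%N).2 => _ [n ->]; exact: cross.
exists (sup A) => n; apply/eqP => fn; have [_ _ _ /negP] := stepP _ (f n) (ablt n); apply.
rewrite -/(ab n.+1) fn; apply/andP; split.
  by apply: sup_upper_bound => //; exists n.+1.
by apply: ge_sup; [exact: Asup.1|move=> _ [m ->]; exact: cross].
Qed.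

Lemma infinite_fiber (R : realType) (T : countType) (phi : R -> T) :
  exists t, infinite_set [set x | phi x = t].
Proof.
apply: contrapT => /forallNP fin.
have /choice[s sP] : forall t, exists s : seq R, [set x | phi x = t] = [set` s].
  by move=> t; apply/finite_seqP; exact: contrapT (fin t).
pose f N := if (choice.unpickle N : option (T * nat)) is Some (t, m) then nth 0 (s t) m else 0 : R.
have [x xP] := real_uncountable f.
have xs : x \in s (phi x) by have : [set` s (phi x)] x by rewrite -sP.
have := xP (choice.pickle (phi x, index x (s (phi x)))).
by rewrite /f choice.pickleK nth_index // eqxx.
Qed.

(** Used with [a] the coefficients of a linear relation between inverses [b j] modulo [M], and [Q]
    the product of all the factors: by [prod_resolvent] each term on the right then lies in [M]. *)
Lemma sum_mod_factor (S : comNzRingType) (J : finType) (a b P : J -> S) (Q : S) :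
  \sum_j a j * b j = 0 -> \sum_j a j * P j = \sum_j a j * (P j - b j * Q).
Proof.
move=> ab; under [RHS]eq_bigr do rewrite mulrBr mulrA.
by rewrite sumrB -mulr_suml ab mul0r subr0.
Qed.

Lemma prod_resolvent (S : comNzRingType) (J : finType) (t : J -> S) (g : S) j :
  \prod_(i | i != j) t i - g * \prod_i t i = - (\prod_(i | i != j) t i * (g * t j - 1)).
Proof. by rewrite [\prod_i t i](bigD1 j) //=; ring. Qed.

Lemma prod_congruence (S : comNzRingType) (x y a b : S) :
  x * y - a * b = x * (y - b) + b * (x - a).
Proof. ring. Qed.

Lemma quotient_congruence (S : comNzRingType) (u t x a b : S) : u * t = 1 ->
  u * x - b = u * (x - a * b) - u * b * (t - a).
Proof. by move=> ut; rewrite -[X in _ - X = _]mul1r -ut; ring. Qed.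

Section Nullstellensatz.
Variables (R : realType) (k : nat).
Local Notation C := R[i].
Local Notation A := (laurent C k).

Definition lconst (c : C) : A := lmono 0 c.

Lemma lconst_zmod : zmod_morphism lconst.
Proof. by move=> c d; exact: (linB (@lmono_linear C k 0)). Qed.

Lemma lconst_monoid : monoid_morphism lconst.
Proof. by split=> // c d; rewrite lmulE lmul_monom addr0. Qed.

HB.instance Definition _ := GRing.isZmodMorphism.Build C A lconst lconst_zmod.
HB.instance Definition _ := GRing.isMonoidMorphism.Build C A lconst lconst_monoid.

Lemma lconst_scale c (f : A) : lconst c * f = c *: f.
Proof.
rewrite lmulE lmul_mono; congr (_ *: _).
by move: f; apply: fsupp_ext => [||s d] //; [exact: lshift_linear|rewrite lshift_mono add0r].
Qed.

Lemma leval_linear (a : 'I_k -> C) : linear (leval a : A -> C^o).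
Proof.
apply: (@fslift_linear C (zk k) C^o C^o (fun r c => c * mono a r)) => r e x y.
by rewrite [LHS]mulrDl; congr (_ + _); rewrite -[LHS]mulrA.
Qed.

Lemma mono_zdelta (F : fieldType) (a : 'I_k -> F) i : mono a (zdelta i) = a i.
Proof.
rewrite /mono (bigD1 i) //= big1 => [|j ji]; rewrite ffunE ?eqxx ?expr1z ?mulr1 //.
by rewrite (negPf ji) expr0z.
Qed.

Definition lvar (i : 'I_k) : A := lmono (zdelta i) 1.

Section Point.
Variable M : maxspec C k.

Let Mid : is_ideal (mideal M). Proof. by case: M => ? []. Qed.
Let M1 : ~ mideal M 1. Proof. by case: M => ? []. Qed.
Let M0 : mideal M 0. Proof. by case: Mid. Qed.
Let MD f g : mideal M f -> mideal M g -> mideal M (f + g). Proof. by case: Mid => _ + _; apply. Qed.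
Let MM f g : mideal M g -> mideal M (f * g). Proof. by case: Mid => _ _; apply. Qed.
Let MN f : mideal M f -> mideal M (- f). Proof. by rewrite -mulN1r; exact: MM. Qed.
Let MB f g : mideal M f -> mideal M g -> mideal M (f - g).
Proof. by move=> Mf Mg; apply: MD => //; exact: MN. Qed.

Let Minv f : ~ mideal M f -> exists g, mideal M (g * f - 1).
Proof.
move=> nf; pose J : set A := [set x | exists g m, mideal M m /\ x = g * f + m].
have Jid : is_ideal J.
  split; first by exists 0, 0; rewrite mul0r addr0.
    move=> _ _ [g [m [Mm ->]]] [g' [m' [Mm' ->]]]; exists (g + g'), (m + m').
    by rewrite mulrDl addrACA; split=> //; exact: MD.
  move=> x _ [g [m [Mm ->]]]; exists (x * g), (x * m); rewrite mulrDr mulrA; split=> //.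
  exact: MM.
have [[g [m [Mm E]]]|nJ] := pselect (J 1).
  exists g; have -> : g * f - 1 = - m by rewrite E opprD addrA subrr sub0r.
  exact: MN.
exfalso; apply: nf; have [_ _ Mmax] : is_maximal_ideal (mideal M) by case: M.
apply: (Mmax J) => // [x Mx|]; first by exists 0, x; rewrite mul0r add0r.
by exists 1, 0; rewrite mul1r addr0.
Qed.

Let Mprime f g : mideal M (f * g) -> mideal M f \/ mideal M g.
Proof.
move=> Mfg; have [|nf] := pselect (mideal M f); [by left|right].
have [u Mu] := Minv nf.
have -> : g = u * (f * g) - (u * f - 1) * g by rewrite mulrBl mul1r mulrA opprB addrC subrK.
by apply: MB; [exact: MM|rewrite mulrC; exact: MM].
Qed.

(* Otherwise every [t_i - c] has an inverse modulo [M]; since there are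
   uncountably many [c], infinitely many of these inverses share a finite
   support, so they are linearly dependent, and clearing denominators puts a
   nonzero polynomial in [t_i] into [M]. *)
Lemma lvar_residue i : exists c, mideal M (lvar i - lconst c).
Proof.
apply: contrapT => /forallNP nM; have inv c := Minv (nM c).
have [g gP] := choice inv.
(* Only real values of [c] are considered; supports are finite sets of exponents and form a
   countable type. *)
have [F Finf] := infinite_fiber (fun x : R => fsset (g (real_complex R x))).
have [D DF Dn] := infinite_set_fset #|` F|.+1 Finf.
have [s [us sD ss]] : exists s : seq R, [/\ uniq s, {subset s <= D} & size s = #|` F|.+1].
  exists (take #|` F|.+1 D); split; first exact: (take_uniq _ (fset_uniq D)).
    by move=> x /mem_take.
  by rewrite size_take_min; apply/minn_idPl.
pose c (j : 'I_#|` F|.+1) : C := real_complex R (nth 0 s j).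
have cinj : injective c.
  move=> j j' /fmorph_inj /eqP; rewrite nth_uniq ?ss // => /eqP; exact: val_inj.
have cF j : fsset (g (c j)) = F.
  have : nth 0 s j \in D by apply: sD; apply: mem_nth; rewrite ss.
  by move=> jD; exact: (DF _ jD).
have Wfd : @fdim C A #|` F| [set f | fsset f = F].
  have <- : size (map (fun r => lmono r 1 : A) (enum_fset F)) = #|` F| by rewrite size_map.
  apply: fdim_span => f /= fF; rewrite (fsupp_decomp f) fF.
  rewrite big_seq; apply: span_sum => r rF.
  have -> : fsdelta r (f r) = f r *: lmono r 1 :> A.
    by rewrite -(linZ (@lmono_linear C k r)); congr fsdelta; rewrite [RHS]mulr1.
  by apply: spanZ; apply: span_sub; apply/mapP; exists r.
have [la [[j0 laj0] lag]] := Wfd (fun j => g (c j)) cF.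
(* The numerator of the sum of the [la j / (X - c j)], a combination that vanishes once the inverses
   [g (c j)] replace the fractions. Its value at [c j0] is [la j0] times a product of nonzero
   differences. *)
pose q : {poly C} := \sum_j la j *: \prod_(j' | j' != j) ('X - (c j')%:P).
have q0 : q != 0.
  apply: contra_neq laj0 => q0; have : q.[c j0] = 0 by rewrite q0 horner0.
  rewrite /q horner_sum (bigD1 j0) //= [X in _ + X]big1 ?addr0 => [|j jj0].
    rewrite hornerZ horner_prod => /eqP; rewrite mulf_eq0 => /orP[/eqP //|/prodf_eq0[j jj0]].
    by rewrite hornerXsubC subr_eq0 => /eqP /cinj e; rewrite e eqxx in jj0.
  rewrite hornerZ horner_prod (bigD1 j0) ?(eq_sym j0) //= hornerXsubC subrr mul0r.
  by rewrite mulr0.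
pose ev (p : {poly C}) : A := (map_poly lconst p).[lvar i].
have evX d : ev ('X - d%:P) = lvar i - lconst d by rewrite /ev map_polyXsubC hornerXsubC.
have evp (J : finType) (P : pred J) (f : J -> {poly C}) :
    ev (\prod_(j | P j) f j) = \prod_(j | P j) ev (f j).
  by rewrite /ev rmorph_prod horner_prod.
pose Q := \prod_j (lvar i - lconst (c j)).
have Mq : mideal M (ev q).
  have -> : ev q = \sum_j lconst (la j) * \prod_(j' | j' != j) (lvar i - lconst (c j')).
    rewrite /ev /q raddf_sum horner_sum; apply: eq_bigr => j _ /=.
    rewrite map_polyZ hornerZ; congr (_ * _); rewrite -/(ev _) evp.
    by apply: eq_bigr => j' _; rewrite evX.
  have E : \sum_j lconst (la j) * g (c j) = 0.
    by rewrite -[RHS]lag; apply: eq_bigr => j _; rewrite lconst_scale.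
  rewrite (sum_mod_factor _ Q E); apply: (big_ind (mideal M)) => [|x y|j _]; [exact: M0|exact: MD|].
  apply: MM.
  rewrite (prod_resolvent (fun j => lvar i - lconst (c j))); apply: MN; apply: MM; exact: gP.
(* [M] is prime, so it would contain the value at [lvar i] of a linear factor of [q], against
   [nM]. *)
have [rs qE] := closed_field_poly_normal q.
have : mideal M (ev (\prod_(z <- rs) ('X - z%:P))).
  have lc0 : lead_coef q != 0 by rewrite lead_coef_eq0.
  have := MM (lconst (lead_coef q)^-1) Mq; rewrite {2}qE /ev map_polyZ hornerZ mulrA.
  by rewrite -rmorphM mulVf // rmorph1 mul1r.
elim: rs {qE} => [|z rs IH]; first by rewrite big_nil /ev rmorph1 hornerE.
rewrite big_cons /ev rmorphM hornerM => /Mprime[]; last exact: IH.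
by rewrite -/(ev _) evX; exact: nM.
Qed.

Lemma maxspec_point : exists a : 'I_k -> C, (forall i, a i != 0) /\
  forall f, mideal M (f - lconst (leval a f)).
Proof.
have [a aP] := choice lvar_residue.
have lvarV i : lmono (- zdelta i) 1 * lvar i = 1 :> A.
  by rewrite lmulE lmul_monom addNr mulr1.
have a0 i : a i != 0.
  apply/eqP => ai; apply: M1; rewrite -(lvarV i); apply: MM.
  by have := aP i; rewrite ai rmorph0 subr0.
exists a; split=> // f.
have Mr r : mideal M (lmono r 1 - lconst (mono a r)).
  elim/zk_ind: r => [|r i IH|r i IH]; first by rewrite mono0 rmorph1 subrr.
    have -> : lmono (r + zdelta i) 1 = lmono r 1 * lvar i :> A.
      by rewrite lmulE lmul_monom mulr1.
    rewrite monoD // mono_zdelta rmorphM.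
    by rewrite prod_congruence; apply: MD; apply: MM; [exact: aP|exact: IH].
  have -> : lmono (r - zdelta i) 1 = lmono (- zdelta i) 1 * lmono r 1 :> A.
    by rewrite lmulE lmul_monom mulr1 addrC.
  have mE : mono a r = a i * mono a (r - zdelta i).
    by rewrite -(mono_zdelta a i) -monoD // addrC subrK.
  rewrite (quotient_congruence _ (lconst (a i)) _ (lvarV i)) -rmorphM -mE.
  by apply: MB; apply: MM; [exact: IH|exact: aP].
rewrite {1}(fsupp_decomp f) /leval rmorph_sum -sumrB.
apply: (big_ind (mideal M)) => [|x y|r _]; [exact: M0|exact: MD|].
have -> : fsdelta r (f r) = lconst (f r) * lmono r 1 :> A.
  by rewrite lmulE lmul_monom add0r mulr1.
by rewrite rmorphM -mulrBr; apply: MM; exact: Mr.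
Qed.

(** The residues of the variables form a point where [M] vanishes, so the choice made in [mpoint]
    meets its specification; the elements [t_i - a_i] of [M] force it to be that point. *)
Lemma mpoint_ideal f : mideal M f <-> leval (mpoint M) f = 0.
Proof.
have [a [a0 aP]] := maxspec_point.
have aM g : mideal M g <-> leval a g = 0.
  split=> [Mg|g0]; last by have := aP g; rewrite g0 rmorph0 subr0.
  apply/eqP/negP => /negP g0; apply: M1.
  have := MM (lconst (leval a g)^-1) (MB Mg (aP g)).
  by rewrite opprB addrC subrK -rmorphM mulVf // rmorph1.
suff -> : mpoint M = a by [].
have [_ Ma] : (forall i, mpoint M i != 0) /\ forall g, mideal M g -> leval (mpoint M) g = 0.
  by rewrite /mpoint; case: xgetP => // /(_ a) []; split=> // g /aM.
apply/funext => i; have lv b : leval b (lvar i - lconst (a i)) = b i - a i :> C.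
  rewrite (linB (leval_linear b)) !leval_mono mono_zdelta mono0 mul1r.
  by rewrite mulr1.
have : leval (mpoint M) (lvar i - lconst (a i)) = 0.
  by apply: Ma; apply/aM; rewrite lv subrr.
by rewrite lv => /eqP; rewrite subr_eq0 => /eqP.
Qed.

End Point.

Lemma mpoint_inj : injective (@mpoint C k).
Proof.
move=> M M' MM'; have : mideal M = mideal M'.
  by apply/seteqP; split=> f /mpoint_ideal Mf; apply/mpoint_ideal; rewrite -Mf MM'.
case: M M' {MM'} => I Imax [I' I'max] /= II'; subst I'; congr MaxSpec.
exact: Prop_irrelevance.
Qed.

(** The inverse arises because [t_i - m_i] in [M] is carried to [b_i t_i - m_i], which vanishes at
    the new point. *)
Lemma mpoint_torus (b : torus C k) (M : maxspec C k) i :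
  mpoint (torus_act b M) i = (val b i)^-1 * mpoint M i.
Proof.
have Mf : mideal M (lvar i - lconst (mpoint M i)).
  apply/mpoint_ideal; rewrite (linB (leval_linear _)) !leval_mono mono_zdelta mono0.
  by rewrite mul1r mulr1 subrr.
have : mideal (torus_act b M) (tscale b (lvar i - lconst (mpoint M i))) by exists (lvar i - lconst (mpoint M i)).
move/mpoint_ideal; rewrite (linB (tscale_linear b)) !tscale_mono (linB (leval_linear _)).
rewrite !leval_mono !mono_zdelta !mono0 mul1r !mulr1 => /eqP; rewrite subr_eq0 => /eqP <-.
by rewrite mulrA mulVf ?mul1r // torus_neq0.
Qed.

End Nullstellensatz.

(** * Spectral classes *)

Section Characters.
Variables (C : fieldType) (k : nat).

Lemma mono_inj (a b : 'I_k -> C) : mono a = mono b -> a = b.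
Proof.
by move=> ab; apply/funext => i; rewrite -(mono_zdelta a) -(mono_zdelta b) ab.
Qed.

(** Independence of characters: they are eigenvectors of the translations with distinct eigenvalues.
    Points may repeat in the family, so only the total weight at each point is determined. *)
Lemma mono_indep (J : finType) (pt : J -> 'I_k -> C) (w : J -> C) (a : 'I_k -> C) :
  (forall j i, pt j i != 0) -> (forall r, \sum_j w j * mono (pt j) r = 0) ->
  \sum_(j | `[< pt j = a >]) w j = 0.
Proof.
move=> pt0 w0; pose V : lmodType C := (zk k -> C^o)%type.
pose T (r : zk k) (F : V) : V := fun s => F (s + r).
have Tl r : linear (T r) by [].
have Tcom i j F : T i (T j F) = T j (T i F) by apply/funext => s; rewrite /T addrAC.
have T2 i j F := @comm2_commuting C V _ T setT Tl (fun _ _ _ => I)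
  (fun i j F _ => Tcom i j F) i j F I.
have z0 (i : zk k) (x : V) : [set (0 : V)] x -> [set (0 : V)] (T i x) by move=> ->.
pose F j : V := fun s => w j * mono (pt j) s.
have jF j : jgen T (mono (pt j)) (F j).
  move=> r; apply: geig_eig; apply/funext => s.
  transitivity (mono (pt j) r * (w j * mono (pt j) s)); last by [].
  by rewrite /T /F (monoD _ _ (pt0 j)) [mono _ s * _]mulrC mulrCA.
have sumE (P : pred J) s : (\sum_(j | P j) F j) s = \sum_(j | P j) w j * mono (pt j) s.
  by elim/big_rec2: _ => // j y1 y2 _ <-.
have := jgen_componentT Tl T2 [set mono a] (subspace0 V) z0 jF.
have -> : \sum_j F j = 0 by apply/funext => s; rewrite sumE w0.
move=> /(_ erefl) S0.
have S00 : \sum_(j | `[< [set mono a] (mono (pt j)) >]) w j * mono (pt j) 0 = 0.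
  by rewrite -sumE S0.
rewrite -[RHS]S00; apply: eq_big => [j|j _]; last by rewrite mono0 mulr1.
by apply: asbool_equiv_eq; split=> [->|/mono_inj].
Qed.

End Characters.

(** If all sums with [n > 0] vanished, summing [d j * P(y j)] for [P] the product of the [X - y j]
    would leave [P(0)] times the sum of the [d j]; but this sum is 0 and [P(0)] is not. *)
Lemma exponential_sum (C : fieldType) (J : finType) (d y : J -> C) :
  (forall j, y j != 0) -> \sum_j d j != 0 ->
  exists n, (0 < n)%N /\ \sum_j d j * y j ^+ n != 0.
Proof.
move=> y0 d0; apply: contrapT => /forallNP H.
have {H} H n : (0 < n)%N -> \sum_j d j * y j ^+ n = 0.
  by move=> n0; apply/eqP/negP => /negP nz; apply: (H n).
pose P : {poly C} := \prod_j ('X - (y j)%:P).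
have P0 : P.[0] != 0.
  rewrite horner_prod; apply/prodf_neq0 => j _.
  by rewrite hornerXsubC sub0r oppr_eq0.
have Py j : P.[y j] = 0 by rewrite horner_prod (bigD1 j) //= hornerXsubC subrr mul0r.
have : \sum_j d j * P.[y j] = 0 by rewrite big1 // => j _; rewrite Py mulr0.
under eq_bigr do rewrite horner_coef mulr_sumr.
rewrite exchange_big /=; case sP : (size P) => [|m].
  by move: P0; move/eqP: sP; rewrite size_poly_eq0 => /eqP ->; rewrite horner0 eqxx.
rewrite big_ord_recl [X in _ + X]big1 ?addr0 => [|i _]; last first.
  by under eq_bigr do rewrite mulrCA; rewrite -mulr_sumr H ?mulr0.
under eq_bigr do rewrite mulrCA expr0 mulr1.
move=> /eqP; rewrite -mulr_sumr mulf_eq0 (negPf d0) orbF -horner_coef0 (negPf P0).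
by [].
Qed.

Section SpectralClasses.
Variables (R : realType) (G : simpleLie R) (k : nat).
Local Notation C := R[i].
Local Notation h := (hfin G).
Implicit Types (p : PiSet G k).

(* the joint eigenvalues in the torus orbit of the class of [pi_eig p] modulo
   the root lattice at every point *)
Definition spectral_class p : set (idx G k -> C) :=
  [set eta | exists (b : 'I_k -> C) (J : finType) (la : J -> hdual h) (M : J -> 'I_k -> C),
    [/\ forall i, b i != 0, forall q, Qlat (la q), forall q i, M q i != 0 &
      forall o r, eta (o, r) = mono b r * pi_eig p (o, r)
        + (if o is Some t then \sum_q la q t * mono (M q) r else 0)]].

Lemma mono_mul (a b : 'I_k -> C) r : mono (fun i => a i * b i) r = mono a r * mono b r.
Proof. by rewrite /mono -big_split; apply: eq_bigr => i _; rewrite expfzMl. Qed.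

Lemma spectral_class_id p : spectral_class p (pi_eig p).
Proof.
exists (fun=> 1), void, (fun=> 0), (fun _ _ => 1); split=> //.
- by move=> i; exact: oner_neq0.
- move=> o r; rewrite [mono _ r]big1 ?mul1r => [|i _]; last by rewrite exp1rz.
  by case: o => [t|]; rewrite ?addr0 // big1 ?addr0 // => -[].
Qed.

Lemma spectral_class_twist p : twist_stable (spectral_class p).
Proof.
move=> c eta c0 [b [J [la [M [b0 Ql M0 E]]]]].
exists (fun i => c i * b i), J, la, (fun q i => c i * M q i); split.
- by move=> i; rewrite mulf_neq0.
- exact: Ql.
- by move=> q i; rewrite mulf_neq0.
move=> o r; rewrite /twist /= E mulrDr mono_mul mulrA; congr (_ + _).
case: o => [t|]; last by rewrite mulr0.
by rewrite mulr_sumr; apply: eq_bigr => q _; rewrite mono_mul mulrCA.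
Qed.

Lemma twistK (b : 'I_k -> C) (eta : idx G k -> C) : (forall i, b i != 0) ->
  twist (fun i => (b i)^-1) (twist b eta) = eta.
Proof.
move=> b0; apply/funext => -[o r]; rewrite /twist /= mulrA -mono_mul /mono big1 ?mul1r // => i _.
by rewrite mulVf // exp1rz.
Qed.

Lemma spectral_class_twistC p : twist_stable (~` spectral_class p).
Proof.
move=> b eta b0 neta; apply: contra_not neta => /(@spectral_class_twist _ (fun i => (b i)^-1)).
by rewrite twistK //; apply=> i; rewrite invr_eq0.
Qed.

Lemma spectral_class_shift p : shift_stable (spectral_class p).
Proof.
move=> mu N eta Qmu N0 [b [J [la [M [b0 Ql M0 E]]]]].
exists b, (J + 'I_1)%type, (fun q => if q is inl q' then la q' else mu),
  (fun q => if q is inl q' then M q' else N); split=> //; try by case.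
case=> [t|] r; rewrite /shift_eig /= E ?addr0 //.
by rewrite big_sumType /= big_ord1 addrA.
Qed.

Lemma Qlat_opp (la : hdual h) : Qlat la -> Qlat (- la).
Proof.
by case=> c ->; exists (fun i => - c i); rewrite -sumrN; apply: eq_bigr => i _; rewrite mulrNz.
Qed.

Lemma Qlat_sum (J : finType) (P : pred J) (la : J -> hdual h) :
  (forall q, P q -> Qlat (la q)) -> Qlat (\sum_(q | P q) la q).
Proof.
move=> Ql; elim/big_ind: _ => [|_ _ [c ->] [d ->]|q]; last exact: Ql.
  by exists (fun=> 0); rewrite big1 // => i _.
by exists (fun i => c i + d i); rewrite -big_split; apply: eq_bigr => i _; rewrite mulrzDr.
Qed.

Lemma shift_eigK (la : hdual h) (M : 'I_k -> C) (eta : idx G k -> C) :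
  shift_eig (shift_eig eta la M) (- la) M = eta.
Proof.
apply/funext => -[[t|] r]; rewrite /shift_eig /= ?addr0 //.
by rewrite opp_lfunE mulNr addrK.
Qed.

Lemma spectral_class_shiftC p : shift_stable (~` spectral_class p).
Proof.
move=> la M eta Ql M0 neta; apply: contra_not neta => H.
rewrite -(shift_eigK la M eta).
by apply: spectral_class_shift => //; exact: Qlat_opp.
Qed.

Lemma supp_sum p (N : maxspec C k) (x : haff G) :
  \sum_(M : pi_supp p | mpoint (val M) == mpoint N) (p (val M) x : C) = p N x.
Proof.
have [Np|Np] := boolP (N \in pi_supp p).
  rewrite (bigD1 [` Np]%fset) //= big1 ?addr0 // => M /andP[/eqP /mpoint_inj MN].
  by case/eqP; apply: val_inj.
rewrite big1 => [|M /eqP /mpoint_inj MN]; last by rewrite -MN (valP M) in Np.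
move: Np; rewrite in_fset_set; last exact: pi_finite.
by rewrite notin_setE /= => /negP /negPn /eqP ->; rewrite lfunE.
Qed.

(** An equality of combinations of characters can be compared point by point: the terms of [p] at
    [N] match those of [p'] at the rescaled point up to the elements of the root lattice placed at
    [N]. *)
Lemma same_orbit_spectral p p' : spectral_class p' (pi_eig p) -> same_orbit (chi p) (chi p').
Proof.
move=> [b [J [la [M [b0 Ql M0 E]]]]].
have bV : [forall i, [ffun i => (b i)^-1] i != 0].
  by apply/forallP => i; rewrite ffunE invr_eq0.
(* The inverse of [b], because the torus acts on points through inverses. *)
pose be : torus C k := exist (fun b : {ffun 'I_k -> C} => [forall i, b i != 0]) _ bV.
exists be => N'; set N := torus_act be N'.
have NE : mpoint N = (fun i => b i * mpoint N' i).
  by apply/funext => i; rewrite mpoint_torus /= ffunE invrK.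
pose ev (o : option (subvs_of h)) := if o is Some t then haff_h t else haff_K G.
pose pt (q : pi_supp p + (pi_supp p' + J)) : 'I_k -> C := match q with
  | inl L => mpoint (val L)
  | inr (inl L) => fun i => b i * mpoint (val L) i
  | inr (inr q) => M q end.
(* For [o = None] this compares levels; for [o = Some t] it compares weights modulo the root
   lattice. *)
have key o : p N (ev o) = p' N' (ev o) + (if o is Some t then
    (\sum_(q | `[< M q = mpoint N >]) la q : hdual h) t else 0) :> C.
  pose w (q : pi_supp p + (pi_supp p' + J)) : C := match q with
    | inl L => p (val L) (ev o)
    | inr (inl L) => - p' (val L) (ev o)
    | inr (inr q) => - (if o is Some t then la q t else 0) end.
  have pt0 q i : pt q i != 0.
    by case: q => [L|[L|q]] /=; rewrite ?mulf_neq0 ?mpoint_neq0.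
  have wpt r : \sum_q w q * mono (pt q) r = 0.
    rewrite !big_sumType /=; have := E o r; rewrite /pi_eig /= -/(ev o) => Eo.
    under eq_bigr do rewrite mulrC.
    rewrite Eo.
    have -> : \sum_(L : pi_supp p') - p' (val L) (ev o) * mono (fun i => b i * mpoint (val L) i) r
        = - (mono b r * \sum_(L : pi_supp p') mono (mpoint (val L)) r * (p' (val L) (ev o) : C)).
      rewrite mulr_sumr -sumrN; apply: eq_bigr => L _; rewrite mono_mul mulNr.
      by congr (- _); rewrite [RHS]mulrA mulrC.
    have -> : \sum_q - (if o is Some t then la q t else 0) * mono (M q) r
        = - (if o is Some t then \sum_q la q t * mono (M q) r else 0).
      case: o {w Eo} => [t|]; last first.
        by rewrite big1 ?oppr0 // => q _; rewrite mul0r.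
      by rewrite -sumrN; apply: eq_bigr => q _; rewrite mulNr.
    by rewrite -opprD subrr.
  have := mono_indep (mpoint N) pt0 wpt; rewrite big_mkcond !big_sumType /=.
  have -> : \sum_(L : pi_supp p) (if `[< mpoint (val L) = mpoint N >] then p (val L) (ev o) else 0 : C)
      = p N (ev o).
    rewrite -(supp_sum p N) [RHS]big_mkcond; apply: eq_bigr => L _.
    by case: asboolP => [->|/eqP /negPf ->]; rewrite ?eqxx.
  have -> : \sum_(L : pi_supp p') (if `[< (fun i => b i * mpoint (val L) i) = mpoint N >]
        then - p' (val L) (ev o) else 0 : C) = - (p' N' (ev o) : C).
    rewrite -(supp_sum p' N'). rewrite -sumrN [RHS]big_mkcond; apply: eq_bigr => L _.
    have -> : `[< (fun i => b i * mpoint (val L) i) = mpoint N >] = (mpoint (val L) == mpoint N').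
      apply/asboolP/eqP => [LN|->]; last by rewrite NE.
      by apply/funext => i; apply: (mulfI (b0 i)); rewrite -[RHS](congr1 (@^~ i) NE) -LN.
    by [].
  have -> : \sum_q (if `[< M q = mpoint N >] then - (if o is Some t then la q t else 0) else 0 : C)
      = - (if o is Some t then (\sum_(q | `[< M q = mpoint N >]) la q : hdual h) t else 0).
    case: o {w wpt} => [t|]; last by rewrite big1 ?oppr0 // => q _; case: ifP.
    by rewrite -big_mkcond sum_lfunE -sumrN.
  by move=> /eqP; rewrite -opprD subr_eq0 => /eqP.
congr pair.
  have K := key None; rewrite /= addr0 in K.
  by rewrite /level; congr (xget 0 _); apply/seteqP; split=> z /=; rewrite -K.
rewrite /weight_class; apply/esym/eqP.
rewrite -(Quotient.idealrBE (@Qfin_pred R G)); apply/asboolP.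
have [c cE] : Qlat (\sum_(q | `[< M q = mpoint N >]) la q).
  by apply: Qlat_sum => q _; exact: Ql.
exists c; rewrite -cE -[LHS]/(restr_h (p N) - restr_h (p' N')).
apply/lfunP => t; rewrite add_lfunE opp_lfunE !restr_hE.
by have := key (Some t) => /= ->; rewrite addrC addKr.
Qed.

End SpectralClasses.

(** * Weights and levels of the objects of the category *)

Section Category.
Variables (R : realType) (G : simpleLie R) (k : nat).
Local Notation C := R[i].
Local Notation h := (hfin G).

Lemma sub_weight (E : tmod G k.+1) (W : set E) (HW : is_submod W) mu ka de (x : submod HW) :
  weight_space mu ka de x <-> weight_space mu ka de (sub_val x).
Proof.
split=> -[hv Kv dv]; split=> i; last 3 first.
- by apply: val_inj; exact: hv.
- by apply: val_inj; exact: Kv.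
- by apply: val_inj; exact: dv.
- by have := congr1 (@sub_val _ _ _ _ _ _) (hv i).
- by have := congr1 (@sub_val _ _ _ _ _ _) (Kv i).
- by have := congr1 (@sub_val _ _ _ _ _ _) (dv i).
Qed.

Section Components.
Variables (E : tmod G k.+1) (N : nat) (W : nat -> set E).
Hypothesis HW : forall m, is_submod (W m).
Hypothesis HJ : forall m, (0 < m < N)%N -> J_int m (submod (HW m)).
Hypothesis Wsum : forall v, exists w : nat -> E, (forall m, W m (w m)) /\
  v = \sum_(1 <= m < N) w m.
Hypothesis Wdirect : forall w : nat -> E, (forall m, W m (w m)) ->
  \sum_(1 <= m < N) w m = 0 -> forall m, (0 < m < N)%N -> w m = 0.

Lemma component_eigen u (c : C) (w : nat -> E) : (forall m, W m (w m)) ->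
  act u (\sum_(1 <= m < N) w m) = c *: \sum_(1 <= m < N) w m ->
  forall m, (0 < m < N)%N -> act u (w m) = c *: w m.
Proof.
move=> Ww uw m mN; apply/eqP; rewrite -subr_eq0; apply/eqP.
apply: (@Wdirect (fun m => act u (w m) - c *: w m)) => // [j|].
  have [[_ Wl] WA] := HW j; rewrite addrC -scaleNr; apply: Wl => //; exact: WA.
by rewrite sumrB -scaler_sumr -uw (lin_sum (act_linear u)) subrr.
Qed.

Lemma component_neq0 (w : nat -> E) : \sum_(1 <= m < N) w m != 0 ->
  exists2 m, (0 < m < N)%N & w m != 0.
Proof.
move=> v0; apply: contrapT => H; move/eqP: v0; apply; rewrite big_nat big1 // => m mN.
by apply/eqP; apply: contrapT => /negP wm; apply: H; exists m.
Qed.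

Let el m (v : E) (Wv : W m v) : submod (HW m) := SubElt (asboolT Wv : v \in sub_pred (HW m)).

Let el_neq0 m (v : E) (Wv : W m v) : v != 0 -> el Wv != 0.
Proof. by apply: contra_neq => e; have := congr1 (@sub_val _ _ _ _ _ _) e. Qed.

Lemma components_tame : tame E.
Proof.
split.
- pose P (v : E) := exists s : seq E, v = \sum_(w <- s) w /\
    forall w, w \in s -> exists mu ka de, weight_space mu ka de w.
  have P0 : P 0 by exists [::]; rewrite big_nil.
  have PD u v : P u -> P v -> P (u + v).
    move=> [s [-> sw]] [s' [-> sw']]; exists (s ++ s'); rewrite big_cat; split=> // w.
    by rewrite mem_cat => /orP[]; [exact: sw|exact: sw'].
  move=> v; have [w [Ww ->]] := Wsum v; rewrite -/(P _) big_nat.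
  apply: (big_ind P) => // m mN; have [[diag _] _ _ _ _] := HJ mN.
  have [s [sE sw]] := diag (el (Ww m)); exists [seq sub_val x | x <- s]; split.
    by rewrite big_map -sub_val_sum -sE.
  move=> _ /mapP[x xs ->]; have [mu [ka [de xw]]] := sw _ xs.
  by exists mu, ka, de; exact/sub_weight.
- move=> i c v; have [w [Ww ->]] := Wsum v => /component_neq0[m mN wm] dv.
  have [_ int _ _ _] := HJ mN; apply: (int i c (el (Ww m)) (el_neq0 _ wm)).
  by apply: val_inj; exact: component_eigen dv _ mN.
- move=> mu ka de.
  have sP m : exists s : seq E, (0 < m < N)%N ->
      forall v, W m v -> weight_space mu ka de v -> v \in span_pred [set` s].
    have [mN|] := boolP (0 < m < N)%N; last by exists [::].
    have [_ _ _ fd _] := HJ mN; have [s sP] := fd mu ka de.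
    exists [seq sub_val x | x <- s] => _ v Wv wv.
    have wx : weight_space mu ka de (el Wv) by exact/sub_weight.
    have svl : linear (@sub_val _ _ _ _ _ (HW m)) by [].
    rewrite -[v]/(sub_val (el Wv)); apply: (span_map svl) (sP _ wx) => x xs.
    by apply: span_sub; exact: map_f.
  have [s {}sP] := choice sP; exists (flatten [seq s m | m <- index_iota 1 N]) => v.
  have [w [Ww ->]] := Wsum v; move=> [hv Kv dv]; rewrite big_seq.
  apply: span_sum => m; rewrite mem_index_iota => mN.
  apply: (@span_mono _ _ [set` s m]).
    move=> x xs; apply/flattenP; exists (s m) => //; apply: map_f.
    by rewrite mem_index_iota.
  apply: sP => //; split=> i; exact: component_eigen _ mN.
Qed.

(** A nonzero vector has a nonzero component, on which [K_1] acts by a positive integer. The periods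
    rely on this nonvanishing of the level. *)
Lemma components_level (v : E) c : v != 0 -> act (GK G 0 ord0) v = c *: v -> c != 0.
Proof.
have [w [Ww ->]] := Wsum v => /component_neq0[m mN wm] Kv.
have [_ _ _ _ K1] := HJ mN; have [+ _] := K1 (el (Ww m)).
move=> /(congr1 (@sub_val _ _ _ _ _ _)) /= Km.
have := component_eigen Ww Kv mN; rewrite Km => /eqP; rewrite -subr_eq0 -scalerBl.
rewrite scaler_eq0 (negPf wm) orbF subr_eq0 => /eqP <-.
by rewrite pnatr_eq0 -lt0n; case/andP: mN.
Qed.

End Components.

Lemma J_plus_tame (E : tmod G k.+1) : J_plus E -> tame E.
Proof. by move=> [N [W [HW [HJ Ws Wd]]]]; exact: (components_tame HJ Ws Wd). Qed.

Lemma J_plus_level (E : tmod G k.+1) (v : E) (c : C) : J_plus E -> v != 0 ->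
  act (GK G 0 ord0) v = c *: v -> c != 0.
Proof. by move=> [N [W [HW [HJ Ws Wd]]]]; exact: (components_level HJ Ws Wd). Qed.

End Category.

(** * Vanishing of extensions and linkage *)

Section Main.
Variables (R : realType) (G : simpleLie R) (k : nat).
Local Notation C := R[i].
Local Notation h := (hfin G).
Implicit Types (p : PiSet G k).

Lemma mono_zdelta_muln (a : 'I_k -> C) i n : mono a (zdelta i *+ n) = a i ^+ n.
Proof.
elim: n => [|n IH]; first by rewrite mulr0n mono0 expr0.
rewrite -[RHS]exprnP /mono (bigD1 i) //= big1 => [|j ji].
  by rewrite ffunMnE ffunE eqxx mulr1 natz.
by rewrite ffunMnE ffunE (negPf ji) mul0rn expr0z.
Qed.

Lemma mono_opp (a : 'I_k -> C) r : mono a (- r) = (mono a r)^-1.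
Proof. by rewrite /mono -prodfV; apply: eq_bigr => i _; rewrite ffunE invr_expz. Qed.

(** The product is the sum over pairs of points of [c M * c M'] times the [n]-th power of a ratio of
    coordinates. The coefficients add up to the square of the level, so [exponential_sum]
    applies. *)
Lemma level_period p i : pi_eig p (None, 0) != 0 ->
  exists n, (0 < n)%N /\
    pi_eig p (None, zdelta i *+ n) * pi_eig p (None, - (zdelta i *+ n)) != 0.
Proof.
set c := fun M : pi_supp p => p (val M) (haff_K G) : C.
set a := fun M : pi_supp p => mpoint (val M) i.
have a0 M : a M != 0 by exact: mpoint_neq0.
have eigE r : pi_eig p (None, r) = \sum_M mono (mpoint (val M)) r * c M by [].
move=> p0; have c0 : \sum_(J : pi_supp p * pi_supp p) c J.1 * c J.2 != 0.
  rewrite -(pair_bigA _ (fun M M' => c M * c M')) /= -big_distrlr /=.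
  suff -> : \sum_M c M = pi_eig p (None, 0) by rewrite mulf_neq0.
  by rewrite eigE; apply: eq_bigr => M _; rewrite mono0 mul1r.
have y0 (J : pi_supp p * pi_supp p) : a J.1 / a J.2 != 0 by rewrite mulf_neq0 ?invr_eq0.
have [n [n0 nP]] := exponential_sum y0 c0; exists n; split=> //.
apply: contra_neq nP => Z; rewrite -[RHS]Z !eigE big_distrlr /= pair_bigA /=.
apply: eq_bigr => J _; rewrite mono_opp !mono_zdelta_muln -/(a J.1) -/(a J.2).
by rewrite expr_div_n [RHS]mulrACA [LHS]mulrC.
Qed.

Variable X : forall la : haff_dual G, Paff_plus la -> hwmod la.

Lemma Xpi_level p g : J_plus (Xpi_mod X p g) -> Xpi_v0 X p g != 0 -> pi_eig p (None, 0) != 0.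
Proof.
move=> J v0; apply: (J_plus_level J v0); apply: val_inj.
by have := Lpi_igen X p (None, 0) (ttail g); rewrite /igen /= zcons00 addr0.
Qed.

Lemma Xpi_spectral p p' g : J_plus (Xpi_mod X p g) -> Xpi_v0 X p g != 0 ->
  ~ same_orbit (chi p) (chi p') ->
  exists l : 'I_k -> nat, [/\ forall i, (0 < l i)%N, invertible l (Xpi_mod X p g) &
    forall v : Xpi_mod X p g, Ecomp l (~` spectral_class p') v].
Proof.
move=> J v0 pp'; have [l lP] := choice (fun i => level_period i (Xpi_level J v0)).
have l0 i : (0 < l i)%N by have [] := lP i.
have Xi : invertible l (Xpi_mod X p g).
  by split=> [|i]; [exact: J_plus_tame|apply: Xpi_inv; have [] := lP i].
exists l; split=> //; apply: Xpi_Ecomp => //.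
- exact: spectral_class_twistC.
- exact: spectral_class_shiftC.
- by move=> /same_orbit_spectral.
Qed.

Lemma spectral_Ecomp_splitting (l : 'I_k -> nat) p : (forall i, (0 < l i)%N) ->
  natural_splitting (invertible l) (fun E => @Ecomp R G k l E (spectral_class p))
    (fun E => @Ecomp R G k l E (~` spectral_class p)).
Proof.
move=> l0; apply: Ecomp_splitting => //.
- exact: spectral_class_twist.
- exact: spectral_class_twistC.
- exact: spectral_class_shift.
- exact: spectral_class_shiftC.
Qed.

Lemma Ext1_zero_spectral (l : 'I_k -> nat) (V : tmod G k.+1) p s : (forall i, (0 < l i)%N) ->
  invertible l V -> (forall v : V, Ecomp l (~` spectral_class p) v) ->
  J_plus (Xpi_mod X p s) -> Ext1_zero V (Xpi_mod X p s).
Proof.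
move=> l0 Vi VK JX E JE; have [Vt Vinv] := Vi; have Et := J_plus_tame JE.
have Xt := J_plus_tame JX.
pose q i := pi_eig p (None, per l i) * pi_eig p (None, - per l i).
have [/forallP q0|nq] := boolP [forall i, q i != 0]; last first.
  have /forallPn[i /negPn /eqP qi] := nq.
  exact: (natural_splitting_ext (@fitting_splitting R G k (per l i)) Et Vt (Vinv i)
    (@Xpi_nil R G k X p s (per l i) qi)).
have Xi : invertible l (Xpi_mod X p s) by split=> [|i]; [exact: Xt|apply: Xpi_inv; exact: q0].
(* The nilpotent part of a vector of [E] dies in [V], so it comes from the submodule, where the
   operator is invertible too; hence it is 0. *)
have Ei : invertible l E.
  split=> // i e; have [_ _ fs fh] := @fitting_splitting R G k (per l i).
  have [a [b [an bi ->]]] := fs _ Et e.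
  have /(ext_exact a)[x xa] : ext_proj a = 0.
    by apply: nil_inv_indep (Vinv i _); have [+ _] := fh _ _ _ a (ext_proj_hom E); apply.
  suff -> : a = 0 by rewrite add0r.
  apply: nil_inv_indep an _; rewrite -xa.
  by have [_ +] := fh _ _ _ x (ext_inj_hom E); apply; have [_ +] := Xi; apply.
apply: (natural_splitting_ext (spectral_Ecomp_splitting p l0) Ei Vi VK) => x.
apply: Xpi_Ecomp => //.
- exact: spectral_class_twist.
- exact: spectral_class_shift.
- exact: spectral_class_id.
Qed.

Lemma Ext1_zero_trivial (V W : tmod G k.+1) : (forall v : V, v = 0) -> Ext1_zero V W.
Proof.
move=> V0 E _; apply: (@ext_split_criterion _ _ _ _ _ _ [set 0]) => [|x|e]; first exact: submod0.
- by move=> x0; apply: (@ext_injective _ _ _ _ _ E); rewrite x0 (lin0 (ext_inj_hom E).1).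
- have /(ext_exact e)[x <-] := V0 (ext_proj e).
  by exists x; rewrite subrr.
Qed.

(** The chain is walked from [V] to [U]. Each step first carries invertibility over by the Fitting
    splittings, because the splitting by eigenvalues is available between invertible modules. *)
Lemma linked_spectral (l : 'I_k -> nat) p (U V : tmod G k.+1) : (forall i, (0 < l i)%N) ->
  linked U V -> invertible l V -> (forall v : V, Ecomp l (~` spectral_class p) v) ->
  invertible l U /\ forall u : U, Ecomp l (~` spectral_class p) u.
Proof.
move=> l0 [r [S [<- <- Sind Shom]]] Vi VK.
have St i : (i <= r)%N -> tame (S i) by move=> /Sind[/J_plus_tame].
suff H j : (j <= r)%N -> invertible l (S (r - j)%N) /\
    forall u : S (r - j)%N, Ecomp l (~` spectral_class p) u.
  by have := H r (leqnn r); rewrite subnn.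
elim: j => [|j IH] jr; first by rewrite subn0.
have [Wi WK] := IH (ltnW jr); have jr1 : (r - j.+1).+1 = (r - j)%N by rewrite subnSK.
have jr' : (r - j.+1 < r)%N by rewrite jr1 leq_subr.
have := Shom _ jr'; rewrite jr1 => /or_comm Hom; have [_ ind] := Sind _ (ltnW jr').
have Ui : invertible l (S (r - j.+1)%N).
  split=> [|i]; first exact/St/ltnW.
  have Wt : tame (S (r - j)%N) by apply: St; exact: leq_subr.
  have Ut : tame (S (r - j.+1)%N) by apply: St; exact: ltnW.
  exact: (natural_splitting_link (@fitting_splitting R G k (per l i)) Wt Ut ind Hom (Wi.2 i)).
split=> //.
exact: (natural_splitting_link (spectral_Ecomp_splitting p l0) Wi Ui ind Hom WK).
Qed.

End Main.

Theorem proposition6p2 (R : realType) (G : simpleLie R) (k : nat)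
    (X : forall la : haff_dual G, Paff_plus la -> hwmod la)
    (pi psi : PiSet G k) :
  ~ same_orbit (chi pi) (chi psi) ->
  (forall g s : zk k.+1, g ord0 = 0%R -> s ord0 = 0%R ->
     J_plus (Xpi_mod X pi g) -> J_plus (Xpi_mod X psi s) ->
     Ext1_zero (Xpi_mod X pi g) (Xpi_mod X psi s)) /\
  (forall (V : tmod G k.+1) (g s : zk k.+1), g ord0 = 0%R -> s ord0 = 0%R ->
     J_plus (Xpi_mod X pi g) -> J_plus (Xpi_mod X psi s) ->
     linked V (Xpi_mod X pi g) ->
     Ext1_zero V (Xpi_mod X psi s)).
Proof.
move=> pp; split=> [g s _ _ Jg Js|V g s _ _ Jg Js VX].
  (* A zero generator is treated directly, in place of a proof that a tensor product of nonzero
     vectors is nonzero. *)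
  have [v0|v0] := eqVneq (Xpi_v0 X pi g) 0.
    by apply: Ext1_zero_trivial; apply: (Xpi_generated (W := [set 0])); first exact: submod0.
  have [l [l0 Xi XK]] := Xpi_spectral Jg v0 pp.
  exact: Ext1_zero_spectral Xi XK Js.
(* The last object of the chain is indecomposable, hence nonzero, and so is its generator. *)
have v0 : Xpi_v0 X pi g != 0.
  have [r [S [_ Sr Sind _]]] := VX; have [_] := Sind r (leqnn r); rewrite Sr => -[[v v_neq0] _].
  apply: contra_neq v_neq0 => v0.
  by apply: (Xpi_generated (W := [set 0])); first exact: submod0.
have [l [l0 Xi XK]] := Xpi_spectral Jg v0 pp.
have [Vi VK] := linked_spectral l0 VX Xi XK.
exact: Ext1_zero_spectral Vi VK Js.
Qed.
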